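(* Let $p>2$, $f\ge1$, $q=p^f$, $k=(k_0,\dots,k_{f-1})$ with $r_i=k_i-2>q+p-2$ for all $i$, and suppose $r=\sum_ir_ip^i\equiv p^h\pmod{q-1}$ for some $0\le h\le f-1$. Let $a_p$ lie in a finite extension of $\mathbb{Q}_{p^f}$ with $v(a_p)\in(0,1)$. Assume that either $v(a_p)\neq\frac12$, or $v(a_p)=\frac12$ and $\frac{a_p^2-pr_h}{p}$ is a $p$-adic unit. Then the natural surjection $\mathrm{ind}_{KZ}^G\mathrm{cosoc}(Q)\twoheadrightarrow F_t$ vanishes on $T(\mathrm{ind}_{KZ}^G\mathrm{cosoc}(Q))$, i.e. it factors through $T$.
   Context: Setting: $\mathbb{Q}_{p^f}$ unramified of degree $f$ over $\mathbb{Q}_p$, ring of integers $\mathbb{Z}_{p^f}$, residue field $\mathbb F_q$, Teichmüller lifts $[\lambda]$; $G=\mathrm{GL}_2(\mathbb{Q}_{p^f})$, $K=\mathrm{GL}_2(\mathbb{Z}_{p^f})$, $Z$ the center, $\Gamma=\mathrm{GL}_2(\mathbb F_q)$, $v(p)=1$. For a ring $R$, $V(R)=\bigotimes_{i=0}^{f-1}\mathrm{Sym}^{r_i}R^2$ is modeled on polynomials homogeneous of degree $r_i$ in $(X_i,Y_i)$; $\begin{pmatrix}a&b\\c&d\end{pmatrix}\in K$ acts by $v\mapsto v(a^{\sigma^i}X_i+c^{\sigma^i}Y_i,b^{\sigma^i}X_i+d^{\sigma^i}Y_i)$ ($\sigma$ Frobenius), $p\in Z$ acts trivially. $[g,v]\in\mathrm{ind}_{KZ}^GV$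 is supported on $KZg^{-1}$ with $g'\mapsto g'g\cdot v$. Hecke operator: $T([g,v])=\sum_{\lambda\in\mathbb F_q}[g\begin{pmatrix}p&[\lambda]\\0&1\end{pmatrix},v(X_i,(-[\lambda])^{p^i}X_i+pY_i)]+[g\begin{pmatrix}1&0\\0&p\end{pmatrix},v(pX_i,Y_i)]$; on the induction of a mod $p$ weight $\bigotimes\mathrm{Sym}^{s_i}\bar{\mathbb F}_p^2\otimes\det^m$, $T$ is given by the reduced formula $T([g,v])=\sum_\lambda[g\begin{pmatrix}p&[\lambda]\\0&1\end{pmatrix},v(X_i,(-\lambda)^{p^i}X_i)]+[g\begin{pmatrix}1&0\\0&p\end{pmatrix},v(0,Y_i)]$. For $a_p$ in a finite extension $E$ of $\mathbb{Q}_{p^f}$ (ring of integers $\mathcal O_E$, residue field $k_E$): $\Pi_{k,a_p}=\mathrm{ind}_{KZ}^GV(E)/(T-a_p)$, $\Theta_{k,a_p}$ = image of $\mathrm{ind}_{KZ}^GV(\mathcal O_E)$ in it, $\bar\Theta_{k,a_p}=\Theta_{k,a_p}\otimes k_E$; there is a natural surjection $\mathrm{ind}_{KZ}^GV_r\twoheadrightarrow\bar\Theta_{k,a_p}$ with $V_r=V(\bar{\mathbb F}_p)$. Let $\theta_i=X_iY_{i-1}^p-Y_iX_{i-1}^p$ (indices mod $f$), $V_r^*$ the subspace of $V_r$ of elements $\sum_i\theta_iP_i$, $X_r$ the $\Gamma$-submodule generated by $\prod_iX_i^{r_i}$, and $Q=V_r/(V_r^*+X_r)$; under the hypotheses the surjection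 factors through $\mathrm{ind}_{KZ}^GQ\twoheadrightarrow\bar\Theta_{k,a_p}$. Let $Q_1=\mathrm{soc}(Q)\subset Q_2\subset\cdots$ be the socle filtration ($Q_{i+1}/Q_i=\mathrm{soc}(Q/Q_i)$), with $Q_f=Q$ as in the paper, $\mathrm{cosoc}(Q):=Q_f/Q_{f-1}$, $F_i$ the image of $\mathrm{ind}_{KZ}^GQ_i$ in $\bar\Theta_{k,a_p}$, and $F_t=F_f/F_{f-1}$; the map $\mathrm{ind}_{KZ}^G\mathrm{cosoc}(Q)\twoheadrightarrow F_t$ is the induced surjection. *)

(* Defs.v *)
From HB Require Import structures.
From mathcomp Require Import all_boot all_order all_algebra all_field.
From mathcomp Require Import ring_quotient ring.
From mathcomp Require Import boolp functions.
From mathcomp Require Import freeg mpoly.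

Set Implicit Arguments.
Unset Strict Implicit.
Unset Printing Implicit Defensive.

Import Order.TTheory GRing.Theory Num.Theory.
Local Open Scope ring_scope.
Local Open Scope quotient_scope.

Record submodule (R : nzRingType) (V : lmodType R) := Submodule {
  smem :> V -> Prop;
  smem0 : smem 0;
  smemP : forall a x y, smem x -> smem y -> smem (a *: x + y) }.

Section Submodules.
Variables (R : nzRingType) (V : lmodType R).
Implicit Types N : submodule V.

Definition spanned (S : V -> Prop) (x : V) : Prop :=
  forall N, (forall y, S y -> N y) -> N x.

Lemma spanned0 S : spanned S 0.
Proof. by move=> N _; apply: smem0. Qed.

Lemma spannedP S a x y : spanned S x -> spanned S y -> spanned S (a *: x + y).
Proof. by move=> hx hy N hN; apply: smemP; [apply: hx | apply: hy]. Qed.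

Definition lspan S : submodule V := Submodule (@spanned0 S) (@spannedP S).

Lemma mem_lspan (S : V -> Prop) x : S x -> lspan S x.
Proof. by move=> Sx N; apply. Qed.

Lemma smemD N x y : N x -> N y -> N (x + y).
Proof. by move=> hx hy; rewrite -[x]scale1r; apply: smemP. Qed.

Lemma smemZ N a x : N x -> N (a *: x).
Proof. by move=> hx; rewrite -[_ *: _]addr0; apply: smemP => //; apply: smem0. Qed.

Definition smem_pred N : {pred V} := fun x => `[< N x >].

Lemma smem_predP N x : reflect (N x) (x \in smem_pred N).
Proof. exact: asboolP. Qed.

Lemma smem_pred_closed N : submod_closed (smem_pred N).
Proof.
split=> [|a x y /smem_predP hx /smem_predP hy]; apply/smem_predP.
  exact: smem0.
exact: smemP.
Qed.

HB.instance Definition _ N :=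
  GRing.isSubmodClosed.Build R V (smem_pred N) (smem_pred_closed N).

Definition submod N := {x : V | x \in smem_pred N}.

HB.instance Definition _ N := SubChoice.on (submod N).
HB.instance Definition _ N := [SubChoice_isSubLmodule of submod N by <:].

Definition quotmod N := Quotient.quot (smem_pred N).

HB.instance Definition _ N := GRing.Zmodule.on (quotmod N).

Section Scale.
Variable N : submodule V.
Local Notation Q := (quotmod N).

Definition qclass (x : V) : Q := \pi_(Quotient.quot (smem_pred N)) x.

Lemma qclass_eq x y : qclass x = qclass y <-> N (x - y).
Proof.
split=> [/eqP|]; first by rewrite -Quotient.idealrBE => /smem_predP.
by move=> h; apply/eqP; rewrite -Quotient.idealrBE; apply/smem_predP.
Qed.

Lemma qclass_repr (x : Q) : qclass (repr x) = x.
Proof. exact: reprK. Qed.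

Lemma qclassD : {morph qclass : x y / x + y}.
Proof. by move=> x y; rewrite /qclass !piE. Qed.

Definition qlift (T : Type) (g : V -> T) (x : Q) : T := g (repr x).

Definition qscale (a : R) : Q -> Q := qlift (fun x => qclass (a *: x)).

Lemma qscaleE a x : qscale a (qclass x) = qclass (a *: x).
Proof.
apply/qclass_eq; rewrite -scalerBr; apply: smemZ.
by apply/qclass_eq; rewrite qclass_repr.
Qed.

Lemma qscaleA a b (v : Q) : qscale a (qscale b v) = qscale (a * b) v.
Proof. by rewrite -[v]qclass_repr !qscaleE scalerA. Qed.

Lemma qscale1 : left_id 1 qscale.
Proof. by move=> v; rewrite -[v]qclass_repr qscaleE scale1r. Qed.

Lemma qscaleDr : right_distributive qscale +%R.
Proof.
move=> a u v; rewrite -[u]qclass_repr -[v]qclass_repr -qclassD !qscaleE.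
by rewrite scalerDr qclassD.
Qed.

Lemma qscaleDl v : {morph qscale^~ v : a b / a + b}.
Proof. by move=> a b; rewrite -[v]qclass_repr !qscaleE scalerDl qclassD. Qed.

HB.instance Definition _ :=
  GRing.Zmodule_isLmodule.Build R Q qscaleA qscale1 qscaleDr qscaleDl.

Lemma qclass_linear : linear qclass.
Proof. by move=> a x y; rewrite qclassD; congr (_ + _); rewrite -qscaleE. Qed.

HB.instance Definition _ :=
  GRing.isLinear.Build R V Q _ qclass qclass_linear.

End Scale.
End Submodules.

Section Image.
Variables (R : nzRingType) (U V : lmodType R) (u : {linear U -> V}).

Definition image_mem (N : submodule U) (y : V) : Prop :=
  exists2 x, N x & u x = y.

Lemma image_mem0 N : image_mem N 0.
Proof. by exists 0; [apply: smem0 | rewrite linear0]. Qed.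

Lemma image_memP N a x y :
  image_mem N x -> image_mem N y -> image_mem N (a *: x + y).
Proof.
move=> [x' hx <-] [y' hy <-]; exists (a *: x' + y'); first exact: smemP.
by rewrite linearP.
Qed.

Definition lin_image N : submodule V := Submodule (image_mem0 N) (@image_memP N).

Definition preimage_mem (N : submodule V) (x : U) : Prop := N (u x).

Lemma preimage_mem0 N : preimage_mem N 0.
Proof. by rewrite /preimage_mem linear0; apply: smem0. Qed.

Lemma preimage_memP N a x y :
  preimage_mem N x -> preimage_mem N y -> preimage_mem N (a *: x + y).
Proof. by move=> hx hy; rewrite /preimage_mem linearP; apply: smemP. Qed.

Definition lin_preim N : submodule U :=
  Submodule (preimage_mem0 N) (@preimage_memP N).

End Image.

Definition full_sub (R : nzRingType) (V : lmodType R) : submodule V :=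
  @Submodule _ V (fun=> True) I (fun _ _ _ _ _ => I).

Definition restr (A B : nzRingType) (phi : {rmorphism A -> B})
  (M : lmodType B) : Type := M.

Section Restriction.
Variables (A B : nzRingType) (phi : {rmorphism A -> B}) (M : lmodType B).
Local Notation rM := (restr phi M).

HB.instance Definition _ := GRing.Zmodule.on rM.

Definition rscale (a : A) (x : rM) : rM := phi a *: (x : M).

Lemma rscaleA a b x : rscale a (rscale b x) = rscale (a * b) x.
Proof. by rewrite /rscale scalerA rmorphM. Qed.

Lemma rscale1 : left_id 1 rscale.
Proof. by move=> x; rewrite /rscale rmorph1 scale1r. Qed.

Lemma rscaleDr : right_distributive rscale +%R.
Proof. by move=> a x y; rewrite /rscale scalerDr. Qed.

Lemma rscaleDl x : {morph rscale^~ x : a b / a + b}.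
Proof. by move=> a b; rewrite /rscale rmorphD scalerDl. Qed.

HB.instance Definition _ :=
  GRing.Zmodule_isLmodule.Build A rM rscaleA rscale1 rscaleDr rscaleDl.

End Restriction.

(* M (x)_A B: the free B-module on the elements of M modulo the relations     *)
(* making m |-> m (x) 1 additive and A-linear along phi.                      *)
Section BaseChange.
Variables (A B : comNzRingType) (phi : {rmorphism A -> B}) (M : lmodType A).

Definition free_elt (m : M) : {freeg M / B} := << m >>.

Definition base_change_rel (z : {freeg M / B}) : Prop :=
  (exists m n, z = free_elt (m + n) - free_elt m - free_elt n) \/
  (exists a m, z = free_elt (a *: m) - phi a *: free_elt m).

Definition base_change : lmodType B := quotmod (lspan base_change_rel).

Definition tensor1 (m : M) : base_change := qclass _ (free_elt m).
End BaseChange.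

Definition GL2 (R : comUnitRingType) := {g : 'M[R]_2 | g \in unitmx}.

HB.instance Definition _ (R : comUnitRingType) := SubChoice.on (GL2 R).

Section GL2Group.
Variable R : comUnitRingType.
Implicit Types g h : GL2 R.

Lemma GL2_mul_unit g h : val g *m val h \in unitmx.
Proof. by rewrite unitmx_mul (valP g) (valP h). Qed.

Lemma GL2_inv_unit g : invmx (val g) \in unitmx.
Proof. by rewrite unitmx_inv (valP g). Qed.

Definition GL2_mul g h : GL2 R := Sub (val g *m val h) (GL2_mul_unit g h).
Definition GL2_inv g : GL2 R := Sub (invmx (val g)) (GL2_inv_unit g).
Definition GL2_one : GL2 R := Sub 1%:M (unitmx1 R 2).

Lemma GL2_mulA : associative GL2_mul.
Proof. by move=> g h l; apply/val_inj; rewrite /= mulmxA. Qed.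

Lemma GL2_mul1g : left_id GL2_one GL2_mul.
Proof. by move=> g; apply/val_inj; rewrite /= mul1mx. Qed.

Lemma GL2_mulg1 : right_id GL2_one GL2_mul.
Proof. by move=> g; apply/val_inj; rewrite /= mulmx1. Qed.

Lemma GL2_mulVg : left_inverse GL2_one GL2_inv GL2_mul.
Proof. by move=> g; apply/val_inj; rewrite /= mulVmx // (valP g). Qed.

Lemma GL2_mulgV : right_inverse GL2_one GL2_inv GL2_mul.
Proof. by move=> g; apply/val_inj; rewrite /= mulmxV // (valP g). Qed.

HB.instance Definition _ :=
  isGroup.Build (GL2 R) GL2_mulA GL2_mul1g GL2_mulg1 GL2_mulVg GL2_mulgV.

End GL2Group.

Definition mx2 (R : nzRingType) (a b c d : R) : 'M[R]_2 :=
  \matrix_(i, j) if i == 0 then (if j == 0 then a else b)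
                 else (if j == 0 then c else d).

Lemma det_mx2 (R : comNzRingType) (a b c d : R) :
  \det (mx2 a b c d) = a * d - b * c.
Proof.
rewrite (expand_det_row _ ord0) !big_ord_recl big_ord0 addr0.
rewrite /cofactor !det_mx11 !mxE /= expr0 expr1.
by rewrite mul1r mulN1r mulrN.
Qed.

Record rep (O : comUnitRingType) (R : comNzRingType) := Rep {
  rep_mod :> lmodType R;
  act : GL2 O -> {linear rep_mod -> rep_mod};
  act1 : forall x, act 1%g x = x;
  actM : forall k l x, act (k * l)%g x = act k (act l x) }.

Arguments act {O R r} k.

Section Representations.
Variables (O : comUnitRingType) (R : comNzRingType).
Implicit Types M : rep O R.

Record subrep M := Subrep {
  subrep_sub :> submodule M;
  subrep_act : forall k x, subrep_sub x -> subrep_sub (act k x) }.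

Definition orbit_of M (S : M -> Prop) (y : M) : Prop :=
  exists k x, S x /\ y = act k x.

Lemma genrep_act M (S : M -> Prop) k x :
  lspan (orbit_of S) x -> lspan (orbit_of S) (act k x).
Proof.
move=> hx; apply: (hx (lin_preim (act k) (lspan (orbit_of S)))).
move=> _ [l [y [Sy ->]]]; rewrite /= /preimage_mem -actM.
by apply: mem_lspan; exists (k * l)%g, y.
Qed.

Definition genrep M (S : M -> Prop) : subrep M := Subrep (@genrep_act M S).

Definition zero_sub M : subrep M := genrep (fun _ : M => False).

Lemma add_sub_act M (N1 N2 : subrep M) k x :
  lspan (fun x => N1 x \/ N2 x) x -> lspan (fun x => N1 x \/ N2 x) (act k x).
Proof.
move=> hx; apply: (hx (lin_preim (act k) (lspan (fun x => N1 x \/ N2 x)))).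
move=> y Ny; apply: mem_lspan.
by case: Ny => Ny; [left | right]; apply: subrep_act.
Qed.

Definition add_sub M (N1 N2 : subrep M) : subrep M :=
  Subrep (@add_sub_act M N1 N2).

Section SubRep.
Variables (M : rep O R) (N : subrep M).

Lemma sub_act_subproof k (x : submod N) : act k (val x) \in smem_pred N.
Proof. by apply/smem_predP/subrep_act/smem_predP/valP. Qed.

Definition sub_act k (x : submod N) : submod N :=
  Sub (act k (val x)) (sub_act_subproof k x).

Lemma sub_act_linear k : linear (sub_act k).
Proof. by move=> a x y; apply/val_inj; rewrite /= linearP. Qed.

HB.instance Definition _ k :=
  GRing.isLinear.Build R (submod N) (submod N) _ (sub_act k) (sub_act_linear k).

Lemma sub_act1 x : sub_act 1%g x = x.
Proof. by apply/val_inj; rewrite /= act1. Qed.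

Lemma sub_actM k l x : sub_act (k * l)%g x = sub_act k (sub_act l x).
Proof. by apply/val_inj; rewrite /= actM. Qed.

Definition sub_rep : rep O R :=
  @Rep O R (submod N) (fun k => sub_act k) sub_act1 sub_actM.

End SubRep.

Section QuotRep.
Variables (M : rep O R) (N : subrep M).

Definition quot_act k : quotmod N -> quotmod N :=
  qlift (fun x => qclass N (act k x)).

Lemma quot_actE k x : quot_act k (qclass N x) = qclass N (act k x).
Proof.
apply/qclass_eq; rewrite -linearB; apply: subrep_act.
by apply/qclass_eq; rewrite qclass_repr.
Qed.

Lemma quot_act_linear k : linear (quot_act k).
Proof.
move=> a x y; rewrite -[x]qclass_repr -[y]qclass_repr -linearP !quot_actE.
by rewrite !linearP.
Qed.

HB.instance Definition _ k := GRing.isLinear.Build R (quotmod N) (quotmod N) _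
  (quot_act k) (quot_act_linear k).

Lemma quot_act1 x : quot_act 1%g x = x.
Proof. by rewrite -[x]qclass_repr quot_actE act1. Qed.

Lemma quot_actM k l x : quot_act (k * l)%g x = quot_act k (quot_act l x).
Proof. by rewrite -[x]qclass_repr !quot_actE actM. Qed.

Definition quot_rep : rep O R :=
  @Rep O R (quotmod N) (fun k => quot_act k) quot_act1 quot_actM.

Lemma preim_quot_act (S : subrep quot_rep) k x :
  lin_preim (qclass N) S x -> lin_preim (qclass N) S (act k x).
Proof.
move=> Sx; have := subrep_act (s := S) k Sx.
by rewrite /= /preimage_mem quot_actE.
Qed.

Definition preim_quot (S : subrep quot_rep) : subrep M :=
  Subrep (@preim_quot_act S).

End QuotRep.

Definition simple_sub M (S : subrep M) : Prop :=
  (exists2 x, S x & x != 0) /\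
  forall S' : subrep M, (forall x, S' x -> S x) ->
    (forall x, S' x -> x = 0) \/ (forall x, S x -> S' x).

Definition soc M : subrep M :=
  genrep (fun x => exists2 S : subrep M, simple_sub S & S x).

Fixpoint socfil M (n : nat) : subrep M :=
  if n is n'.+1 then preim_quot (soc (quot_rep (socfil M n'))) else zero_sub M.

End Representations.

(* Additive equivariant maps; the coefficient rings may differ, so that       *)
(* reduction of coefficients is covered.                                      *)
Record equivar (O : comUnitRingType) (R R' : comNzRingType)
    (M : rep O R) (N : rep O R') := Equivar {
  equivar_fun :> {additive M -> N};
  equivar_act : forall k x, equivar_fun (act k x) = act k (equivar_fun x) }.

Section QuotSubMaps.
Variables (O : comUnitRingType) (R : comNzRingType) (M : rep O R).

Lemma qclass_act (N : subrep M) k x :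
  qclass N (act k x) = act (r := quot_rep N) k (qclass N x).
Proof. by rewrite /= quot_actE. Qed.

Definition quot_proj (N : subrep M) : equivar M (quot_rep N) :=
  @Equivar O R R M (quot_rep N) (qclass N) (@qclass_act N).

Definition sub_incl (N : subrep M) : equivar (sub_rep N) M :=
  @Equivar O R R (sub_rep N) M (\val : submod N -> M) (fun k x => erefl).

Definition res_sub_mem (N S : subrep M) : submodule (sub_rep N) :=
  lin_preim (\val : submod N -> M) S.

Lemma res_sub_act (N S : subrep M) k x :
  res_sub_mem N S x -> res_sub_mem N S (act k x).
Proof. by move=> Sx; apply: (@subrep_act _ _ _ S). Qed.

(* S viewed inside N, that is the intersection of S and N. *)
Definition res_sub (N S : subrep M) : subrep (sub_rep N) :=
  Subrep (@res_sub_act N S).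

End QuotSubMaps.

(* Q_n / Q_(n-1) for the socle filtration Q_0 = 0 < Q_1 = soc Q < ... *)
Definition soclayer (O : comUnitRingType) (R : comNzRingType) (Q : rep O R) n :
    rep O R :=
  quot_rep (res_sub (socfil Q n) (socfil Q n.-1)).

(* Additive valuations; the value at 0 is irrelevant. *)
Record valuation (K : fieldType) := Valuation {
  vfun :> K -> rat;
  vfunM : forall x y, x != 0 -> y != 0 -> vfun (x * y) = vfun x + vfun y;
  vfunD : forall x y, x != 0 -> y != 0 -> x + y != 0 ->
    Num.min (vfun x) (vfun y) <= vfun (x + y) }.

Section ValuationRing.
Variables (K : fieldType) (v : valuation K).

Definition vge (c : rat) (x : K) : bool := (x == 0) || (c <= v x).
Definition vgt (c : rat) (x : K) : bool := (x == 0) || (c < v x).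

Lemma v1 : v 1 = 0.
Proof.
have := @vfunM _ v 1 1 (oner_neq0 _) (oner_neq0 _); rewrite mulr1 => /eqP.
by rewrite -{1}[v 1]addr0 (inj_eq (addrI _)) => /eqP.
Qed.

Lemma vN1 : v (-1) = 0.
Proof.
have N1 : -1 != 0 :> K by rewrite oppr_eq0 oner_neq0.
have := @vfunM _ v _ _ N1 N1; rewrite mulrNN mulr1 v1 => /esym/eqP.
by rewrite -mulr2n mulrn_eq0 /= => /eqP.
Qed.

Lemma vV x : x != 0 -> v x^-1 = - v x.
Proof.
move=> nx; apply/eqP; rewrite -addr_eq0 addrC -vfunM ?invr_eq0 //.
by rewrite divff // v1.
Qed.

Lemma vfunX x n : x != 0 -> v (x ^+ n) = v x *+ n.
Proof.
move=> nx; elim: n => [|n IH]; first by rewrite expr0 v1.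
by rewrite exprS vfunM ?expf_neq0 // IH mulrS.
Qed.

Lemma vfunXz x (n : int) : x != 0 -> v (x ^ n) = v x *~ n.
Proof.
move=> nx; case: n => n; first by rewrite -exprnP -pmulrn vfunX.
by rewrite NegzE -exprnN vV ?expf_neq0 // vfunX // mulrNz pmulrn.
Qed.

Definition intring_pred : {pred K} := vge 0.

Lemma intring_closed : subring_closed intring_pred.
Proof.
rewrite /intring_pred; split; rewrite ?unfold_in /vge.
- by rewrite v1 lexx orbT.
- move=> x y; rewrite ![_ \in _]unfold_in.
  have [->|nx] /= := eqVneq x 0; have [->|ny] /= := eqVneq y 0 => hx hy.
  + by rewrite subr0 eqxx.
  + by rewrite sub0r -mulN1r vfunM ?oppr_eq0 ?oner_neq0 // vN1 add0r hy orbT.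
  + by rewrite subr0 hx orbT.
  have [//|nxy /=] := eqVneq (x - y) 0.
  have ny' : - y != 0 by rewrite oppr_eq0.
  apply: le_trans (vfunD v nx ny' nxy).
  rewrite le_min hx -mulN1r vfunM ?oppr_eq0 ?oner_neq0 //.
  by rewrite vN1 add0r hy.
move=> x y; rewrite ![_ \in _]unfold_in.
have [->|nx] /= := eqVneq x 0; first by rewrite mul0r eqxx.
have [->|ny] /= := eqVneq y 0; first by rewrite mulr0 eqxx.
by move=> hx hy; rewrite vfunM // addr_ge0 ?orbT.
Qed.

HB.instance Definition _ :=
  GRing.isSubringClosed.Build K intring_pred intring_closed.

Definition intring := {x : K | x \in intring_pred}.

HB.instance Definition _ := SubChoice.on intring.
HB.instance Definition _ := [SubChoice_isSubComNzRing of intring by <:].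

Definition int_unit : {pred intring} :=
  [pred x | (val x != 0) && (v (val x) == 0)].

Lemma int_inv_subproof (x : intring) : x \in int_unit ->
  (val x)^-1 \in intring_pred.
Proof.
rewrite inE => /andP[nx /eqP vx].
by rewrite unfold_in /= /vge invr_eq0 vV // vx oppr0 lexx orbT.
Qed.

Definition int_inv (x : intring) : intring :=
  if boolP (x \in int_unit) is AltTrue h
  then Sub (val x)^-1 (int_inv_subproof h) else x.

Lemma int_mulVr : {in int_unit, left_inverse 1 int_inv *%R}.
Proof.
move=> x ux; apply/val_inj; rewrite /int_inv /=.
case: {-}_ / boolP => [h|]; last by rewrite ux.
by rewrite /= mulVf //; move: ux; rewrite inE => /andP[].
Qed.

Lemma int_unitP (x y : intring) : y * x = 1 -> int_unit x.
Proof.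
move=> /(congr1 val) /= yx; have := oner_neq0 K; rewrite -yx mulf_eq0 negb_or.
case/andP=> ny nx; apply/andP; split=> //.
have := vfunM v ny nx; rewrite yx v1 => /esym/eqP; rewrite addr_eq0 => /eqP vyx.
have := valP x; have := valP y; rewrite ![_ \in _]unfold_in /vge.
rewrite (negPf nx) (negPf ny) /= vyx oppr_ge0 => h1 h2.
by apply/eqP/le_anti; rewrite h1 h2.
Qed.

Lemma int_inv_out : {in [predC int_unit], int_inv =1 id}.
Proof.
move=> x; rewrite inE => ux; rewrite /int_inv.
by case: {-}_ / boolP => // h; rewrite h in ux.
Qed.

HB.instance Definition _ := GRing.ComNzRing_hasMulInverse.Build intring
  int_mulVr int_unitP int_inv_out.

End ValuationRing.

(* K is the completion of the field of rationals for the p-adic valuation. *)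
Record is_Qp (p : nat) (K : fieldType) (v : valuation K) : Prop := IsQp {
  Qp_nat : forall n, (0 < n)%N -> n%:R != 0 :> K /\ v n%:R = (logn p n)%:R;
  Qp_dense : forall (x : K) (N : nat), exists a : rat,
    vge v N%:R (x - ratr a);
  Qp_complete : forall u : nat -> K,
    (forall N : nat, exists n0, forall m n,
       (n0 <= m)%N -> (n0 <= n)%N -> vge v N%:R (u m - u n)) ->
    exists l, forall N : nat, exists n0, forall n,
       (n0 <= n)%N -> vge v N%:R (u n - l) }.

(* F is the unramified extension of Q_p of degree f (p still generates the    *)
(* maximal ideal of its ring of integers), E a finite extension of F, kbar    *)
(* an algebraic closure of the residue field of E. All valuations are         *)
(* normalized by v(p) = 1.                                                    *)
Record padic_setting (p f : nat) := PadicSetting {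
  p_prime : prime p;
  Qp : fieldType;
  vQp : valuation Qp;
  QpP : is_Qp p vQp;

  F : fieldExtType Qp;
  vF : valuation F;
  vF_Qp : forall x : Qp, x != 0 -> vF x%:A = vQp x;
  dim_F : \dim {: F} = f;
  F_unramified : forall x : F, x != 0 -> exists n : int, vF x = n%:~R;

  kF : finFieldType;
  card_kF : #|kF| = (p ^ f)%N;
  resF : {rmorphism intring vF -> kF};
  resF_surj : forall c, exists x, resF x = c;
  resF_ker : forall x, resF x = 0 <-> vgt vF 0 (val x);

  teich : kF -> intring vF;
  teichX : forall c, teich c ^+ (p ^ f) = teich c;
  res_teich : forall c, resF (teich c) = c;

  (* frob is the only endomorphism with this property: it is the            *)
  (* restriction of the Frobenius automorphism of F over Q_p                *)
  frob : {rmorphism intring vF -> intring vF};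
  frobP : forall x, resF (frob x) = resF x ^+ p;

  E : fieldExtType F;
  vE : valuation E;
  vE_F : forall x : F, x != 0 -> vE x%:A = vF x;

  kbar : closedFieldType;
  redE : {rmorphism intring vE -> kbar};
  redE_ker : forall x, redE x = 0 <-> vgt vE 0 (val x);
  kbar_alg : forall c : kbar, exists2 n, (0 < n)%N & c ^+ (p ^ n) = c }.

(* X_i and Y_i are the variables of index i and f + i. *)
Definition varX (f : nat) (R : nzRingType) (i : 'I_f) : {mpoly R[f + f]} :=
  'X_(lshift f i).
Definition varY (f : nat) (R : nzRingType) (i : 'I_f) : {mpoly R[f + f]} :=
  'X_(rshift f i).

Section Polynomials.
Variables (f : nat) (R : comNzRingType).
Local Notation P := {mpoly R[f + f]}.

Definition multihom (r : 'I_f -> nat) : {pred P} :=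
  fun v => all (fun m : 'X_{1..f + f} =>
    [forall i, (m (lshift f i) + m (rshift f i))%N == r i]) (msupp v).

Lemma multihomP r (v : P) :
  reflect (forall m : 'X_{1..f + f}, m \in msupp v ->
            forall i, (m (lshift f i) + m (rshift f i))%N = r i)
          (v \in multihom r).
Proof.
apply: (iffP allP) => h m hm; last by apply/forallP => i; rewrite h.
by move=> i; apply/eqP; move/forallP: (h m hm).
Qed.

Lemma multihom_closed r : submod_closed (multihom r).
Proof.
split=> [|a u v /multihomP hu /multihomP hv].
  by apply/multihomP => m; rewrite msupp0.
apply/multihomP => m /msuppD_le; rewrite mem_cat => /orP[/msuppZ_le|]; last first.
  exact: hv.
exact: hu.
Qed.

HB.instance Definition _ r :=
  GRing.isSubmodClosed.Build R P (multihom r) (multihom_closed r).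

Lemma multihomM r s u v : u \in multihom r -> v \in multihom s ->
  u * v \in multihom (fun i => (r i + s i)%N).
Proof.
move=> /multihomP hu /multihomP hv; apply/multihomP => m /msuppM_le.
case/allpairsP=> -[m1 m2] /= [h1 h2 ->] i.
by rewrite !mnmDE addnACA hu // hv.
Qed.

Lemma multihom1 : 1 \in multihom (fun=> 0%N).
Proof.
apply/multihomP => m; rewrite msupp1 inE => /eqP -> i.
by rewrite !mnm0E.
Qed.

Lemma multihomX r u n : u \in multihom r ->
  u ^+ n \in multihom (fun i => (r i * n)%N).
Proof.
move=> hu; elim: n => [|n IH].
  by rewrite expr0; have := multihom1; congr (_ \in multihom _); apply/funext => i;
     rewrite muln0.
rewrite exprS; have := multihomM hu IH; congr (_ \in multihom _).
by apply/funext => i; rewrite mulnS.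
Qed.

Lemma multihom_prod (I : Type) (s : seq I) (r : I -> 'I_f -> nat) (u : I -> P) :
  (forall j, u j \in multihom (r j)) ->
  \prod_(j <- s) u j \in multihom (fun i => \sum_(j <- s) r j i)%N.
Proof.
move=> hu; elim: s => [|j s IH].
  rewrite big_nil; have := multihom1; congr (_ \in multihom _).
  by apply/funext => i; rewrite big_nil.
rewrite big_cons; have := multihomM (hu j) IH; congr (_ \in multihom _).
by apply/funext => i; rewrite big_cons.
Qed.

Lemma varX_multihom i : varX R i \in multihom (fun j => (i == j)%N).
Proof.
apply/multihomP => m; rewrite msuppX inE => /eqP -> j.
by rewrite !mnm1E (inj_eq (@lshift_inj _ _)) eq_lrshift addn0.
Qed.

Lemma varY_multihom i : varY R i \in multihom (fun j => (i == j)%N).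
Proof.
apply/multihomP => m; rewrite msuppX inE => /eqP -> j.
by rewrite !mnm1E (inj_eq (@rshift_inj _ _)) eq_rlshift.
Qed.

Definition polyV (r : 'I_f -> nat) := {v : P | v \in multihom r}.

HB.instance Definition _ r := SubChoice.on (polyV r).
HB.instance Definition _ r := [SubChoice_isSubLmodule of polyV r by <:].

(* The substitution (X_i, Y_i) := (X_i, Y_i) *m A i. *)
Definition lin_forms (A : 'I_f -> 'M[R]_2) : (f + f).-tuple P :=
  [tuple match fintype.split j with
         | inl i => A i 0 0 *: varX R i + A i 1 0 *: varY R i
         | inr i => A i 0 1 *: varX R i + A i 1 1 *: varY R i
         end | j < f + f].

Definition lsubst (A : 'I_f -> 'M[R]_2) (v : P) : P := v \mPo lin_forms A.

Lemma lin_formsX A i : tnth (lin_forms A) (lshift f i) =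
  A i 0 0 *: varX R i + A i 1 0 *: varY R i.
Proof. by rewrite tnth_mktuple (fintype.unsplitK (inl i)). Qed.

Lemma lin_formsY A i : tnth (lin_forms A) (rshift f i) =
  A i 0 1 *: varX R i + A i 1 1 *: varY R i.
Proof. by rewrite tnth_mktuple (fintype.unsplitK (inr i)). Qed.

Lemma lsubstX A i :
  lsubst A (varX R i) = A i 0 0 *: varX R i + A i 1 0 *: varY R i.
Proof. by rewrite /lsubst comp_mpolyXU -tnth_nth lin_formsX. Qed.

Lemma lsubstY A i :
  lsubst A (varY R i) = A i 0 1 *: varX R i + A i 1 1 *: varY R i.
Proof. by rewrite /lsubst comp_mpolyXU -tnth_nth lin_formsY. Qed.

Lemma lsubst_multihom A r v : v \in multihom r -> lsubst A v \in multihom r.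
Proof.
move=> /multihomP hv; rewrite /lsubst comp_mpolyE big_seq.
apply: rpred_sum => m hm; apply: rpredZ.
have hA i a b : a *: varX R i + b *: varY R i \in multihom (fun j => (i == j)%N).
  by apply: rpredD; apply: rpredZ; [apply: varX_multihom | apply: varY_multihom].
rewrite big_split_ord /=.
have hX : \prod_(i < f) tnth (lin_forms A) (lshift f i) ^+ m (lshift f i)
  \in multihom (fun j => \sum_(i < f) (i == j) * m (lshift f i))%N.
  by apply: multihom_prod => i; apply: multihomX; rewrite lin_formsX.
have hY : \prod_(i < f) tnth (lin_forms A) (rshift f i) ^+ m (rshift f i)
  \in multihom (fun j => \sum_(i < f) (i == j) * m (rshift f i))%N.
  by apply: multihom_prod => i; apply: multihomX; rewrite lin_formsY.
have := multihomM hX hY; congr (_ \in multihom _).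
apply/funext => j; rewrite -(hv _ hm j).
have S (g : 'I_f -> nat) : (\sum_(i < f) (i == j) * g i)%N = g j.
  rewrite (bigD1 j) //= eqxx mul1n big1 ?addn0 // => i /negPf ->.
  by rewrite mul0n.
by rewrite !S.
Qed.

Definition psubst (A : 'I_f -> 'M[R]_2) r (v : polyV r) : polyV r :=
  Sub (lsubst A (val v)) (lsubst_multihom A (valP v)).

Lemma lsubst1 v : lsubst (fun=> 1%:M) v = v.
Proof.
rewrite -[RHS]comp_mpoly_id /lsubst; congr (_ \mPo _).
apply: eq_from_tnth => j; rewrite !tnth_mktuple.
case: fintype.splitP => i ji; rewrite !mxE /= ?mulr1n ?mulr0n scale1r scale0r ?addr0 ?add0r;
  by congr mpolyX; congr mnm1; apply/val_inj.
Qed.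

Lemma sum2 (g : 'I_2 -> R) : \sum_i g i = g 0 + g 1.
Proof.
by rewrite !big_ord_recl big_ord0 addr0; congr (_ + g _); apply/val_inj.
Qed.

Lemma lsubstM A B v :
  lsubst A (lsubst B v) = lsubst (fun i => A i *m B i) v.
Proof.
rewrite /lsubst !(comp_mpolyEX v) raddf_sum; apply: eq_bigr => m _.
rewrite /= linearZ /= !comp_mpolyX rmorph_prod; congr (_ *: _).
apply: eq_bigr => j _; rewrite rmorphXn; congr (_ ^+ _).
rewrite -[j]fintype.splitK; case: (fintype.split j) => i; rewrite /= ?lin_formsX ?lin_formsY;
  rewrite linearD !linearZ /= -!/(lsubst A _) lsubstX lsubstY;
  rewrite !mxE !sum2 !scalerDr !scalerA !scalerDl addrACA;
  by rewrite ![_ * B i _ _]mulrC.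
Qed.

End Polynomials.

Section Setting.
Variables (p f : nat) (D : padic_setting p f).

Notation OF := (intring (vF D)).
Notation OE := (intring (vE D)).
Notation G := (GL2 (F D)).
Notation K := (GL2 OF).

Lemma inclOE_subproof (x : OF) : (val x)%:A \in intring_pred (vE D).
Proof.
have := valP x; rewrite ![_ \in _]unfold_in /vge.
have [->|nx] /= := eqVneq (val x) 0; first by rewrite scale0r eqxx.
by rewrite vE_F // => ->; rewrite orbT.
Qed.

Definition inclOE (x : OF) : OE := Sub (val x)%:A (inclOE_subproof x).

Lemma inclOE_additive : zmod_morphism inclOE.
Proof. by move=> x y; apply/val_inj; rewrite /= scalerBl. Qed.

Lemma inclOE_multiplicative : monoid_morphism inclOE.
Proof.
split=> [|x y]; apply/val_inj; rewrite /= ?scale1r //.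
by rewrite -scalerAl mul1r scalerA.
Qed.

HB.instance Definition _ :=
  GRing.isZmodMorphism.Build OF OE inclOE inclOE_additive.
HB.instance Definition _ :=
  GRing.isMonoidMorphism.Build OF OE inclOE inclOE_multiplicative.

Definition structOE : {rmorphism OF -> OE} := inclOE.
Definition structE : {rmorphism OF -> E D} := (\val : OE -> E D) \o inclOE.
Definition structkbar : {rmorphism OF -> kbar D} := redE D \o inclOE.

Definition frobn (i : nat) : OF -> OF := iter i (frob D).

Lemma frobn_additive i : zmod_morphism (frobn i).
Proof.
by rewrite /frobn; elim: i => //= i IH x y; rewrite !iterS IH rmorphB.
Qed.

Lemma frobn_multiplicative i : monoid_morphism (frobn i).
Proof.
rewrite /frobn; split; first by elim: i => // i IH; rewrite iterS IH rmorph1.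
by elim: i => //= i IH x y; rewrite !iterS IH rmorphM.
Qed.

HB.instance Definition _ i :=
  GRing.isZmodMorphism.Build OF OF (frobn i) (frobn_additive i).
HB.instance Definition _ i :=
  GRing.isMonoidMorphism.Build OF OF (frobn i) (frobn_multiplicative i).

(* (x)_i Sym^(r_i) R^2 (x) det^m, for an algebra j : OF -> R. *)
Section Weights.
Variables (R : comNzRingType) (j : {rmorphism OF -> R}).
Variables (r : 'I_f -> nat) (m : nat).

Definition conj_mx (k : 'M[OF]_2) (i : 'I_f) : 'M[R]_2 :=
  map_mx (j \o frobn i) k.

Definition weight_act_fun (k : K) (v : polyV R r) : polyV R r :=
  j (\det (val k)) ^+ m *: psubst (conj_mx (val k)) v.

Lemma weight_act_linear k : linear (weight_act_fun k).
Proof.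
move=> a u v; apply/val_inj; rewrite /= /lsubst linearP scalerDr.
by rewrite !scalerA mulrC.
Qed.

HB.instance Definition _ k := GRing.isLinear.Build R (polyV R r) (polyV R r) _
  (weight_act_fun k) (weight_act_linear k).

Lemma weight_act1 v : weight_act_fun 1%g v = v.
Proof.
apply/val_inj; rewrite /= det1 rmorph1 expr1n scale1r -[RHS]lsubst1.
by congr lsubst; apply/funext => i; rewrite /conj_mx map_mx1.
Qed.

Lemma weight_actM k l v :
  weight_act_fun (k * l)%g v = weight_act_fun k (weight_act_fun l v).
Proof.
apply/val_inj; rewrite /= det_mulmx rmorphM exprMn.
rewrite [in RHS]/lsubst linearZ scalerA /= -!/(lsubst _ _) lsubstM; congr (_ *: _).
by congr lsubst; apply/funext => i; rewrite /conj_mx map_mxM.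
Qed.

Definition weight_rep : rep OF R :=
  @Rep OF R (polyV R r) (fun k => weight_act_fun k) weight_act1 weight_actM.

End Weights.

Definition Vrep (R : comNzRingType) (j : {rmorphism OF -> R}) r : rep OF R :=
  weight_rep j r 0.

Section CoefMap.
Variables (R R' : comNzRingType) (phi : {rmorphism R -> R'}).
Variables (j : {rmorphism OF -> R}) (r : 'I_f -> nat).

Lemma coef_map_subproof (v : polyV R r) : map_mpoly phi (val v) \in multihom r.
Proof.
have /multihomP hv := valP v; apply/multihomP => m; rewrite mcoeff_msupp => hm.
apply: hv; rewrite mcoeff_msupp; apply: contraNneq hm => h.
by rewrite mcoeff_map_mpoly h raddf0.
Qed.

Definition coef_map_fun (v : polyV R r) : polyV R' r :=
  Sub (map_mpoly phi (val v)) (coef_map_subproof v).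

Lemma coef_map_additive : zmod_morphism coef_map_fun.
Proof. by move=> u v; apply/val_inj; rewrite /= raddfB. Qed.

HB.instance Definition _ := GRing.isZmodMorphism.Build (polyV R r) (polyV R' r)
  coef_map_fun coef_map_additive.

Lemma map_lsubst (A : 'I_f -> 'M[R]_2) (v : {mpoly R[f + f]}) :
  map_mpoly phi (lsubst A v) = lsubst (fun i => map_mx phi (A i)) (map_mpoly phi v).
Proof.
have -> : map_mpoly phi v = \sum_(m <- msupp v) phi v@_m *: 'X_[m].
  rewrite {1}[v]mpolyE (raddf_sum (map_mpoly phi)); apply: eq_bigr => m _.
  by rewrite /= map_mpolyZ map_mpolyX.
rewrite /lsubst (raddf_sum (comp_mpoly _)) comp_mpolyEX.
rewrite (raddf_sum (map_mpoly phi)); apply: eq_bigr => m _.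
rewrite /= map_mpolyZ comp_mpolyZ; congr (_ *: _).
rewrite !comp_mpolyX rmorph_prod; apply: eq_bigr => l _.
rewrite rmorphXn; congr (_ ^+ _); rewrite -[l]fintype.splitK.
case: (fintype.split l) => i; rewrite /= ?lin_formsX ?lin_formsY raddfD /= !map_mpolyZ;
by rewrite !map_mpolyX !mxE.
Qed.

Lemma coef_map_act k v :
  coef_map_fun (act (r := Vrep j r) k v) =
  act (r := Vrep (phi \o j) r) k (coef_map_fun v).
Proof.
apply/val_inj; rewrite /= !expr0 !scale1r map_lsubst; congr lsubst.
by apply/funext => i; apply/matrixP => a b; rewrite !mxE.
Qed.

Definition coef_map : equivar (Vrep j r) (Vrep (phi \o j) r) :=
  @Equivar _ _ _ (Vrep j r) (Vrep (phi \o j) r) coef_map_fun coef_map_act.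

End CoefMap.

Definition coefE r : equivar (Vrep structOE r) (Vrep structE r) :=
  coef_map (\val : OE -> E D) structOE r.
Definition coefkbar r : equivar (Vrep structOE r) (Vrep structkbar r) :=
  coef_map (redE D) structOE r.

Lemma vF_nat n : (0 < n)%N ->
  n%:R != 0 :> F D /\ vF D n%:R = (logn p n)%:R.
Proof.
move=> n0; have [nn vn] := Qp_nat (QpP D) n0.
have E : n%:R = (n%:R : Qp D)%:A :> F D by rewrite scaler_nat.
by rewrite E vF_Qp // vn scaler_eq0 negb_or nn oner_neq0.
Qed.

Lemma pF_neq0 : p%:R != 0 :> F D.
Proof. by case: (vF_nat (prime_gt0 (p_prime D))). Qed.

Lemma vF_p : vF D p%:R = 1.
Proof.
have [_ ->] := vF_nat (prime_gt0 (p_prime D)).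
by rewrite logn_prime ?eqxx // (p_prime D).
Qed.

Lemma KZelt_unit (n : int) (k : K) :
  p%:R ^ n *: map_mx val (val k) \in (unitmx : pred 'M[F D]_2).
Proof.
rewrite unitmxZ; last by rewrite unitfE expfz_neq0 // pF_neq0.
by have := valP k; rewrite !unitmxE det_map_mx; apply: rmorph_unit.
Qed.

(* The element p^n k of KZ; every element of KZ has this form, since Z is     *)
(* generated by p and the scalar matrices in K. *)
Definition KZelt (n : int) (k : K) : G :=
  Sub (p%:R ^ n *: map_mx val (val k)) (KZelt_unit n k).

Lemma KZelt_inj n n' k k' : KZelt n k = KZelt n' k' -> n = n' /\ k = k'.
Proof.
move=> /(congr1 val) /= e.
have p0 := pF_neq0.
have vdet (l : K) : \det (map_mx val (val l) : 'M[F D]_2) != 0 /\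
    vF D (\det (map_mx val (val l))) = 0.
  have := valP l; rewrite unitmxE => /andP[d0 /eqP vd].
  by rewrite det_map_mx.
have en : n = n'.
  have vz m (l : K) : vF D (\det (p%:R ^ m *: map_mx val (val l))) = m%:~R *+ 2.
    have [d0 vd0] := vdet l.
    by rewrite detZ (vfunM _ (expf_neq0 2 (expfz_neq0 _ p0)) d0) vd0 addr0
               (vfunX _ 2 (expfz_neq0 _ p0)) vfunXz // vF_p.
  have := congr1 (fun M => vF D (\det M)) e; rewrite !vz => /eqP.
  by rewrite eqrMn2r // eqr_int => /eqP.
split=> //; apply/val_inj.
have {}e : map_mx val (val k) = map_mx val (val k') :> 'M[F D]_2.
  by apply: (scalerI _ (etrans e _)); rewrite ?en // expfz_neq0.
apply/matrixP => a b; apply/val_inj.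
by have /matrixP/(_ a b) := e; rewrite !mxE.
Qed.

Section Induction.
Variables (R : comNzRingType) (M : rep OF R).

Definition ind_mem (phi : G -> M) : Prop :=
  (forall n k g, phi (KZelt n k * g)%g = act k (phi g)) /\
  (exists s : seq G, forall g, phi g != 0 ->
     exists n k h, h \in s /\ g = (KZelt n k * h)%g).

Lemma ind_mem0 : ind_mem 0.
Proof.
by split=> [n k g|]; [rewrite linear0 | exists [::] => g; rewrite eqxx].
Qed.

Lemma ind_memP a x y : ind_mem x -> ind_mem y -> ind_mem (a *: x + y).
Proof.
move=> [ex [s hs]] [ey [t ht]]; split=> [n k g|].
  by rewrite /GRing.add /GRing.scale /= ex ey linearP.
exists (s ++ t) => g; have [x0|/hs[n [k [h [hh ->]]]] _] := eqVneq (x g) 0.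
  have [y0|/ht[n [k [h [hh ->]]]] _] := eqVneq (y g) 0.
    by rewrite /GRing.add /GRing.scale /= x0 y0 scaler0 addr0 eqxx.
  by exists n, k, h; rewrite mem_cat hh orbT.
by exists n, k, h; rewrite mem_cat hh.
Qed.

Definition ind_sub : submodule (G -> M) := Submodule ind_mem0 ind_memP.

Definition ind : lmodType R := submod ind_sub.

Definition ind_fun (x : ind) : G -> M := val (x : submod ind_sub).

Definition elt_fun (g : G) (v : M) (g' : G) : M :=
  if pselect (exists nk : int * K, (g' * g)%g = KZelt nk.1 nk.2) is left h
  then act (projT1 (cid h)).2 v else 0.

Lemma elt_funE g v g' n k : (g' * g)%g = KZelt n k -> elt_fun g v g' = act k v.
Proof.
move=> e; rewrite /elt_fun; case: pselect => [h|]; last by case; exists (n, k).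
by case: (cid h) => -[n' k'] /= e'; rewrite e' in e; case: (KZelt_inj e) => _ ->.
Qed.

Lemma KZeltM n k n' k' : (KZelt n k * KZelt n' k')%g = KZelt (n + n') (k * k')%g.
Proof.
have mM : map_mx val (val (k * k')%g) =
    map_mx val (val k) *m map_mx val (val k') :> 'M[F D]_2.
  exact: (map_mxM (\val : OF -> F D)).
apply/val_inj; rewrite [LHS]/= -scalemxAl -scalemxAr scalerA -mM.
by rewrite -expfzDr // pF_neq0.
Qed.

Lemma KZelt1 : KZelt 0 1%g = 1%g.
Proof.
apply/val_inj; rewrite /= expr0z scale1r.
exact: (map_mx1 (\val : OF -> F D)).
Qed.

Lemma KZeltV n k : (KZelt n k)^-1%g = KZelt (- n) k^-1%g.
Proof.
apply: (@mulgI _ (KZelt n k)).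
by rewrite mulgV KZeltM subrr mulgV KZelt1.
Qed.

Lemma elt_mem g v : ind_mem (elt_fun g v).
Proof.
split=> [n k g'|].
  have [[[n' k'] /= e]|ne] := pselect (exists nk, (g' * g)%g = KZelt nk.1 nk.2).
    rewrite (elt_funE v e) -actM; apply: (@elt_funE _ _ _ (n + n')).
    by rewrite -mulgA e KZeltM.
  rewrite /elt_fun; case: pselect => [[[n' k'] /= e]|_].
    case: ne; exists (- n + n', k^-1 * k')%g => /=.
    by rewrite -KZeltM -e -KZeltV -mulgA mulKg.
  by case: pselect => // _; rewrite linear0.
exists [:: g^-1%g] => g'; rewrite /elt_fun; case: pselect => [[[n k] /= e] _|].
  by exists n, k, g^-1%g; rewrite inE eqxx -e mulgK.
by rewrite eqxx.
Qed.

(* [g, v] *)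
Definition elt (g : G) (v : M) : ind :=
  (Sub (elt_fun g v) (introT (smem_predP ind_sub _) (elt_mem g v)) :
     submod ind_sub).

End Induction.

Section IndMap.
Variables (R R' : comNzRingType) (M : rep OF R) (N : rep OF R').
Variable (u : equivar M N).

Lemma ind_map_mem (x : ind M) : ind_mem (u \o ind_fun x : G -> N).
Proof.
have /smem_predP[ex [s hs]] := valP (x : submod (ind_sub M)).
split=> [n k g|]; first by rewrite /= /ind_fun ex equivar_act.
exists s => g /= hg; apply: hs; apply: contraNneq hg => hg.
by rewrite /ind_fun hg raddf0.
Qed.

Definition ind_map (x : ind M) : ind N :=
  (Sub (u \o ind_fun x) (introT (smem_predP (ind_sub N) _) (ind_map_mem x)) :
     submod (ind_sub N)).

End IndMap.
Section IndSub.
Variables (R : comNzRingType) (M : rep OF R) (N : subrep M).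

Definition ind_in_mem (x : ind M) : Prop := forall g, N (ind_fun x g).

Lemma ind_in_mem0 : ind_in_mem 0.
Proof. by move=> g; apply: (smem0 N). Qed.

Lemma ind_in_memP a x y :
  ind_in_mem x -> ind_in_mem y -> ind_in_mem (a *: x + y).
Proof. by move=> hx hy g; apply: (smemP (s := N) a (hx g) (hy g)). Qed.

(* ind N as a submodule of ind M *)
Definition ind_in : submodule (ind M) := Submodule ind_in_mem0 ind_in_memP.

End IndSub.

Lemma gl_teich_unit (c : kF D) :
  mx2 p%:R (val (teich c)) 0 1 \in (unitmx : pred 'M[F D]_2).
Proof. by rewrite unitmxE det_mx2 mulr1 mulr0 subr0 unitfE pF_neq0. Qed.

Lemma gl_alpha_unit : mx2 1 0 0 p%:R \in (unitmx : pred 'M[F D]_2).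
Proof. by rewrite unitmxE det_mx2 mul1r mulr0 subr0 unitfE pF_neq0. Qed.

Definition gl_teich (c : kF D) : G :=
  Sub (mx2 p%:R (val (teich c)) 0 1) (gl_teich_unit c).
Definition gl_alpha : G := Sub (mx2 1 0 0 p%:R) gl_alpha_unit.

Section Hecke.
Variables (R : comNzRingType) (j : {rmorphism OF -> R}).
Variables (r : 'I_f -> nat) (m : nat).
Local Notation W := (weight_rep j r m).

(* T([g, v]). For R = kbar one has p = 0 in R, and this is the reduced        *)
(* formula.                                                                   *)
Definition hecke_elt (g : G) (v : W) : ind W :=
  \sum_(c : kF D) elt (M := W) (g * gl_teich c)%g
     (psubst (fun i => mx2 1 ((- j (teich c)) ^+ (p ^ i)) 0 p%:R) v)
  + elt (M := W) (g * gl_alpha)%g (psubst (fun=> mx2 p%:R 0 0 1) v).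

(* hecke_rel x y means y = T x, T being the additive extension of hecke_elt   *)
(* (the elements [g, v] generate ind W).                                      *)
Definition hecke_rel (x y : ind W) : Prop :=
  exists s : seq (G * W), x = \sum_(gv <- s) elt gv.1 gv.2 /\
                          y = \sum_(gv <- s) hecke_elt gv.1 gv.2.

End Hecke.

(* T(ind M), for a semisimple representation M over kbar. The simple          *)
(* representations of GL_2(F_q) over kbar are the weights Sym^s (x) det^m with*)
(* 0 <= s_i <= p - 1, so M is the sum of the images of the equivariant maps   *)
(* iota from the weights, and T on ind M is the operator commuting with all   *)
(* the maps ind iota.                                                         *)
Definition hecke_image (M : rep OF (kbar D)) : submodule (ind M) :=
  lspan (fun z => exists (s : 'I_f -> nat) (m : nat)
      (iota : equivar (weight_rep structkbar s m) M)
      (x y : ind (weight_rep structkbar s m)),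
    [/\ forall i, (s i < p)%N,
        forall a v, iota (a *: v) = a *: iota v,
        hecke_rel x y
      & z = ind_map iota y]).

Section Reduction.
Variables (r : 'I_f -> nat) (ap : E D).

(* (T - a_p)(ind V(E)) *)
Definition hecke_shift : submodule (ind (Vrep structE r)) :=
  lspan (fun z => exists2 xy, hecke_rel xy.1 xy.2 & z = xy.2 - ap *: xy.1).

Definition bigPi : lmodType (E D) := quotmod hecke_shift.

Definition theta_map (x : ind (Vrep structOE r)) :
    restr (\val : OE -> E D) bigPi :=
  qclass hecke_shift (ind_map (coefE r) x).

Lemma theta_map_linear : linear theta_map.
Proof.
move=> a x y; rewrite /theta_map [RHS]/=.
have -> : ind_map (coefE r) (a *: x + y) =
    val a *: ind_map (coefE r) x + ind_map (coefE r) y.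
  apply/val_inj/funext => g; apply/val_inj => /=.
  apply: etrans (raddfD (map_mpoly (\val : OE -> E D)) _ _) _.
  by congr (_ + _); apply: (map_mpolyZ (\val : OE -> E D)).
exact: (linearP (qclass hecke_shift) (val a)).
Qed.

HB.instance Definition _ := GRing.isLinear.Build OE (ind (Vrep structOE r))
  (restr (\val : OE -> E D) bigPi) _ theta_map theta_map_linear.

Definition Theta : lmodType OE := submod (lin_image theta_map (full_sub _)).

Lemma to_theta_subproof x : theta_map x \in smem_pred (lin_image theta_map (full_sub _)).
Proof. by apply/smem_predP; exists x. Qed.

Definition to_theta (x : ind (Vrep structOE r)) : Theta :=
  (Sub (theta_map x) (to_theta_subproof x) :
     submod (lin_image theta_map (full_sub _))).

(* The reduction of Theta, with scalars extended from the residue field of E  *)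
(* to kbar. *)
Definition Thetabar : lmodType (kbar D) := base_change (redE D) Theta.

Definition natural_surj (psi : ind (Vrep structkbar r) -> Thetabar) : Prop :=
  forall x, psi (ind_map (coefkbar r) x) = tensor1 (redE D) (to_theta x).

End Reduction.

Definition theta (i : 'I_f) : {mpoly (kbar D)[f + f]} :=
  varX _ i * varY _ (ord_pred i) ^+ p - varY _ i * varX _ (ord_pred i) ^+ p.

Section Quotient.
Variable r : 'I_f -> nat.
Local Notation V := (Vrep structkbar r).

Definition Vstar_mem (v : V) : Prop :=
  exists P : 'I_f -> {mpoly (kbar D)[f + f]},
    val (v : polyV (kbar D) r) = \sum_i theta i * P i.

Lemma Vstar_mem0 : Vstar_mem 0.
Proof. by exists (fun=> 0); rewrite big1 // => i _; rewrite mulr0. Qed.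

Lemma Vstar_memP a x y : Vstar_mem x -> Vstar_mem y -> Vstar_mem (a *: x + y).
Proof.
move=> [P hP] [P' hP']; exists (fun i => a *: P i + P' i).
rewrite /= hP hP' scaler_sumr -big_split; apply: eq_bigr => i _.
by rewrite mulrDr scalerAr.
Qed.

Definition Vstar_sub : submodule V := Submodule Vstar_mem0 Vstar_memP.

Lemma struct_frob x : structkbar (frob D x) = structkbar x ^+ p.
Proof.
apply/eqP; rewrite -rmorphXn -subr_eq0 -rmorphB; apply/eqP.
apply/redE_ker => /=.
have /resF_ker : resF D (frob D x - x ^+ p) = 0.
  by rewrite rmorphB rmorphXn frobP subrr.
rewrite /vgt; case: eqVneq => [/= h _|n0 /=]; first by rewrite h scale0r eqxx.
by rewrite vE_F // => ->; rewrite orbT.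
Qed.

Lemma struct_frobn i x : structkbar (frobn i x) = structkbar x ^+ (p ^ i).
Proof.
rewrite /frobn; elim: i => [|i IH]; first by rewrite expn0 expr1.
by rewrite iterS struct_frob IH -exprM expnSr.
Qed.

Lemma struct_card x : structkbar x ^+ (p ^ f) = structkbar x.
Proof.
apply/eqP; rewrite -rmorphXn -subr_eq0 -rmorphB; apply/eqP.
apply/redE_ker => /=.
have /resF_ker : resF D (x ^+ (p ^ f) - x) = 0.
  by rewrite rmorphB rmorphXn -(card_kF D) expf_card subrr.
rewrite /vgt; case: eqVneq => [/= h _|n0 /=]; first by rewrite h scale0r eqxx.
by rewrite vE_F // => ->; rewrite orbT.
Qed.

Lemma struct_pred (i : 'I_f) x :
  structkbar (frobn (ord_pred i) x) ^+ p = structkbar (frobn i x).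
Proof.
rewrite !struct_frobn -exprM -expnSr; case: i => -[|i] hi /=.
  by rewrite add0n modn_small ?ltn_predL // prednK // struct_card expn0 expr1.
by rewrite modnDr modn_small // ltnW.
Qed.

Lemma kbar_pchar : p \in [pchar (kbar D)].
Proof.
rewrite !inE (p_prime D) /=.
have -> : p%:R = structkbar p%:R by rewrite rmorph_nat.
apply/eqP/redE_ker => /=.
rewrite /vgt.
have -> : val (p%:R : OF) = p%:R by rewrite (rmorph_nat (\val : OF -> F D)).
by rewrite vE_F ?pF_neq0 // vF_p ltr01 orbT.
Qed.

Lemma theta_lsubst (k : 'M[OF]_2) (i : 'I_f) :
  exists c : kbar D, lsubst (conj_mx structkbar k) (theta i) = c *: theta i.
Proof.
have pP : p \in [pchar {mpoly (kbar D)[f + f]}].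
  exact: (rmorph_pchar (@mpolyC _ _)) kbar_pchar.
pose A := conj_mx structkbar k.
have hA a b : A (ord_pred i) a b ^+ p = A i a b by rewrite !mxE /= struct_pred.
exists (A i 0 0 * A i 1 1 - A i 0 1 * A i 1 0).
rewrite -/A /theta /lsubst rmorphB !rmorphM !rmorphXn /= -!/(lsubst _ _).
rewrite !lsubstX !lsubstY !exprDn_pchar ?pnatE ?(p_prime D) // !exprZn !hA.
rewrite -!mul_mpolyC rmorphB !rmorphM /=; ring.
Qed.

Lemma Vstar_act k x : Vstar_sub x -> Vstar_sub (act k x).
Proof.
move=> [P hP].
have /choice[c hc] := theta_lsubst (val k).
exists (fun i => c i *: lsubst (conj_mx structkbar (val k)) (P i)).
rewrite /= expr0 scale1r hP /lsubst (raddf_sum (comp_mpoly _)) /=.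
apply: eq_bigr => i _; rewrite rmorphM /= -!/(lsubst _ _) hc.
by rewrite -scalerAl -scalerAr.
Qed.

Definition Vstar : subrep V := Subrep Vstar_act.

(* GL2 OF acts on V through GL_2(F_q), so this is the GL_2(F_q)-submodule     *)
(* generated by prod_i X_i^(r_i).                                             *)
Definition Xr : subrep V :=
  genrep (fun v : V => val (v : polyV (kbar D) r) = \prod_i varX _ i ^+ r i).

Definition repQ : rep OF (kbar D) := quot_rep (add_sub Vstar Xr).

Definition projQ : equivar V repQ := quot_proj (add_sub Vstar Xr).

Definition cosocQ : rep OF (kbar D) := soclayer repQ f.

End Quotient.

Section Filtration.
Variables (r : 'I_f -> nat) (ap : E D).
Variable psiQ : {linear ind (repQ r) -> Thetabar r ap}.

(* F_n, the image of ind Q_n *)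
Definition Fil (n : nat) : submodule (Thetabar r ap) :=
  lin_image psiQ (ind_in (socfil (repQ r) n)).

(* F_t = F_f / F_(f-1) *)
Definition Ft : lmodType (kbar D) :=
  quotmod (lin_preim (\val : submod (Fil f) -> Thetabar r ap) (Fil f.-1)).

Definition toFt (y : submod (Fil f)) : Ft := qclass _ y.

(* pi is induced by psiQ on ind cosoc(Q) = ind (Q_f / Q_(f-1)). *)
Definition induced_surj (pi : ind (cosocQ r) -> Ft) : Prop :=
  forall (x : ind (sub_rep (socfil (repQ r) f))) (y : submod (Fil f)),
    val y = psiQ (ind_map (sub_incl _) x) ->
    pi (ind_map (quot_proj _) x) = toFt y.

End Filtration.
End Setting.

Definition padic_unit (K : fieldType) (v : valuation K) (x : K) : Prop :=
  x != 0 /\ v x = 0.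

(* Main.v *)
Require Import Defs.
From HB Require Import structures.
From mathcomp Require Import all_boot all_order all_algebra all_field.
From mathcomp Require Import ring_quotient ring zify lra.
From mathcomp Require Import boolp functions.
From mathcomp Require Import mpoly.

Set Implicit Arguments.
Unset Strict Implicit.
Unset Printing Implicit Defensive.

Import Order.TTheory GRing.Theory Num.Theory.
Local Open Scope ring_scope.


(* Modulo V_r^*, elements of V_r are functions on F_q^2, and evaluating them
   shows that the socle layers of Q are cut out by the weights of monomials;
   in the cosocle, the vectors fixed by the upper unipotents are multiples of the
   class of eps = prod_i X_i^(r_i) Y_h / X_h.
   Applying T - a_p to u_mu Y^r, summing over mu in F_q and computing modulo
   p^2 yields
     (a_p^2 - p r_h) sum_lambda [g_lambda, eps] in im (T - a_p) + (a_p^3, p a_p) ind V(O_E).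
   The hypothesis on a_p makes the valuation of a_p^2 - p r_h smaller
   than those of a_p^3 and p a_p, so after division sum_lambda [g_lambda, eps]
   vanishes in Theta-bar, and so does T [g, prod_i X_i^(s_i)] for every weight s mapping to
   the cosocle.  Equivariance of T under lower unipotents extends this to
   the whole weight, which they generate from prod_i X_i^(s_i). *)

(** The hypothesis r = p^h mod q - 1 acts twice. On functions, V_r consists of functions homogeneous
    of degree p^h, X_r becomes the span of x^(p^h) and y^(p^h), and borrowing digits from p^h around
    the cycle Z/f yields multidegrees whose evaluations form a chain N_0, ..., N_f from X_r up to
    V_r. The socle filtration enters through the inclusion of N_j in Q_j: a larger Q_j only shrinks
    the cosocle. In characteristic 0, the lambda-terms of T cannot tell Y^r from eps modulo p, so T
    [g, Y^r - eps] = [g alpha, Y^r] mod p. Hence [g alpha, Y^r] = a_p [g, Y^r - eps] mod p in Theta;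
    as [g, u_mu Y^r] = [g g_mu alpha, Y^r], this is the source of a_p^2. It also makes X^r and Y^r
    divisible by a_p, which improves errors p X^r to p a_p. The sum over mu removes the X^r term
    modulo p and keeps only i = h among the first-order terms p r_i, since sum_mu (mu - lambda)^(r -
    p^i) is -1 for i = h and 0 otherwise. One-dimensional weights, where the alpha-term of T
    survives on the highest weight vector, need their own argument: in a nonzero cosocle, eps and
    its Weyl conjugate are independent. *)

Lemma linear_factor (R : nzRingType) (A B C : lmodType R) (u : A -> B)
    (psi : {linear A -> C}) :
  linear u -> (forall y, exists x, u x = y) ->
  (forall x, u x = 0 -> psi x = 0) ->
  exists psi' : {linear B -> C}, forall x, psi' (u x) = psi x.
Proof.
move=> ul us uk.
have [g gK] := choice us.
have uB x y : u (x - y) = u x - u y.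
  by rewrite addrC -scaleN1r ul scaleN1r addrC.
have eqP' x y : u x = u y -> psi x = psi y.
  by move=> e; apply/eqP; rewrite -subr_eq0 -linearB uk // uB e subrr.
have l : linear (psi \o g).
  by move=> a x y /=; rewrite -linearP; apply: eqP'; rewrite ul !gK.
pose P' := GRing.isLinear.Build R B C _ _ l.
pose F : {linear B -> C} := HB.pack (psi \o g) P'.
by exists F => x /=; apply: eqP'; rewrite gK.
Qed.

Lemma smem_sum (R : nzRingType) (U : lmodType R) (T : submodule U) (I : Type)
    (s : seq I) (P : pred I) (x : I -> U) :
  (forall i, P i -> T (x i)) -> T (\sum_(i <- s | P i) x i).
Proof.
by move=> hx; elim/big_rec: _ => [|i y Pi hy]; [apply: smem0 | apply: smemD => //; apply: hx].
Qed.

Lemma smemN (R : nzRingType) (U : lmodType R) (T : submodule U) x : T x -> T (- x).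
Proof. by rewrite -scaleN1r; apply: smemZ. Qed.

Lemma big_uniq_supp (I : eqType) (A : zmodType) (F : I -> A) (s t : seq I) :
  uniq s -> uniq t -> (forall i, F i != 0 -> i \in s) ->
  (forall i, F i != 0 -> i \in t) -> \sum_(i <- s) F i = \sum_(i <- t) F i.
Proof.
move=> us ut hs ht.
have key u : \sum_(i <- u) F i = \sum_(i <- u | F i != 0) F i.
  by rewrite [LHS](bigID (fun i => F i != 0)) /= [X in _ + X]big1 ?addr0 // => i /negPn/eqP.
rewrite (key s) (key t) -big_filter -[RHS]big_filter; apply: perm_big; apply: uniq_perm; rewrite ?filter_uniq //.
move=> i; rewrite !mem_filter; case: eqVneq => //= n0.
by rewrite hs // ht.
Qed.

(** * Compact induction: the elements [g, v], finite supports, functoriality *)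

Section Induced.
Variables (p f : nat) (D : padic_setting p f).
Local Notation OF := (intring (vF D)).
Local Notation OE := (intring (vE D)).
Local Notation G := (GL2 (F D)).
Local Notation K := (GL2 OF).

Section OneRep.
Variables (R : comNzRingType) (M : rep OF R).

Lemma ind_eq (x y : ind M) : (forall g, ind_fun x g = ind_fun y g) -> x = y.
Proof. by move=> e; apply/val_inj/funext. Qed.

Lemma ind_funD (x y : ind M) g : ind_fun (x + y) g = ind_fun x g + ind_fun y g.
Proof. by []. Qed.

Lemma ind_funZ a (x : ind M) g : ind_fun (a *: x) g = a *: ind_fun x g.
Proof. by []. Qed.

Lemma ind_fun_sum I (s : seq I) (x : I -> ind M) g :
  ind_fun (\sum_(i <- s) x i) g = \sum_(i <- s) ind_fun (x i) g.
Proof.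
elim: s => [|i s IH]; first by rewrite !big_nil.
by rewrite !big_cons ind_funD IH.
Qed.

Lemma ind_funK (x : ind M) n k g : ind_fun x (KZelt n k * g)%g = act k (ind_fun x g).
Proof. by have /smem_predP[ex _] := valP (x : submod (ind_sub M)); apply: ex. Qed.

Lemma ind_supp (x : ind M) : exists s : seq G, forall g, ind_fun x g != 0 ->
  exists n k h, h \in s /\ g = (KZelt n k * h)%g.
Proof. by have /smem_predP[_ [s hs]] := valP (x : submod (ind_sub M)); exists s. Qed.

Lemma elt_funN g (v : M) g' :
  ~ (exists nk, (g' * g)%g = KZelt nk.1 nk.2) -> elt_fun g v g' = 0.
Proof. by rewrite /elt_fun; case: pselect. Qed.

Lemma eltP g : linear (elt (M := M) g).
Proof.
move=> a x y; apply: ind_eq => g'; rewrite ind_funD ind_funZ /ind_fun /=.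
have [[[n k] /= e]|ne] := pselect (exists nk, (g' * g)%g = KZelt nk.1 nk.2).
  by rewrite !(elt_funE _ e) linearP.
by rewrite !elt_funN // scaler0 addr0.
Qed.

HB.instance Definition _ g := GRing.isLinear.Build R M (ind M) _ (elt g) (eltP g).

Lemma elt_KZ g n k (v : M) : elt (g * KZelt n k)%g v = elt g (act k v).
Proof.
apply: ind_eq => g'; rewrite /ind_fun /=.
have [[[n' k'] /= e]|ne] := pselect (exists nk, (g' * g)%g = KZelt nk.1 nk.2).
  rewrite (elt_funE _ e) (@elt_funE _ _ _ _ M _ _ _ (n' + n) (k' * k)%g) ?actM //.
  by rewrite mulgA e KZeltM.
rewrite !elt_funN // => -[[n' k'] /=]; rewrite mulgA => e; apply: ne.
by exists (n' - n, k' * k^-1)%g; rewrite /= -KZeltM -KZeltV -e mulgK.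
Qed.

Definition cosetKZ (g h : G) : Prop := exists n k, h = (KZelt n k * g)%g.

Lemma cosetKZ_refl g : cosetKZ g g.
Proof. by exists 0, 1%g; rewrite KZelt1 mul1g. Qed.

(** [xchoose] depends only on the extension of its predicate, so all elements of KZ g receive the
    same representative. *)
Definition coset_rep (g : G) : G :=
  xchoose (P := fun h => `[< cosetKZ g h >])
    (ex_intro _ g (introT (asboolP _) (cosetKZ_refl g))).

Lemma coset_repP g : cosetKZ g (coset_rep g).
Proof. exact/asboolP/(xchooseP (P := fun h => `[< cosetKZ g h >])). Qed.

Lemma coset_rep_eq g h : cosetKZ g h -> coset_rep g = coset_rep h.
Proof.
move=> [n [k ->]]; apply: eq_xchoose => h'; apply/asboolP/asboolP.
  move=> [n' [k' ->]]; exists (n' - n), (k' * k^-1)%g.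
  by rewrite -KZeltM -KZeltV mulgA mulgVK.
by move=> [n' [k' ->]]; exists (n' + n), (k' * k)%g; rewrite -KZeltM mulgA.
Qed.

Definition rep_supp (x : ind M) (t : seq G) : Prop :=
  [/\ uniq t, forall g, g \in t -> coset_rep g = g &
      forall g, ind_fun x g != 0 -> coset_rep g \in t].

Lemma rep_suppP (x : ind M) : exists t, rep_supp x t.
Proof.
have [s hs] := ind_supp x; exists (undup (map coset_rep s)); split.
- exact: undup_uniq.
- move=> g; rewrite mem_undup => /mapP[h _ ->].
  by rewrite -(coset_rep_eq (coset_repP h)).
- move=> g /hs[n [k [h [hh e]]]]; rewrite mem_undup; apply/mapP.
  by exists h => //; apply/esym/coset_rep_eq; exists n, k.
Qed.

(** Since [g, v] lives on KZ g^-1, the value of x on the coset of h is carried by the summand with g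
    = h^-1 alone. *)
Lemma ind_decomp (x : ind M) t : rep_supp x t ->
  x = \sum_(h <- t) elt h^-1%g (ind_fun x h).
Proof.
move=> [ut rt st]; apply: ind_eq => g; rewrite ind_fun_sum.
have off h : h \in t -> h != coset_rep g ->
    ind_fun (elt h^-1%g (ind_fun x h)) g = 0.
  move=> ht hn; rewrite /ind_fun /= elt_funN // => -[[n k] /= e].
  case/negP: hn; rewrite -(rt h ht); apply/eqP/coset_rep_eq.
  by exists n, k; rewrite -e mulgVK.
have [gt|ngt] := boolP (coset_rep g \in t); last first.
  rewrite big_seq big1 => [|h ht].
    by apply/eqP; move: ngt; apply: contraNT => /st.
  by apply: off => //; apply: contraNneq ngt => <-.
rewrite (bigD1_seq _ gt ut) /= big_seq_cond big1 ?addr0; last first.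
  by move=> h /andP[ht hn]; apply: off.
have [n [k e]] := coset_repP g.
have e' : (g * (coset_rep g)^-1)%g = KZelt (- n) k^-1%g.
  by rewrite e invgM mulgA mulgV mul1g KZeltV.
by rewrite {2}/ind_fun /= (elt_funE _ e') e ind_funK -actM mulVg act1.
Qed.

(** Recording that the summands carry values of x is what makes [ind_factor] work: if x dies in ind
    (M/N), these values all lie in N. *)
Lemma ind_gen (x : ind M) : exists s : seq (G * M),
  x = \sum_(gv <- s) elt gv.1 gv.2 /\
  forall gv, gv \in s -> exists g, gv.2 = ind_fun x g.
Proof.
have [t ht] := rep_suppP x.
exists [seq (h^-1%g, ind_fun x h) | h <- t]; split.
  by rewrite big_map /= -(ind_decomp ht).
by move=> _ /mapP[h _ ->]; exists h.
Qed.

End OneRep.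

Section Maps.
Variables (R R' : comNzRingType) (M : rep OF R) (N : rep OF R').
Variable (u : equivar M N).

Lemma ind_map_elt g v : ind_map u (elt g v) = elt g (u v).
Proof.
apply: ind_eq => g'; rewrite /ind_fun /= /ind_fun /=.
have [[[n k] /= e]|ne] := pselect (exists nk, (g' * g)%g = KZelt nk.1 nk.2).
  by rewrite (elt_funE v e) (elt_funE (u v) e); apply: equivar_act.
by rewrite !elt_funN // raddf0.
Qed.

Lemma ind_mapD x y : ind_map u (x + y) = ind_map u x + ind_map u y.
Proof. by apply: ind_eq => g; rewrite ind_funD /ind_fun /= raddfD. Qed.

Lemma ind_map0 : ind_map u 0 = 0.
Proof. by apply: ind_eq => g; rewrite /ind_fun /= raddf0. Qed.

Lemma ind_map_sum I (s : seq I) (x : I -> ind M) :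
  ind_map u (\sum_(i <- s) x i) = \sum_(i <- s) ind_map u (x i).
Proof. exact: (big_morph _ ind_mapD ind_map0). Qed.

Lemma ind_map_surj : (forall w, exists v, u v = w) ->
  forall y, exists x, ind_map u x = y.
Proof.
move=> us y; have [s [-> _]] := ind_gen y.
have [l hl] := choice us.
exists (\sum_(gv <- s) elt gv.1 (l gv.2)); rewrite ind_map_sum.
by apply: eq_bigr => gv _; rewrite ind_map_elt hl.
Qed.

Lemma ind_map_semilinear (phi : R -> R') a x :
  (forall v, u (a *: v) = phi a *: u v) -> ind_map u (a *: x) = phi a *: ind_map u x.
Proof. by move=> e; apply: ind_eq => g; rewrite ind_funZ /ind_fun /= e. Qed.

End Maps.

Lemma ind_map_lin (R : comNzRingType) (M N : rep OF R) (u : equivar M N) :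
  (forall a v, u (a *: v) = a *: u v) -> linear (ind_map u).
Proof.
by move=> e a x y; rewrite ind_mapD (@ind_map_semilinear _ _ _ _ u id).
Qed.

Lemma ind_factor (R : comNzRingType) (M : rep OF R) (N : subrep M) (C : lmodType R)
    (psi : {linear ind M -> C}) :
  (forall g v, N v -> psi (elt g v) = 0) ->
  exists psi' : {linear ind (quot_rep N) -> C},
    forall x, psi' (ind_map (quot_proj N) x) = psi x.
Proof.
move=> h; apply: (linear_factor (u := ind_map (quot_proj N))).
- by apply: ind_map_lin => a v; apply: linearZ.
- by apply: ind_map_surj => w; exists (repr w); apply: qclass_repr.
move=> x x0; have [s [xE hs]] := ind_gen x; rewrite xE linear_sum big_seq big1 //.
move=> gv /hs[g e]; apply: h.
have e0 : ind_fun (ind_map (quot_proj N) x) g = 0 by rewrite x0.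
have : N (gv.2 - 0) by apply/qclass_eq; rewrite e linear0; apply: e0.
by rewrite subr0.
Qed.

End Induced.

(** * Exponents modulo q - 1 and digits in base p *)

Lemma expr_eq_mod (R : comNzRingType) (q : nat) (x : R) (a b : nat) :
  x ^+ q = x -> (0 < q)%N -> (0 < a)%N -> (0 < b)%N -> a = b %[mod q - 1] ->
  x ^+ a = x ^+ b.
Proof.
move=> xq q0.
wlog ab : a b / (a <= b)%N => [hw a0 b0 e|a0 _ e].
  by case/orP: (leq_total a b) => ab; [apply: hw|apply/esym; apply: hw].
have step n : x ^+ (a + n * (q - 1)) = x ^+ a.
  elim: n => [|n IH]; first by rewrite mul0n addn0.
  have -> : (a + n.+1 * (q - 1) = (a + n * (q - 1)).-1 + q)%N by nia.
  by rewrite exprD xq -exprSr prednK ?IH //; lia.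
move/eqP: e; rewrite eq_sym eqn_mod_dvd // => /dvdnP[n e].
by rewrite -(subnKC ab) e step.
Qed.

(** Representatives are taken in 1..q-1 and not in 0..q-2, because x^0 and x^(q-1) differ at x =
    0. *)
Lemma mod_lt_ind (q a : nat) : (0 < a)%N -> (1 < q)%N ->
  exists2 b, (0 < b <= q - 1)%N & b = a %[mod q - 1].
Proof.
move=> a0 q1; exists ((a.-1 %% (q - 1)).+1)%N.
  by rewrite /= ltn_mod; lia.
by rewrite -addn1 modnDml addn1 prednK.
Qed.

Section Digits.
Variable (p : nat).
Hypothesis p_gt1 : (1 < p)%N.

(** Total exponent of x once X_i is sent to x^(p^i). Digits at least p are allowed; carries between
    them produce the relations among monomials. *)
Definition pval (f : nat) (b : 'I_f -> nat) : nat := \sum_(i < f) b i * p ^ i.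

Lemma pval_recl f (b : 'I_f.+1 -> nat) :
  pval b = (b ord0 + p * pval (fun i => b (fintype.lift ord0 i)))%N.
Proof.
rewrite /pval big_ord_recl expn0 muln1 big_distrr; congr (_ + _)%N.
by apply: eq_bigr => i _; rewrite /= /bump /= add1n expnS; lia.
Qed.

Lemma pval_ltn f (b : 'I_f -> nat) : (forall i, b i < p)%N -> (pval b < p ^ f)%N.
Proof.
elim: f b => [|f IH] b hb; first by rewrite /pval big_ord0 expn0.
rewrite pval_recl expnS; have hv := IH _ (fun i => hb (fintype.lift ord0 i)).
apply: leq_trans (_ : p * (pval (fun i => b (fintype.lift ord0 i))).+1 <= _)%N.
  by rewrite mulnS ltn_add2r.
by rewrite leq_mul2l hv orbT.
Qed.

Lemma pval_inj f (b c : 'I_f -> nat) : (forall i, b i < p)%N ->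
  (forall i, c i < p)%N -> pval b = pval c -> b =1 c.
Proof.
elim: f b c => [|f IH] b c hb hc; first by move=> _ [].
rewrite !pval_recl => e.
have e0 : b ord0 = c ord0.
  have := congr1 (modn^~ p) e.
  by rewrite !(mulnC p) !(addnC _ (_ * p)%N) !modnMDl !modn_small.
move: e; rewrite e0 => /addnI/eqP; rewrite eqn_pmul2l; last exact: ltnW.
move=> /eqP/IH e i; case: (unliftP ord0 i) => [j ->|-> //]; exact: e.
Qed.

Lemma pvalD f (b c : 'I_f -> nat) : pval (fun i => (b i + c i)%N) = (pval b + pval c)%N.
Proof. by rewrite /pval -big_split; apply: eq_bigr => i _; rewrite mulnDl. Qed.

Lemma pvalB f (b c : 'I_f -> nat) : (forall i, c i <= b i)%N ->
  pval (fun i => (b i - c i)%N) = (pval b - pval c)%N.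
Proof.
move=> h; have -> : pval b = (pval (fun i => (b i - c i)%N) + pval c)%N.
  by rewrite -pvalD; congr (\sum_(i < _) _)%N; apply/funext => i; rewrite subnK.
by rewrite addnK.
Qed.

Lemma leq_pval f (b c : 'I_f -> nat) : (forall i, b i <= c i)%N -> (pval b <= pval c)%N.
Proof. by move=> h; apply: leq_sum => i _; rewrite leq_mul2r h orbT. Qed.

Lemma leq_pval1 f (b : 'I_f -> nat) i : (b i * p ^ i <= pval b)%N.
Proof. by rewrite /pval (bigD1 i) //= leq_addr. Qed.

Lemma pval_delta f (i : 'I_f) n : pval (fun j => (n * (j == i))%N) = (n * p ^ i)%N.
Proof.
rewrite /pval (bigD1 i) //= eqxx muln1 big1 ?addn0 // => j /negPf ->.
by rewrite muln0.
Qed.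

Lemma pval_delta1 f (i : 'I_f) : pval (fun j => (j == i : nat)) = (p ^ i)%N.
Proof.
by rewrite -[RHS]mul1n -pval_delta; congr pval; apply/funext => j; rewrite mul1n.
Qed.

Lemma pval_eq0 f (b : 'I_f -> nat) : pval b = 0%N -> forall i, b i = 0%N.
Proof.
move=> e i; have := leq_pval1 b i; rewrite e leqn0 muln_eq0 expn_eq0.
by case/orP=> [/eqP //|/andP[/eqP p0 _]]; have := p_gt1; rewrite p0.
Qed.

Lemma expr_pval f (R : comNzRingType) (x : R) (b : 'I_f -> nat) :
  \prod_(i < f) (x ^+ (p ^ i)) ^+ b i = x ^+ pval b.
Proof.
rewrite /pval -prodrXr; apply: eq_bigr => i _.
by rewrite -exprM mulnC.
Qed.

End Digits.

(** * Power sums over a finite field *)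

Section PowerSums.
Variable (k : finFieldType).
Local Notation q := #|k|.

Lemma natr_card_eq0 : q%:R = 0 :> k.
Proof.
apply/eqP; rewrite -(inj_eq (addrI (\sum_(z : k) z))) addr0.
rewrite [in X in _ == X](reindex_inj (addIr 1)) big_split /=.
by rewrite sumr_const cardT.
Qed.

Lemma sum_pow_finField (e : nat) : (0 < e)%N ->
  \sum_(z : k) z ^+ e = - ((q - 1 %| e)%N)%:R.
Proof.
move=> e0; have q1 : (1 < q)%N := finRing_gt1 k.
have [de|nde] := boolP (q - 1 %| e)%N.
  rewrite (bigD1 0) //= expr0n eqn0Ngt e0 add0r.
  rewrite (eq_bigr (fun=> 1)) => [|z z0]; last first.
    case/dvdnP: de => n ->; rewrite mulnC exprM.
    suff -> : z ^+ (q - 1) = 1 by rewrite expr1n.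
    apply: (mulfI z0); rewrite mulr1 -exprS.
    by rewrite subn1 prednK ?expf_card // ltnW.
  rewrite sumr_const.
  have -> : #|[pred i : k | i != 0]| = q.-1 by rewrite -(cardC1 (0 : k)); apply: eq_card.
  apply/eqP; rewrite -addr_eq0 natr1 prednK 1?ltnW //.
  by rewrite natr_card_eq0.
rewrite oppr0.
have [g g0 ge] : exists2 g : k, g != 0 & g ^+ e != 1.
  pose e' := (e %% (q - 1))%N.
  have e'0 : (0 < e')%N by rewrite lt0n.
  have e'q : (e' < q - 1)%N by rewrite ltn_mod subn_gt0.
  (* If z^e = 1 for every nonzero z, the polynomial X^e' - 1 of degree e' < q - 1 would have q - 1
     roots. *)
  have [//|H] := pselect (exists2 g : k, g != 0 & g ^+ e != 1).
  have rts : all (root ('X^e' - 1 : {poly k})) [seq z <- enum k | z != 0].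
    apply/allP => z; rewrite mem_filter => /andP[z0 _].
    rewrite /root !hornerE subr_eq0; apply/eqP.
    have : z ^+ e = 1 by apply/eqP; apply: contrapT => /negP ze; apply: H; exists z.
    rewrite {1}(divn_eq e (q - 1)) exprD mulnC exprM.
    suff -> : z ^+ (q - 1) = 1 by rewrite expr1n mul1r.
    apply: (mulfI z0); rewrite mulr1 -exprS.
    by rewrite subn1 prednK ?expf_card // ltnW.
  have := max_poly_roots _ rts (filter_uniq _ (enum_uniq _)).
  have -> : size ('X^e' - 1 : {poly k}) = e'.+1 by rewrite size_XnsubC.
  rewrite -size_poly_eq0 size_XnsubC // => /(_ isT).
  have -> : size [seq z <- enum k | z != 0] = q.-1.
    by rewrite -(cardC1 (0 : k)) cardE enumT.
  by rewrite ltnS; lia.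
have inj : injective (fun z : k => g * z) by apply: mulfI.
set S := \sum_z _.
have : g ^+ e * S = S.
  rewrite /S [RHS](reindex_inj inj) mulr_sumr.
  by apply: eq_bigr => z _; rewrite exprMn.
move/eqP; rewrite -subr_eq0 -{2}[S]mul1r -mulrBl mulf_eq0 subr_eq0 (negPf ge) /=.
by move/eqP.
Qed.

End PowerSums.

(** * Residues, Teichmüller lifts and extraction of coefficients *)

Section Residues.
Variables (p f : nat) (D : padic_setting p f).
Local Notation OF := (intring (vF D)).
Local Notation OE := (intring (vE D)).
Local Notation kb := (kbar D).
Local Notation sb := (structkbar D).

Lemma prime_p : prime p. Proof. exact: p_prime D. Qed.

Lemma p_gt1 : (1 < p)%N. Proof. exact: prime_gt1 prime_p. Qed.

Lemma val_natOF n : val (n%:R : OF) = n%:R.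
Proof. exact: (rmorph_nat (\val : OF -> F D)). Qed.

Lemma val_natOE n : val (n%:R : OE) = n%:R.
Proof. exact: (rmorph_nat (\val : OE -> E D)). Qed.

Lemma resF_p : resF D p%:R = 0.
Proof.
apply/resF_ker; rewrite val_natOF /vgt vF_p.
by rewrite ltr01 orbT.
Qed.

Lemma resF_frobn i x : resF D (frobn i x) = resF D x ^+ (p ^ i).
Proof.
rewrite /frobn; elim: i => [|i IH]; first by rewrite expn0 expr1.
by rewrite iterS frobP IH -exprM expnSr.
Qed.

Lemma resF_dvd x : resF D x = 0 -> exists y, x = p%:R * y.
Proof.
move/resF_ker; rewrite /vgt; case: eqVneq => [x0 _|x0 /= vx].
  by exists 0; apply/val_inj; rewrite /= mulr0.
have [n en] := F_unramified x0.
have p0 := pF_neq0 D.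
have hy : val x / p%:R \in intring_pred (vF D).
  rewrite unfold_in /vge /= vfunM ?invr_eq0 // vV // vF_p en.
  move: vx; rewrite en ltr0z gtz0_ge1 -(ler_int rat) subr_ge0 => ->.
  by rewrite orbT.
exists (Sub (val x / p%:R) hy); apply/val_inj.
by rewrite /= val_natOF mulrC divfK.
Qed.

Lemma structkbar_eq0 x : sb x = 0 <-> resF D x = 0.
Proof.
rewrite resF_ker; split; last first.
  move=> h; apply/redE_ker; move: h; rewrite /vgt /=.
  case: eqVneq => [-> _|n0 /=]; first by rewrite scale0r eqxx.
  by rewrite vE_F // => ->; rewrite orbT.
move/redE_ker; rewrite /vgt /=; case: (eqVneq (val x) 0) => //= n0.
by rewrite scaler_eq0 (negPf n0) oner_eq0 /= vE_F.
Qed.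

Lemma structkbar_eq x y : sb x = sb y <-> resF D x = resF D y.
Proof.
split=> /eqP; rewrite -subr_eq0 -rmorphB => /eqP/structkbar_eq0/eqP;
by rewrite rmorphB subr_eq0 => /eqP.
Qed.

(** The embedding of F_q in kbar. It is additive although [teich] is not, because [structkbar] sees
    only residues. *)
Definition zeta (c : kF D) : kb := sb (teich c).

Lemma zeta_res x : zeta (resF D x) = sb x.
Proof. by apply/structkbar_eq; rewrite res_teich. Qed.

Lemma zeta_zmod : zmod_morphism zeta.
Proof.
move=> a b; rewrite /zeta -rmorphB; apply/structkbar_eq.
by rewrite rmorphB !res_teich.
Qed.

Lemma zeta_monoid : monoid_morphism zeta.
Proof.
split=> [|a b]; first by rewrite -(rmorph1 (resF D)) zeta_res rmorph1.
by rewrite /zeta -rmorphM; apply/structkbar_eq; rewrite rmorphM !res_teich.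
Qed.

HB.instance Definition _ := GRing.isZmodMorphism.Build (kF D) kb zeta zeta_zmod.
HB.instance Definition _ := GRing.isMonoidMorphism.Build (kF D) kb zeta zeta_monoid.

Hypothesis p_gt2 : (2 < p)%N.
Hypothesis f_gt0 : (0 < f)%N.

Lemma q_gt2 : (2 < p ^ f)%N.
Proof. by apply: leq_trans p_gt2 _; rewrite -{1}(expn1 p) leq_pexp2l // ltnW // p_gt1. Qed.

Lemma pf1_gt0 : (0 < p ^ f - 1)%N.
Proof. by have := q_gt2; lia. Qed.

Lemma p_odd : odd p.
Proof. by case/even_prime: prime_p => // e; move: p_gt2; rewrite e. Qed.

Lemma expN_odd (R : comNzRingType) (x : R) i : (- x) ^+ (p ^ i) = - x ^+ (p ^ i).
Proof. by rewrite exprNn -signr_odd oddX p_odd orbT expr1 mulN1r. Qed.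

Lemma teichNX c : (- teich c : OF) ^+ (p ^ f) = - teich c.
Proof. by rewrite expN_odd teichX. Qed.

Lemma mod_p_lt (h : 'I_f) : (p ^ h < p ^ f - 1)%N.
Proof.
have h1 : (p ^ h * p <= p ^ f)%N by rewrite -expnSr leq_pexp2l // ltnW // p_gt1.
have : (0 < p ^ h)%N by rewrite expn_gt0 (ltnW p_gt1).
have := p_gt2; nia.
Qed.

Lemma sum_zeta_pow e : (0 < e)%N ->
  \sum_(z : kF D) zeta z ^+ e = - (((p ^ f - 1) %| e)%N)%:R.
Proof.
move=> e0; under eq_bigr do rewrite -rmorphXn.
by rewrite -rmorph_sum sum_pow_finField // rmorphN rmorph_nat card_kF.
Qed.

Lemma natr_q_kbar : (p ^ f)%:R = 0 :> kb.
Proof.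
by rewrite -(card_kF D) -(rmorph_nat zeta) natr_card_eq0 rmorph0.
Qed.

(** Fourier inversion on F_q: the sum over z of z^(q-1-e k+e b) is -1 for b = k and 0 otherwise. The
    exponent e k has to be positive, since 0 and q - 1 pair identically with z^(q-1). *)
Lemma extract_coef (U : lmodType kb) (I : finType) (e : I -> nat) (g : I -> U) k :
  injective e -> (forall b, e b < p ^ f)%N -> (0 < e k)%N ->
  - \sum_(z : kF D) zeta z ^+ (p ^ f - 1 - e k) *:
      (\sum_b zeta z ^+ e b *: g b) = g k.
Proof.
move=> ie he k0; have hq := q_gt2; have := he k => hk.
under eq_bigr do rewrite scaler_sumr; rewrite exchange_big /=.
under eq_bigr => b _.
  under eq_bigr do rewrite scalerA -exprD.
  rewrite -scaler_suml; over.
have S b : \sum_(z : kF D) zeta z ^+ (p ^ f - 1 - e k + e b) = - (b == k)%:R.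
  (* Exponent 0 means e k = q - 1 and e b = 0; the sum is then q, which vanishes in kbar. *)
  have [e0|e0] := posnP (p ^ f - 1 - e k + e b)%N.
    rewrite e0; under eq_bigr do rewrite expr0.
    rewrite sumr_const card_kF natr_q_kbar.
    by case: eqVneq => [bk|]; rewrite ?oppr0 //; move: e0; rewrite bk; lia.
  rewrite sum_zeta_pow //; congr (- _%:R); congr nat_of_bool.
  apply/idP/eqP => [/dvdnP[n en]|->]; last by rewrite subnK ?dvdnn //; lia.
  apply: ie; have := he b; move: en; set Q := (p ^ f - 1)%N.
  case: n => [|[|n]]; rewrite ?mul0n ?mul1n; [lia|lia|].
  rewrite 2!mulSnr; nia.
under eq_bigr do rewrite S.
rewrite (bigD1 k) //= eqxx big1 ?addr0; first by rewrite scaleN1r opprK.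
by move=> b /negPf ->; rewrite oppr0 scale0r.
Qed.

(** The same extraction kills a term independent of z, so it applies to u_z phi - phi just as to u_z
    phi. *)
Lemma sum_zeta_compl k : (0 < k < p ^ f)%N ->
  \sum_(z : kF D) zeta z ^+ (p ^ f - 1 - k) = 0.
Proof.
move=> hk; have hq := q_gt2; have [e0|e0] := posnP (p ^ f - 1 - k)%N.
  rewrite e0; under eq_bigr do rewrite expr0.
  by rewrite sumr_const card_kF natr_q_kbar.
by rewrite sum_zeta_pow // gtnNdvd ?oppr0 //; lia.
Qed.

Lemma bin_kbar_neq0 n k : (k <= n < p)%N -> 'C(n, k)%:R != 0 :> kb.
Proof.
move=> /andP[kn np]; rewrite -(dvdn_pcharf (kbar_pchar D)).
have : ~~ (p %| n`!)%N.
  elim: n {kn} np => [|n IH] np; first by rewrite fact0 dvdn1; have := p_gt1; lia.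
  by rewrite factS Euclid_dvdM ?prime_p // negb_or gtnNdvd //= IH // ltnW.
by apply: contra => h; rewrite -(bin_fact kn) dvdn_mulr.
Qed.

End Residues.

(** * Elements of V_r as functions in two variables *)

Section Evaluation.
Variables (p f : nat) (D : padic_setting p f).
Local Notation OF := (intring (vF D)).
Local Notation kb := (kbar D).
Local Notation sb := (structkbar D).
Local Notation P := {mpoly kb[f + f]}.

(** Functions on pairs of integers of F instead of F_q^2: those that occur depend on residues only,
    and matrices over [OF] act without a choice of lifts. *)
Definition Fun2 := OF * OF -> kb^o.
HB.instance Definition _ := GRing.Lmodule.on Fun2.

Lemma funZE a (phi : Fun2) xy : (a *: phi) xy = a * phi xy.
Proof. by []. Qed.

Definition mono (a b : nat) : Fun2 := fun xy => sb xy.1 ^+ a * sb xy.2 ^+ b.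

Definition evpt (xy : OF * OF) (j : 'I_(f + f)) : kb :=
  match fintype.split j with
  | inl i => sb xy.1 ^+ (p ^ i)
  | inr i => sb xy.2 ^+ (p ^ i)
  end.

Definition ev (v : P) : Fun2 := fun xy => v.@[evpt xy].

Lemma evP : linear ev.
Proof.
move=> a u v; apply/funext => xy; rewrite /ev.
by rewrite mevalD mevalZ.
Qed.

HB.instance Definition _ := GRing.isLinear.Build kb P Fun2 _ ev evP.

Lemma evptX xy i : evpt xy (lshift f i) = sb xy.1 ^+ (p ^ i).
Proof. by rewrite /evpt (fintype.unsplitK (inl i)). Qed.

Lemma evptY xy i : evpt xy (rshift f i) = sb xy.2 ^+ (p ^ i).
Proof. by rewrite /evpt (fintype.unsplitK (inr i)). Qed.

Definition expX (m : 'X_{1..f + f}) (i : 'I_f) : nat := m (lshift f i).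
Definition expY (m : 'X_{1..f + f}) (i : 'I_f) : nat := m (rshift f i).

Lemma ev_mpolyX m : ev 'X_[m] = mono (pval p (expX m)) (pval p (expY m)).
Proof.
apply/funext => xy; rewrite /ev mevalX big_split_ord /= /mono.
congr (_ * _); rewrite -expr_pval; apply: eq_bigr => i _.
  by rewrite evptX.
by rewrite evptY.
Qed.

Definition fact (k : 'M[OF]_2) (phi : Fun2) : Fun2 := fun xy =>
  phi (xy.1 * k 0 0 + xy.2 * k 1 0, xy.1 * k 0 1 + xy.2 * k 1 1).

Lemma factP k : linear (fact k).
Proof. by []. Qed.

HB.instance Definition _ k := GRing.isLinear.Build kb Fun2 Fun2 _ (fact k) (factP k).

Lemma conj_mxE k (i : 'I_f) a b : conj_mx sb k i a b = sb (k a b) ^+ (p ^ i).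
Proof. by rewrite mxE; apply: struct_frobn. Qed.

(** Modulo the maximal ideal the i-th matrix is the entrywise p^i-th power of k, and raising to the
    power p^i is additive; so the twisted substitutions of all X_i, Y_i amount to one linear change
    of (x, y). *)
Lemma ev_lsubst k (v : P) : ev (lsubst (conj_mx sb k) v) = fact k (ev v).
Proof.
apply/funext => xy; rewrite /ev /fact /lsubst comp_mpoly_meval; apply: meval_eq => j.
have pP := kbar_pchar D.
have pn i : [pchar kb].-nat (p ^ i)%N.
  by rewrite pnatX pnatE ?(p_prime D) // pP.
rewrite -[j]fintype.splitK; case: (fintype.split j) => i; rewrite /= ?evptX ?evptY.
  rewrite lin_formsX mevalD !mevalZ /varX /varY !mevalXU evptX evptY !conj_mxE.
  by rewrite -!exprMn -exprDn_pchar // -!rmorphM -rmorphD !(mulrC (k _ _)).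
rewrite lin_formsY mevalD !mevalZ /varX /varY !mevalXU evptX evptY !conj_mxE.
by rewrite -!exprMn -exprDn_pchar // -!rmorphM -rmorphD !(mulrC (k _ _)).
Qed.

Lemma mono_mod a a' b : (0 < a)%N -> (0 < a')%N -> a = a' %[mod p ^ f - 1] ->
  mono a b = mono a' b.
Proof.
move=> a0 a'0 e; apply/funext => xy; congr (_ * _).
by apply: (expr_eq_mod (struct_card _)) => //; rewrite expn_gt0 (ltnW (p_gt1 D)).
Qed.

Lemma mono_modr a b b' : (0 < b)%N -> (0 < b')%N -> b = b' %[mod p ^ f - 1] ->
  mono a b = mono a b'.
Proof.
move=> b0 b'0 e; apply/funext => xy; congr (_ * _).
by apply: (expr_eq_mod (struct_card _)) => //; rewrite expn_gt0 (ltnW (p_gt1 D)).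
Qed.

(** Both terms of theta_i evaluate to (x y)^(p^i); for i = 0 this uses x^q = x. *)
Lemma ev_theta i (v : P) : ev (theta D i * v) = 0.
Proof.
apply/funext => xy; rewrite /ev mevalM.
suff -> : (theta D i).@[evpt xy] = 0 by rewrite mul0r.
rewrite /theta mevalB !mevalM !rmorphXn /= /varX /varY !mevalXU !evptX !evptY.
have hp z : (sb z ^+ (p ^ ord_pred i)) ^+ p = sb z ^+ (p ^ i).
  by rewrite -!struct_frobn struct_pred struct_frobn.
by rewrite !hp mulrC subrr.
Qed.

Definition evV (r : 'I_f -> nat) (v : Vrep sb r) : Fun2 :=
  ev (val (v : polyV kb r)).

Lemma evVP r : linear (@evV r).
Proof. by move=> a u v; rewrite /evV -linearP. Qed.

HB.instance Definition _ r := GRing.isLinear.Build kb (Vrep sb r) Fun2 _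
  (@evV r) (@evVP r).

Lemma evV_act r k (v : Vrep sb r) : evV (act k v) = fact (val k) (evV v).
Proof. by rewrite /evV /= expr0 scale1r ev_lsubst. Qed.

Lemma ev_Vstar (r : 'I_f -> nat) (v : Vrep sb r) :
  Vstar D r v -> evV v = 0.
Proof.
rewrite /evV => -[Q ->]; rewrite linear_sum big1 // => i _.
exact: ev_theta.
Qed.

Definition umx (c : OF) : 'M[OF]_2 := mx2 1 c 0 1.
Definition lmx (c : OF) : 'M[OF]_2 := mx2 1 0 c 1.

Lemma umx_unit c : umx c \in unitmx.
Proof. by rewrite unitmxE det_mx2 mulr1 mulr0 subr0 unitr1. Qed.
Lemma lmx_unit c : lmx c \in unitmx.
Proof. by rewrite unitmxE det_mx2 mulr1 mul0r subr0 unitr1. Qed.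

Definition ugl (c : OF) : GL2 OF := Sub (umx c) (umx_unit c).
Definition lgl (c : OF) : GL2 OF := Sub (lmx c) (lmx_unit c).

Lemma fact_umx c phi xy : fact (umx c) phi xy = phi (xy.1, xy.2 + xy.1 * c).
Proof. by rewrite /fact !mxE /= mulr0 addr0 !mulr1 addrC. Qed.

Lemma fact_lmx c phi xy : fact (lmx c) phi xy = phi (xy.1 + xy.2 * c, xy.2).
Proof. by rewrite /fact !mxE /= mulr0 add0r !mulr1. Qed.

Lemma monoE a b x y : mono a b (x, y) = sb x ^+ a * sb y ^+ b.
Proof. by []. Qed.

(** Each factor (x^(p^i) + y^(p^i))^(b i) is expanded separately. With digits below p, all
    coefficients with k <= b are invertible. *)
Lemma prod_binomial (x y : kb) (b : {ffun 'I_f -> 'I_p}) :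
  (x + y) ^+ pval p (fun i => b i : nat) =
  \sum_(k : {ffun 'I_f -> 'I_p}) y ^+ pval p (fun i => k i : nat) *
     ((\prod_i 'C(b i, k i)%:R) *
      x ^+ pval p (fun i => (b i - k i)%N)).
Proof.
have pP := kbar_pchar D.
have pn i : [pchar kb].-nat (p ^ i)%N.
  by rewrite pnatX pnatE ?(p_prime D) // pP.
rewrite -expr_pval.
have E (i : 'I_f) : ((x + y) ^+ (p ^ i)) ^+ b i = \sum_(k : 'I_p)
    (y ^+ (p ^ i)) ^+ k * ('C(b i, k)%:R * (x ^+ (p ^ i)) ^+ (b i - k)).
  rewrite exprDn_pchar // exprDn.
  rewrite (big_ord_widen _ (fun k : nat => ((x ^+ (p ^ i)) ^+ (b i - k) *
     (y ^+ (p ^ i)) ^+ k) *+ 'C(b i, k)) (ltn_ord (b i))).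
  rewrite [RHS](bigID (fun k : 'I_p => (k < (b i).+1)%N)) /= [X in _ = _ + X]big1 ?addr0.
    by apply: eq_bigr => k _; rewrite -mulr_natr; ring.
  by move=> k; rewrite -leqNgt => /bin_small ->; rewrite mul0r mulr0.
under eq_bigr do rewrite E; rewrite bigA_distr_bigA /=.
by apply: eq_bigr => k _; rewrite !big_split /= !expr_pval.
Qed.

Lemma fact_umx_mono c a (b : {ffun 'I_f -> 'I_p}) :
  fact (umx c) (mono a (pval p (fun i => b i : nat))) =
  \sum_(k : {ffun 'I_f -> 'I_p}) sb c ^+ pval p (fun i => k i : nat) *:
    ((\prod_i 'C(b i, k i)%:R) *:
      mono (a + pval p (fun i => k i : nat)) (pval p (fun i => (b i - k i)%N))).
Proof.
apply/funext => -[x y]; rewrite fct_sumE fact_umx monoE.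
rewrite !(rmorphD sb) (rmorphM sb) prod_binomial mulr_sumr; apply: eq_bigr => k _.
by rewrite !funZE monoE exprMn exprD; ring.
Qed.

Lemma fact_lmx_mono c (b : {ffun 'I_f -> 'I_p}) a :
  fact (lmx c) (mono (pval p (fun i => b i : nat)) a) =
  \sum_(k : {ffun 'I_f -> 'I_p}) sb c ^+ pval p (fun i => k i : nat) *:
    ((\prod_i 'C(b i, k i)%:R) *:
      mono (pval p (fun i => (b i - k i)%N)) (a + pval p (fun i => k i : nat))).
Proof.
apply/funext => -[x y]; rewrite fct_sumE fact_lmx monoE.
rewrite !(rmorphD sb) (rmorphM sb) prod_binomial mulr_suml; apply: eq_bigr => k _.
by rewrite !funZE monoE exprMn exprD; ring.
Qed.

End Evaluation.

Arguments mono {p f} D a b.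

(** Climb from [i0] to f - 1, wrap around to 0, then climb to the target. *)
Lemma ord_cycle_ind f (Q : 'I_f -> Prop) (i0 : 'I_f) :
  (forall i, Q i -> Q (ordS i)) -> Q i0 -> forall i, Q i.
Proof.
move=> hS h0.
have up n i : Q i -> (i + n < f)%N -> forall j : 'I_f, j = (i + n)%N :> nat -> Q j.
  elim: n => [|n IH] hi hn j ej.
    by have -> : j = i by apply/val_inj; rewrite /= ej addn0.
  have hn' : (i + n < f)%N by rewrite -addnS ltnW // addnS.
  have := hS _ (IH hi hn' (Ordinal hn') erefl); congr Q.
  by apply/val_inj; rewrite /= ej addnS modn_small // -addnS.
have f0 : (0 < f)%N by apply: leq_ltn_trans (ltn_ord i0).
have q0 : Q (Ordinal f0).
  have hl : (f.-1 < f)%N by rewrite prednK.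
  have hl' : (i0 + (f.-1 - i0) = f.-1)%N by rewrite subnKC // -ltnS prednK.
  have := hS _ (up (f.-1 - i0)%N i0 h0 _ (Ordinal hl) _).
  rewrite hl' => /(_ hl erefl); congr Q; apply/val_inj.
  by rewrite /= prednK // modnn.
move=> i; exact: (up i (Ordinal f0) q0 (ltn_ord i) i).
Qed.

(** * Bihomogeneous monomials *)

Section Monomials.
Variables (f : nat) (R : comNzRingType).

Definition mon (a b : 'I_f -> nat) : 'X_{1..f + f} :=
  [multinom match fintype.split j with inl i => a i | inr i => b i end | j < f + f].

Lemma monX a b i : mon a b (lshift f i) = a i.
Proof. by rewrite mnmE (fintype.unsplitK (inl i)). Qed.

Lemma monY a b i : mon a b (rshift f i) = b i.
Proof. by rewrite mnmE (fintype.unsplitK (inr i)). Qed.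

Lemma mnm_split (m m' : 'X_{1..f + f}) :
  (forall i, m (lshift f i) = m' (lshift f i)) ->
  (forall i, m (rshift f i) = m' (rshift f i)) -> m = m'.
Proof.
move=> hX hY; apply/mnmP => j; rewrite -[j]fintype.splitK.
by case: (fintype.split j) => i; [apply: hX|apply: hY].
Qed.

Lemma mpolyX_multihom (r : 'I_f -> nat) (m : 'X_{1..f + f}) :
  (forall i, (m (lshift f i) + m (rshift f i))%N = r i) ->
  ('X_[m] : {mpoly R[f + f]}) \in multihom r.
Proof. by move=> h; apply/multihomP => m'; rewrite msuppX inE => /eqP ->. Qed.

Lemma polyV_gen (r : 'I_f -> nat) (S : submodule (polyV R r)) :
  (forall u (m : 'X_{1..f + f}), (forall i, (expX m i + expY m i)%N = r i) ->
     val u = 'X_[m] -> S u) -> forall v, S v.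
Proof.
move=> h v; have /multihomP hv := valP v.
pose w m : polyV R r := insubd 0 'X_[m].
have wE m : m \in msupp (val v) -> val (w m) = 'X_[m].
  by move=> hm; rewrite /w val_insubd mpolyX_multihom // => i; apply: hv.
have -> : v = \sum_(m <- msupp (val v)) (val v)@_m *: w m.
  apply/val_inj; rewrite raddf_sum {1}[val v]mpolyE; apply: eq_big_seq => m hm.
  by rewrite /= wE.
rewrite big_seq; elim/big_rec: _ => [|m x hm hx]; first exact: smem0.
by apply: smemP => //; apply: h (wE m hm) => i; apply: hv.
Qed.

Lemma mpolyX_mon a b : 'X_[mon a b] =
  (\prod_i varX R i ^+ a i) * (\prod_i varY R i ^+ b i) :> {mpoly R[f + f]}.
Proof.
rewrite mpolyXE_id big_split_ord /=; congr (_ * _); apply: eq_bigr => i _.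
  by rewrite monX.
by rewrite monY.
Qed.

End Monomials.

(** * V_r^* as the kernel of evaluation *)

Section Kernel.
Variables (p f : nat) (D : padic_setting p f).
Local Notation kb := (kbar D).
Local Notation sb := (structkbar D).
Variable r : 'I_f -> nat.
Local Notation V := (Vrep sb r).
Hypothesis p_gt2 : (2 < p)%N.
Hypothesis f_gt0 : (0 < f)%N.
Hypothesis r_gt : forall i, (p ^ f + p - 2 < r i)%N.

Lemma r_ge_p i : (p < r i)%N.
Proof. by have := r_gt i; have := q_gt2 D p_gt2 f_gt0; lia. Qed.

Lemma r_ge_q i : (p ^ f <= r i)%N.
Proof. by have := r_gt i; lia. Qed.

(** V_r^* with monomial cofactors. Its generators lie in V, so a linear property can be tested on
    them; that it exhausts V_r^* follows from [ev_Vstar] and [ev_eq0_theta_span]. *)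
Definition theta_span : submodule V :=
  lspan (fun v : V => exists i m, val (v : polyV kb r) = theta D i * 'X_[m]).

Lemma theta_span_Vstar v : theta_span v -> Vstar D r v.
Proof.
apply=> u [i [m e]]; exists (fun j => if j == i then 'X_[m] else 0).
rewrite (bigD1 i) //= eqxx big1 ?addr0 // => j /negPf ->.
by rewrite mulr0.
Qed.

Definition vmon (b : 'I_f -> nat) : V := insubd (0 : polyV kb r) 'X_[mon (fun i => (r i - b i)%N) b].

Lemma val_vmon b : (forall i, b i <= r i)%N ->
  val (vmon b : polyV kb r) = 'X_[mon (fun i => (r i - b i)%N) b].
Proof.
move=> hb; rewrite /vmon val_insubd mpolyX_multihom // => i.
by rewrite monX monY subnK.
Qed.

Lemma vmon_eq (u : V) m : (forall i, (expX m i + expY m i)%N = r i) ->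
  val (u : polyV kb r) = 'X_[m] -> u = vmon (expY m).
Proof.
move=> hm e; apply/val_inj; rewrite e val_vmon; last first.
  by move=> i; rewrite -hm leq_addl.
congr mpolyX; apply: mnm_split => i; rewrite ?monX ?monY //.
by rewrite -hm addnK.
Qed.

Lemma ev_vmon b : (forall i, b i <= r i)%N ->
  evV (vmon b) = mono D (pval p r - pval p b) (pval p b).
Proof.
move=> hb; rewrite /evV val_vmon // ev_mpolyX; congr mono.
  rewrite -pvalB //; congr pval; apply/funext => i; exact: monX.
by congr pval; apply/funext => i; exact: monY.
Qed.

Definition dgt (n : {ffun 'I_f -> 'I_p}) : 'I_f -> nat := fun i => n i.

Lemma dgt_le n i : (dgt n i <= r i)%N.
Proof. by rewrite ltnW // (leq_trans (ltn_ord _)) // ltnW // r_ge_p. Qed.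

Lemma pval_dgt_lt n : (pval p (dgt n) < p ^ f)%N.
Proof. by apply: (pval_ltn (p_gt1 D)) => i; apply: ltn_ord. Qed.

Lemma pval_dgt_inj : injective (fun n => pval p (dgt n)).
Proof.
move=> n n' /(pval_inj (p_gt1 D)) e; apply/ffunP => i; apply/val_inj.
by apply: e => j; apply: ltn_ord.
Qed.

Lemma pval_r_gt n : (pval p (dgt n) < pval p r)%N.
Proof.
apply: leq_trans (pval_dgt_lt n) _.
apply: leq_trans (leq_pval1 p r (Ordinal f_gt0)).
by rewrite /= expn0 muln1 r_ge_q.
Qed.

(** Normal form modulo the theta_i: the q monomials with all Y-exponents below p, together with Y^r.
    These are q + 1 vectors, one for each point of the projective line over F_q. *)
Definition nform (c : {ffun 'I_f -> 'I_p} -> kb) (b : kb) : V :=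
  \sum_n c n *: vmon (dgt n) + b *: vmon r.

Definition nf_mem (v : V) : Prop := exists c b, theta_span (v - nform c b).

Lemma nf_mem0 : nf_mem 0.
Proof.
exists (fun=> 0), 0; rewrite /nform scale0r addr0 big1 ?subr0.
  exact: smem0.
by move=> n _; rewrite scale0r.
Qed.

Lemma nf_memP a x y : nf_mem x -> nf_mem y -> nf_mem (a *: x + y).
Proof.
move=> [c [b h]] [c' [b' h']]; exists (fun n => a * c n + c' n), (a * b + b').
have -> : a *: x + y - nform (fun n => a * c n + c' n) (a * b + b') =
    a *: (x - nform c b) + (y - nform c' b').
  rewrite scalerBr addrACA -opprD; congr (_ - _).
  rewrite /nform scalerDr scalerA scalerDl addrACA; congr (_ + _).
  rewrite scaler_sumr -big_split; apply: eq_bigr => n _.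
  by rewrite scalerDl scalerA.
exact: smemP.
Qed.

Definition nf_sub : submodule V := Submodule nf_mem0 nf_memP.

Lemma nf_theta_span v : theta_span v -> nf_sub v.
Proof.
move=> h; exists (fun=> 0), 0; rewrite /nform scale0r addr0 big1 ?subr0 // => n _.
by rewrite scale0r.
Qed.

Lemma nf_vmon_dgt n : nf_sub (vmon (dgt n)).
Proof.
exists (fun n' => (n' == n)%:R), 0; rewrite /nform (bigD1 n) //= eqxx scale1r.
rewrite big1 => [|n' /negPf ->]; last by rewrite scale0r.
by rewrite scale0r !addr0 subrr; apply: (smem0 theta_span).
Qed.

Lemma nf_vmon_r : nf_sub (vmon r).
Proof.
exists (fun=> 0), 1; rewrite /nform big1 => [|n _]; last by rewrite scale0r.
by rewrite scale1r add0r subrr; apply: (smem0 theta_span).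
Qed.

(** Replacing X_i Y_(i-1)^p by Y_i X_(i-1)^p lowers the total Y-degree by p - 1, so rewriting
    terminates. *)
Lemma nf_monomial u m : (forall i, (expX m i + expY m i)%N = r i) ->
  val (u : polyV kb r) = 'X_[m] -> nf_sub u.
Proof.
have [n] := ubnP (\sum_i expY m i)%N; elim: n => // n IH in u m * => hn hm e.
have [hs|hs] := pselect (forall i, expY m i < p)%N.
  rewrite (vmon_eq hm e).
  have -> : expY m = dgt [ffun i => Ordinal (hs i)].
    by apply/funext => i; rewrite /dgt ffunE.
  exact: nf_vmon_dgt.
have {hs} [i0 hi0] : exists i0, (p <= expY m i0)%N.
  apply: contrapT => H; apply: hs => i; rewrite ltnNge; apply/negP => hi.
  by apply: H; exists i.
have [[i hY hX]|hN] :=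
    pselect (exists2 i, (p <= expY m (ord_pred i))%N & (0 < expX m i)%N); last first.
  (* Rewriting is blocked: a Y-exponent at least p at i leaves no X_(i+1), hence the Y-exponent at i
     + 1 is r_(i+1) > p, and so on around the cycle. The monomial is Y^r. *)
  have hX0 i : (p <= expY m (ord_pred i))%N -> expX m i = 0%N.
    by move=> hi; apply/eqP; rewrite -leqn0 leqNgt; apply/negP => hx; apply: hN; exists i.
  have all i : (p <= expY m i)%N.
    apply: (ord_cycle_ind (Q := fun i => (p <= expY m i)%N) (i0 := i0)) => // {}i hi.
    by rewrite -[expY m _]add0n -(hX0 (ordS i)) ?ordSK // hm ltnW // r_ge_p.
  have mYr : expY m = r by apply/funext => i; rewrite -hm hX0.
  by rewrite (vmon_eq hm e) mYr; apply: nf_vmon_r.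
pose j0 := ord_pred i.
(* [m'] is the common cofactor: times X_i Y_j0^p it is the given monomial, times Y_i X_j0^p its
   replacement [m2]. *)
pose m' := mon (fun j => expX m j - (j == i))%N (fun j => expY m j - p * (j == j0))%N.
pose m2 := mon (fun j => expX m' j + p * (j == j0))%N (fun j => expY m' j + (j == i))%N.
have m'X j : (expX m' j + (j == i))%N = expX m j.
  by rewrite [expX m' j]monX subnK //; case: eqVneq => // ->.
have m'Y j : (expY m' j + p * (j == j0))%N = expY m j.
  rewrite [expY m' j]monY subnK //; case: eqVneq => [->|_]; last by rewrite muln0.
  by rewrite muln1.
have m2X j : expX m2 j = (expX m' j + p * (j == j0))%N by apply: monX.
have m2Y j : expY m2 j = (expY m' j + (j == i))%N by apply: monY.
have hm2 j : (expX m2 j + expY m2 j)%N = r j.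
  by rewrite m2X m2Y -hm -m'X -m'Y; lia.
have eX : 'X_[m] = varX kb i * varY kb j0 ^+ p * 'X_[m'].
  rewrite /varX /varY mpolyXn -!mpolyXD; congr mpolyX; apply: mnm_split => j.
    rewrite !mnmDE mulmnE !mnm1E (inj_eq (@lshift_inj _ _)) eq_rlshift mul0n addn0.
    by rewrite -[m (lshift f j)]/(expX m j) -m'X addnC (eq_sym i).
  rewrite !mnmDE mulmnE !mnm1E (inj_eq (@rshift_inj _ _)) eq_lrshift add0n.
  by rewrite -[m (rshift f j)]/(expY m j) -m'Y addnC mulnC (eq_sym j0).
have eX2 : 'X_[m2] = varY kb i * varX kb j0 ^+ p * 'X_[m'].
  rewrite /varX /varY mpolyXn -!mpolyXD; congr mpolyX; apply: mnm_split => j.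
    rewrite !mnmDE mulmnE !mnm1E (inj_eq (@lshift_inj _ _)) eq_rlshift add0n.
    by rewrite -[m2 (lshift f j)]/(expX m2 j) m2X addnC mulnC (eq_sym j0).
  rewrite !mnmDE mulmnE !mnm1E (inj_eq (@rshift_inj _ _)) eq_lrshift mul0n addn0.
  by rewrite -[m2 (rshift f j)]/(expY m2 j) m2Y addnC (eq_sym i).
have e2 : val (vmon (expY m2) : polyV kb r) = 'X_[m2].
  rewrite val_vmon; last by move=> j; rewrite -hm2 leq_addl.
  congr mpolyX; apply: mnm_split => j; last by rewrite monY.
  by rewrite monX -hm2 addnK.
have h2 : nf_sub (vmon (expY m2)).
  suff lt : (\sum_j expY m2 j < \sum_j expY m j)%N.
    by apply: IH hm2 e2; rewrite ltnS in hn; apply: leq_trans lt hn.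
  rewrite (eq_bigr _ (fun j _ => m2Y j)) -(eq_bigr _ (fun j _ => m'Y j)).
  rewrite !big_split /= ltn_add2l.
  rewrite (bigD1 i) //= eqxx big1 ?addn0 => [|j /negPf -> //].
  rewrite (bigD1 j0) //= eqxx big1 ?addn0 => [|j /negPf ->]; last by rewrite muln0.
  by rewrite muln1; have := p_gt2; lia.
rewrite -[u](subrK (vmon (expY m2))); apply: smemD => //.
apply: nf_theta_span; apply: mem_lspan; exists i, m'.
by rewrite /= e e2 eX eX2 /theta -mulrBl.
Qed.

Lemma nfP (v : V) : nf_sub v.
Proof. exact: (polyV_gen (S := nf_sub) nf_monomial). Qed.

Lemma ev_theta_span v : theta_span v -> evV v = 0.
Proof. by move/theta_span_Vstar/ev_Vstar. Qed.

Lemma ev_nform c b : evV (nform c b) =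
  \sum_n c n *: mono D (pval p r - pval p (dgt n)) (pval p (dgt n)) +
  b *: mono D 0 (pval p r).
Proof.
rewrite /nform linearD linear_sum; congr (_ + _).
  by apply: eq_bigr => n _; rewrite linearZ /= ev_vmon //; apply: dgt_le.
by rewrite linearZ /= ev_vmon // subnn.
Qed.

(** The point (0, 1) isolates the coefficient of Y^r, since the other normal monomials contain some
    X_i. The points (1, z) then give a polynomial in z with exponents below q that vanishes on
    F_q. *)
Lemma ev_eq0_theta_span (v : V) : evV v = 0 -> theta_span v.
Proof.
move=> v0; have [c [b h]] := nfP v.
suff -> : v = v - nform c b by [].
have E := ev_theta_span h.
have {}E : evV (nform c b) = 0.
  by apply/eqP; rewrite -oppr_eq0 -[X in X == _]add0r -{1}v0 -linearB /= E.
rewrite ev_nform in E.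
have pr0 : (0 < pval p r)%N by apply: leq_trans (pval_r_gt [ffun=> Ordinal (ltnW (p_gt1 D))]).
have b0 : b = 0.
  have := congr1 (fun phi : Fun2 D => phi (0, 1)) E.
  rewrite /GRing.add /= fct_sumE !funZE big1 => [|n _]; last first.
    by rewrite funZE monoE rmorph0 expr0n subn_eq0 leqNgt pval_r_gt mul0r mulr0.
  by rewrite monoE rmorph1 expr1n expr0 !mulr1 add0r.
have S z : \sum_n zeta z ^+ pval p (dgt n) *: (c n : kb^o) = 0.
  have := congr1 (fun phi : Fun2 D => phi (1, teich z)) E.
  rewrite b0 scale0r addr0 fct_sumE => E'; apply: etrans E'.
  by apply: eq_bigr => n _; rewrite funZE monoE rmorph1 expr1n mul1r mulrC.
have c0 n : (0 < pval p (dgt n))%N -> c n = 0.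
  move=> n0; rewrite -[LHS](extract_coef (D := D) p_gt2 f_gt0 (U := kb^o) c pval_dgt_inj pval_dgt_lt n0).
  by rewrite big1 ?oppr0 // => z _; rewrite S scaler0.
rewrite /nform b0 scale0r addr0 big1 ?subr0 // => n _.
have [n0|n0] := posnP (pval p (dgt n)); last by rewrite c0 ?scale0r.
have := S 0; rewrite (bigD1 n) //= n0 expr0 scale1r big1 ?addr0 => [->|n' hn'].
  by rewrite scale0r.
have [n'0|n'0] := posnP (pval p (dgt n')); last by rewrite c0 ?scaler0.
by case/eqP: hn'; apply: pval_dgt_inj; rewrite n0 n'0.
Qed.

End Kernel.

Lemma ltn_pval p f (b c : 'I_f -> nat) i : (0 < p)%N -> (forall i, b i <= c i)%N ->
  (b i < c i)%N -> (pval p b < pval p c)%N.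
Proof.
move=> p0 h hi; rewrite -subn_gt0 -pvalB //.
apply: leq_trans (leq_pval1 p _ i).
by rewrite muln_gt0 subn_gt0 hi expn_gt0 p0.
Qed.

Lemma sum_le1 f (d : 'I_f -> nat) : (\sum_i d i <= 1)%N ->
  (forall i, d i = 0%N) \/ exists i, forall t, d t = (t == i) :> nat.
Proof.
move=> h; have [h0|h0] := pselect (forall i, d i = 0%N); first by left.
have [i hi] : exists i, d i != 0%N.
  by apply: contrapT => H; apply: h0 => i; apply/eqP; apply: contrapT => /negP hi; apply: H; exists i.
right; exists i => t; have [->|ti] := eqVneq t i.
  by apply/eqP; rewrite eqn_leq lt0n hi andbT; apply: leq_trans h; rewrite (bigD1 i) //= leq_addr.
move: h; rewrite (bigD1 i) //= (bigD1 t) //=; lia.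
Qed.

(** * The chain of function spaces N_0, ..., N_f and its layers *)

Section Layers.
Variables (p f : nat) (D : padic_setting p f) (h : 'I_f).
Local Notation OF := (intring (vF D)).
Local Notation kb := (kbar D).
Local Notation sb := (structkbar D).
Hypothesis p_gt2 : (2 < p)%N.

Lemma f_gt0_of : (0 < f)%N. Proof. exact: leq_ltn_trans (ltn_ord h). Qed.
Let f_gt0 := f_gt0_of.
Let p_gt0 : (0 < p)%N := ltnW (p_gt1 D).
Local Notation q1 := (p ^ f - 1)%N.

(* The number of steps (between 1 and f) from i up to h in the cycle Z/f. *)
Definition hdist (i : 'I_f) : nat := if (i < h)%N then (h - i)%N else (h + f - i)%N.

Lemma hdist_inj : injective hdist.
Proof.
move=> i i' e; apply/val_inj; move: e; rewrite /hdist /=.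
have := ltn_ord i; have := ltn_ord i'; have := ltn_ord h.
by case: (ltnP i h); case: (ltnP i' h); lia.
Qed.

Lemma hdist_gt0 i : (0 < hdist i)%N.
Proof. by rewrite /hdist; have := ltn_ord i; case: (ltnP i h); lia. Qed.

Lemma hdist_le i : (hdist i <= f)%N.
Proof. by rewrite /hdist; have := ltn_ord h; case: (ltnP i h); lia. Qed.

Lemma hdist_h : hdist h = f.
Proof. by rewrite /hdist ltnn addKn. Qed.

Lemma hdist_ex j : (0 < j <= f)%N -> exists i, hdist i = j.
Proof.
move=> hj; have hh := ltn_ord h.
have [jh|hj'] := leqP j h.
  have hi : (h - j < f)%N by lia.
  by exists (Ordinal hi); rewrite /hdist /=; case: ltnP; lia.
have hi : (h + f - j < f)%N by lia.
by exists (Ordinal hi); rewrite /hdist /=; case: ltnP; lia.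
Qed.

Lemma ordS_val (i : 'I_f) : ordS i = (if (i.+1 < f)%N then i.+1 else 0%N) :> nat.
Proof.
rewrite /=; case: ltnP => [/modn_small //|hi].
have -> : i.+1 = f by have := ltn_ord i; lia.
by rewrite modnn.
Qed.

Lemma hdist_ordS1 i : hdist i = 1%N -> ordS i = h.
Proof.
move=> e; apply/val_inj; rewrite /= -[LHS]/(nat_of_ord (ordS i)) ordS_val.
by move: e; rewrite /hdist; have := ltn_ord h; have := ltn_ord i; case: (ltnP i.+1 f); case: (ltnP i h); lia.
Qed.

Lemma hdist_ordS i : (1 < hdist i)%N -> hdist (ordS i) = (hdist i).-1.
Proof.
rewrite /hdist ordS_val; have := ltn_ord h; have := ltn_ord i.
case: (ltnP i.+1 f) => hS; case: (ltnP i h) => hi.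
- by case: (ltnP i.+1 h); lia.
- by case: (ltnP i.+1 h); lia.
- by case: (ltnP 0 h); lia.
- by case: (ltnP 0 h); lia.
Qed.

(** Multidegrees obtained from p^h by j borrowings: p^h = p p^(h-1) = (p-1) p^(h-1) + p p^(h-2) =
    ..., with indices modulo f. After f borrowings the total is p^h + q - 1. *)
Definition wt (j : nat) (i : 'I_f) : nat :=
  if j == 0%N then (i == h : nat)
  else if hdist i == j then p else if (hdist i < j)%N then p.-1 else 0%N.

Lemma wt_top i0 j : (0 < j)%N -> hdist i0 = j -> wt j i0 = p.
Proof. by rewrite /wt lt0n => /negPf -> ->; rewrite eqxx. Qed.

Lemma wt_lt i0 j i : (0 < j)%N -> hdist i0 = j -> i != i0 -> (wt j i < p)%N.
Proof.
rewrite /wt lt0n => /negPf -> <- ni; rewrite (inj_eq hdist_inj) (negPf ni).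
by case: (hdist i < _)%N => //; rewrite prednK.
Qed.

Lemma wt_small i0 j i : (0 < j)%N -> hdist i0 = j -> i != i0 -> (0 < wt j i)%N ->
  wt j i = p.-1.
Proof.
rewrite /wt lt0n => /negPf -> <- ni; rewrite (inj_eq hdist_inj) (negPf ni).
by case: (hdist i < _)%N.
Qed.

Lemma wt_carry i0 j t : (0 < j)%N -> hdist i0 = j ->
  (wt j t + (t == ordS i0) = wt j.-1 t + p * (t == i0))%N.
Proof.
move=> j0 e0; rewrite /wt eqn0Ngt j0 /= -e0 (inj_eq hdist_inj) e0.
have tp := hdist_gt0 t.
have [j1|j1] := eqVneq j 1%N.
  rewrite j1 /= hdist_ordS1 ?e0 // ltnS leqNgt tp /=.
  by case: (t == i0); rewrite ?muln1 ?muln0; lia.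
have j2 : (1 < j)%N by lia.
have -> : (j.-1 == 0)%N = false by lia.
have eS := hdist_ordS (i := i0); rewrite e0 in eS.
rewrite -(eS j2) (inj_eq hdist_inj) eS //.
have [ti|ti] := eqVneq t i0.
  rewrite ti e0; have -> : (j < j.-1)%N = false by lia.
  have [h1|h1] := eqVneq i0 (ordS i0); last by rewrite muln1 !addn0 add0n.
  by move: (eS j2); rewrite -h1 e0; lia.
have [tS|tS] := eqVneq t (ordS i0).
  rewrite tS eS // ; have -> : (j.-1 < j)%N by lia.
  by rewrite muln0 addn0 addn1 prednK.
rewrite muln0 !addn0.
have : hdist t != j.-1 by rewrite -eS // (inj_eq hdist_inj).
have : hdist t != j by rewrite -e0 (inj_eq hdist_inj).
by case: (ltnP (hdist t) j); case: (ltnP (hdist t) j.-1); lia.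
Qed.

Lemma wt_ge i0 j t : (0 < j)%N -> hdist i0 = j -> t != i0 -> (wt j t <= wt j.-1 t)%N.
Proof.
move=> j0 e0 ti; have := wt_carry t j0 e0; rewrite (negPf ti) muln0 addn0 => <-.
exact: leq_addr.
Qed.

Lemma wt_f_ge i : (p.-1 <= wt f i)%N.
Proof.
rewrite /wt eqn0Ngt f_gt0 /=; case: eqVneq => [_|ni]; first exact: leq_pred.
by have := hdist_le i; case: (ltnP (hdist i) f) => //; lia.
Qed.

Lemma p_ordS (i : 'I_f) : (p ^ ordS i = p * p ^ i %[mod q1])%N.
Proof.
rewrite ordS_val -expnS; case: ltnP => // hi.
have -> : i.+1 = f by have := ltn_ord i; lia.
by apply/eqP; rewrite expn0 eq_sym eqn_mod_dvd ?dvdnn // expn_gt0 p_gt0.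
Qed.

Lemma pval_wt j : (j <= f)%N -> (pval p (wt j) = p ^ h %[mod q1])%N.
Proof.
elim: j => [|j IH] hj.
  by rewrite -(pval_delta1 p h); congr (pval _ _ %% _)%N; apply/funext.
have [i0 e0] := @hdist_ex j.+1 hj.
have := congr1 (@pval p f) (funext (fun t => @wt_carry i0 j.+1 t isT e0)).
rewrite !pvalD pval_delta1 pval_delta /= => e.
apply/eqP; rewrite -(eqn_modDr (p ^ ordS i0)) e -modnDmr -p_ordS modnDmr.
by rewrite eqn_modDr; apply/eqP/IH/ltnW.
Qed.

Lemma pval_wt_gt0 j : (j <= f)%N -> (0 < pval p (wt j))%N.
Proof.
move=> hj; have := pval_wt hj; case: (posnP (pval _ _)) => // ->.
rewrite mod0n modn_small ?mod_p_lt // => e.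
have : (0 < p ^ h)%N by rewrite expn_gt0 p_gt0.
by rewrite -e.
Qed.

(** N_0 is spanned by x^(p^h) and y^(p^h), the evaluations coming from X_r, and N_f receives all of
    V_r. *)
Definition N (j : nat) : submodule (Fun2 D) :=
  lin_image (@evV p f D (wt j)) (full_sub _).

Lemma N_act j k phi : N j phi -> N j (fact (val (k : GL2 OF)) phi).
Proof. by move=> [w _ <-]; exists (act k w) => //; apply: evV_act. Qed.

Lemma N_mono j b : (forall i, b i <= wt j i)%N ->
  N j (mono D (pval p (wt j) - pval p b) (pval p b)).
Proof. by move=> hb; exists (vmon D (wt j) b) => //; apply: ev_vmon. Qed.

Lemma N_gen j (S : submodule (Fun2 D)) :
  (forall b, (forall i, b i <= wt j i)%N ->
     S (mono D (pval p (wt j) - pval p b) (pval p b))) ->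
  forall phi, N j phi -> S phi.
Proof.
move=> hS _ [w _ <-].
apply: (polyV_gen (S := lin_preim (@evV p f D (wt j)) S)) => u m hm e.
have hb i : (expY m i <= wt j i)%N by rewrite -hm leq_addl.
rewrite (vmon_eq hm e); change (S (evV (vmon D (wt j) (expY m)))).
by rewrite ev_vmon //; apply: hS.
Qed.

(** The monomial in y^n of degree p^h modulo q - 1: for n <= q - 1 the exponent of x is a positive
    representative of p^h - n, and this determines the function. *)
Definition mN (n : nat) : Fun2 D := mono D (q1 - n + q1 + p ^ h) n.

Lemma mN_exp_gt0 n : (0 < q1 - n + q1 + p ^ h)%N.
Proof. by rewrite addn_gt0 expn_gt0 p_gt0 orbT. Qed.

Lemma mono_mN a n : (0 < a)%N -> (n <= q1)%N -> (a + n = p ^ h %[mod q1])%N ->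
  mono D a n = mN n.
Proof.
move=> a0 hn e; apply: mono_mod => //; first exact: mN_exp_gt0.
apply/eqP; rewrite -(eqn_modDr n) e.
have -> : (q1 - n + q1 + p ^ h + n = q1 + (q1 + p ^ h))%N by lia.
by rewrite !modnDl.
Qed.

Lemma N_x j : (j <= f)%N -> N j (mN 0).
Proof.
move=> hj; rewrite -(@mono_mN (pval p (wt j)) 0) ?pval_wt_gt0 // ?addn0 ?pval_wt //.
have := @N_mono j (fun=> 0%N) (fun=> leq0n _).
by rewrite /pval (@big1 _ _ _ _ _ _ (fun i : 'I_f => 0 * p ^ i)%N) // subn0.
Qed.

(** The bound on [wt j i] leaves a positive power of x beside y^(p^i), so that its exponent may be
    read modulo q - 1. *)
Lemma N_e j i : (j <= f)%N -> (1 < wt j i)%N -> N j (mN (p ^ i)).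
Proof.
move=> hj hi.
have le t : ((t == i) <= wt j t)%N by case: eqVneq => // ->; apply: ltnW.
have lt : (p ^ i < pval p (wt j))%N.
  by rewrite -(pval_delta1 p i); apply: (@ltn_pval _ _ _ _ i); rewrite // eqxx.
have := N_mono le; rewrite pval_delta1 mono_mN //.
- by rewrite subn_gt0.
- by rewrite ltnW // mod_p_lt.
by rewrite subnK ?pval_wt // ltnW.
Qed.

(** Digits of the monomials that span N_j modulo N_(j-1): those that use position [i0], where [wt j]
    has its degree p. *)
Definition inlayer j i0 (n : {ffun 'I_f -> 'I_p}) : Prop :=
  (forall i, n i <= wt j i)%N /\ (0 < n i0)%N.

Definition mND (n : {ffun 'I_f -> 'I_p}) := mN (pval p (dgt n)).

Lemma pval_dgt_le n : (pval p (@dgt p f n) <= q1)%N.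
Proof. by have := pval_dgt_lt D n; lia. Qed.

(** The exponent at [i0] decides: 0 puts a monomial in N_(j-1), a value in 1..p-1 puts it in the
    layer, and p is carried to a unit at the next position, which leads back to N_(j-1). *)
Lemma N_decomp j i0 phi : (0 < j <= f)%N -> hdist i0 = j -> N j phi ->
  exists c, (forall n, c n != 0 -> inlayer j i0 n) /\
    N j.-1 (phi - \sum_n c n *: mND n).
Proof.
move=> /andP[j0 jf] e0.
pose mem (phi : Fun2 D) := exists c : {ffun 'I_f -> 'I_p} -> kb,
  (forall n, c n != 0 -> inlayer j i0 n) /\ N j.-1 (phi - \sum_n c n *: mND n).
have inj phi' : N j.-1 phi' -> mem phi'.
  exists (fun=> 0); split=> [n|]; first by rewrite eqxx.
  by rewrite big1 ?subr0 // => n _; rewrite scale0r.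
have mem0 : mem 0 by apply: inj; apply: (smem0 (N j.-1)).
have memP a x y : mem x -> mem y -> mem (a *: x + y).
  move=> [c [hc h1]] [c' [hc' h2]]; exists (fun n => a * c n + c' n); split=> [n|].
    have [cn|/hc //] := eqVneq (c n) 0; rewrite cn mulr0 add0r; exact: hc'.
  have -> : a *: x + y - \sum_n (a * c n + c' n) *: mND n =
      a *: (x - \sum_n c n *: mND n) + (y - \sum_n c' n *: mND n).
    rewrite scalerBr addrACA -opprD; congr (_ - _).
    rewrite scaler_sumr -big_split; apply: eq_bigr => n _.
    by rewrite scalerDl scalerA.
  exact: smemP.
apply: (N_gen (S := Submodule mem0 memP)) => b hb; rewrite /=.
have jf' : (j.-1 <= f)%N by lia.
have hw := pval_wt jf; have hw' := pval_wt jf'.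
have bp i : i != i0 -> (b i < p)%N.
  by move=> ni; apply: leq_ltn_trans (hb i) (wt_lt j0 e0 ni).
have bi0 := hb i0; rewrite (wt_top j0 e0) in bi0.
have lew := leq_pval p hb.
have [bz|bpos] := posnP (b i0).
  apply: inj.
  have le t : (b t <= wt j.-1 t)%N.
    by have [->|ti] := eqVneq t i0; rewrite ?bz //; apply: leq_trans (hb t) (wt_ge j0 e0 ti).
  (* The unit borrowed from the next position leaves room there, so x keeps a positive exponent in
     multidegree [wt j.-1]. *)
  have lt : (b (ordS i0) < wt j.-1 (ordS i0))%N.
    have := wt_carry (ordS i0) j0 e0; rewrite eqxx.
    have [eS|nS] := eqVneq (ordS i0) i0.
      by rewrite eS bz (wt_top j0 e0) muln1 addnC => /addIn <-.
    by rewrite muln0 addn0 addn1 => <-; rewrite ltnS.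
  have a0 : (0 < pval p (wt j) - pval p b)%N.
    rewrite subn_gt0; apply: (@ltn_pval _ _ _ _ i0) => //.
    by rewrite bz (wt_top j0 e0).
  have a0' : (0 < pval p (wt j.-1) - pval p b)%N.
    by rewrite subn_gt0; apply: (@ltn_pval _ _ _ _ (ordS i0)).
  rewrite (@mono_mod _ _ D _ (pval p (wt j.-1) - pval p b)) //; first exact: N_mono.
  apply/eqP; rewrite -(eqn_modDr (pval p b)) !subnK ?hw ?hw' //.
  exact: leq_pval.
have [blt|bge] := ltnP (b i0) p.
  have bp' i : (b i < p)%N by have [->//|/bp] := eqVneq i i0.
  pose n : {ffun 'I_f -> 'I_p} := [ffun i => Ordinal (bp' i)].
  have nb : dgt n = b by apply/funext => i; rewrite /dgt ffunE.
  exists (fun n' => (n' == n)%:R); split=> [n'|].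
    have [->|_] := eqVneq n' n; last by rewrite eqxx.
    by move=> _; split=> [i|]; rewrite -/(dgt n _) nb.
  rewrite (bigD1 n) //= eqxx scale1r big1 ?addr0 => [|n' /negPf ->]; last by rewrite scale0r.
  rewrite /mND nb mono_mN ?subrr; first exact: (smem0 (N j.-1)).
  - rewrite subn_gt0; apply: (@ltn_pval _ _ _ _ i0) => //.
    by rewrite (wt_top j0 e0).
  - by rewrite -nb pval_dgt_le.
  by rewrite subnK.
have {bi0 bge} bE : b i0 = p by lia.
apply: inj.
have [b' carry b'S] : exists2 b' : 'I_f -> nat,
    (forall t, b t + (t == ordS i0) = b' t + p * (t == i0))%N & (0 < b' (ordS i0))%N.
  exists (fun t => b t - p * (t == i0) + (t == ordS i0))%N; last by rewrite eqxx addn1.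
  move=> t; case: (eqVneq t i0) => [->|_]; last by rewrite muln0 subn0 !addn0.
  by rewrite bE muln1 subnn add0n addnC.
have le t : (b' t <= wt j.-1 t)%N.
  by rewrite -(leq_add2r (p * (t == i0))) -carry -(wt_carry t j0 e0) leq_add2r.
have ew := congr1 (@pval p f) (funext (fun t => @wt_carry i0 j t j0 e0)).
have eb := congr1 (@pval p f) (funext carry).
move: ew eb; rewrite !pvalD pval_delta1 pval_delta => ew eb.
have le' := leq_pval p le.
have b'0 : (0 < pval p b')%N.
  apply: leq_trans (leq_pval1 p b' (ordS i0)).
  by rewrite muln_gt0 expn_gt0 p_gt0 b'S.
have b0 : (0 < pval p b)%N.
  by apply: leq_trans (leq_pval1 p b i0); rewrite bE muln_gt0 expn_gt0 p_gt0.
rewrite -(subnDr (p ^ ordS i0)) ew eb subnDr.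
rewrite (@mono_modr _ _ D _ _ (pval p b')) //; first exact: N_mono.
apply/eqP; rewrite -(eqn_modDr (p ^ ordS i0)) eb eqn_modDl.
by apply/eqP; rewrite p_ordS.
Qed.

Lemma submodZ_inv (U : lmodType kb) (T : submodule U) a x : a != 0 -> T (a *: x) -> T x.
Proof. by move=> a0 /(smemZ a^-1); rewrite scalerA mulVf // scale1r. Qed.

Lemma prod_bin_neq0 (b k : {ffun 'I_f -> 'I_p}) : (forall i, k i <= b i)%N ->
  \prod_i ('C(b i, k i)%:R : kb) != 0.
Proof.
by move=> hk; apply/prodf_neq0 => i _; rewrite (bin_kbar_neq0 D) // hk ltn_ord.
Qed.

(** Choose [n1] of maximal digit sum in phi and put k = n1 - e_i0. By maximality the coefficient of
    z^k in u_z phi involves only n = k and n = k + e_i. The terms n = k and i <> i0 lie in N_(j-1);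
    the term i = i0 is an invertible multiple of [mN (p ^ i0)]. *)
Lemma mN_key (T : submodule (Fun2 D)) j i0 c n0 (phi := \sum_n c n *: mND n) :
  (0 < j <= f)%N -> hdist i0 = j -> (forall phi, N j.-1 phi -> T phi) ->
  (forall n, c n != 0 -> inlayer j i0 n) ->
  (forall z, T (fact (umx (teich z)) phi - phi)) ->
  c n0 != 0 -> pval p (dgt n0) <> (p ^ i0)%N -> T (mN (p ^ i0)).
Proof.
move=> /andP[j0 jf] e0 hN hc hT c0 n0e.
pose ds (n : {ffun 'I_f -> 'I_p}) := (\sum_i n i)%N.
case: (arg_maxnP ds (P := fun n => c n != 0) c0) => n1 c1 max1.
have jf' : (j.-1 <= f)%N by lia.
have [_ n1i0] := hc _ c1.
have kp i : (n1 i - (i == i0) < p)%N by apply: leq_ltn_trans (leq_subr _ _) (ltn_ord _).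
pose k : {ffun 'I_f -> 'I_p} := [ffun i => Ordinal (kp i)].
have kE i : (k i + (i == i0) = n1 i)%N.
  by rewrite ffunE /= subnK //; case: eqVneq => // ->.
have dsn1 : ds n1 = (ds k).+1.
  rewrite /ds (eq_bigr _ (fun i _ => esym (kE i))) big_split /= -addn1; congr (_ + _)%N.
  by rewrite (bigD1 i0) //= eqxx big1 // => i /negPf ->.
(* Here [n0] enters: k = 0 would bound all digit sums by 1 and force n0 = e_i0. Positivity is what
   coefficient extraction requires. *)
have k0 : (0 < pval p (dgt k))%N.
  rewrite lt0n; apply/eqP => /(pval_eq0 (p_gt1 D)) kz.
  have ds0 : (ds n0 <= 1)%N.
    apply: leq_trans (max1 _ c0) _; rewrite dsn1 ltnS leqn0 /ds big1 // => i _.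
    exact: kz.
  have [_ n0i0] := hc _ c0.
  case: (sum_le1 ds0) => [hz|[i hi]]; first by rewrite hz in n0i0.
  apply: n0e.
  have ii0 : i = i0 by move: n0i0; rewrite hi; case: eqVneq.
  rewrite -(pval_delta1 p i0) -ii0; congr pval; apply/funext => t; exact: hi.
pose g (k' : {ffun 'I_f -> 'I_p}) : Fun2 D := \sum_n c n *:
  ((\prod_i 'C(n i, k' i)%:R) *: mono D (q1 - pval p (dgt n) + q1 + p ^ h + pval p (dgt k'))
      (pval p (fun i => (n i - k' i)%N))).
have Tg : T (g k).
  rewrite -(extract_coef (D := D) p_gt2 f_gt0 (U := Fun2 D) g (pval_dgt_inj D) (pval_dgt_lt D) k0).
  have E z : \sum_k' zeta z ^+ pval p (dgt k') *: g k' = fact (umx (teich z)) phi.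
    rewrite /phi linear_sum /g.
    under eq_bigr do rewrite scaler_sumr.
    rewrite exchange_big; apply: eq_bigr => n _.
    rewrite linearZ /= /mND /mN (fact_umx_mono (teich z) _ n) scaler_sumr.
    apply: eq_bigr => k1 _; rewrite !scalerA; congr (_ *: _); rewrite mulrCA; exact: mulrA.
  have -> : \sum_z zeta z ^+ (p ^ f - 1 - pval p (dgt k)) *:
       (\sum_b zeta z ^+ pval p (dgt b) *: g b) =
     \sum_z zeta z ^+ (p ^ f - 1 - pval p (dgt k)) *: (fact (umx (teich z)) phi - phi).
    rewrite [RHS](eq_bigr _ (fun z _ => scalerBr _ _ _)) sumrB -scaler_suml.
    rewrite (sum_zeta_compl D p_gt2 f_gt0) ?scale0r ?subr0; last first.
      by rewrite k0 pval_dgt_lt.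
    by apply: eq_bigr => z _; rewrite E.
  by apply: smemN; apply: smem_sum => z _; apply: smemZ.
move: Tg; rewrite /g (bigD1 n1) //= => Tg.
have Trest : T (\sum_(n | n != n1) c n *: ((\prod_i 'C(n i, k i)%:R) *:
    mono D (q1 - pval p (dgt n) + q1 + p ^ h + pval p (dgt k))
      (pval p (fun i => (n i - k i)%N)))).
  apply: smem_sum => n nn1.
  have [cn|cn] := eqVneq (c n) 0; first by rewrite cn scale0r; apply: smem0.
  have [hle|hnle] := pselect (forall i, (k i <= n i)%N); last first.
    have [i hi] : exists i, (n i < k i)%N.
      apply: contrapT => H; apply: hnle => i; rewrite leqNgt; apply/negP => hi.
      by apply: H; exists i.
    rewrite (bigD1 i) //= bin_small // mul0r scale0r scaler0; exact: smem0.
  apply: smemZ; apply: smemZ.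
  have hle' : (pval p (dgt k) <= pval p (dgt n))%N by apply: leq_pval => i; apply: hle.
  have -> : (pval p (fun i => (n i - k i)%N) = pval p (dgt n) - pval p (dgt k))%N.
    by rewrite -pvalB.
  have hn := pval_dgt_le n.
  have -> : (q1 - pval p (dgt n) + q1 + p ^ h + pval p (dgt k) =
     q1 - (pval p (dgt n) - pval p (dgt k)) + q1 + p ^ h)%N.
    move: (pval p (dgt n)) (pval p (dgt k)) hle' hn => x y; lia.
  rewrite -/(mN _).
  have hds : (\sum_i (n i - k i) <= 1)%N.
    rewrite -(leq_add2r (ds k)) -big_split /= add1n -dsn1.
    by rewrite (eq_bigr (fun i => n i : nat)) => [|i _]; [apply: max1 | rewrite subnK].
  case: (sum_le1 hds) => [hz|[i hi]].
    have -> : (pval p (dgt n) - pval p (dgt k) = 0)%N.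
      by rewrite -pvalB // /pval big1 // => i _; rewrite /dgt hz.
    by apply: hN; apply: N_x.
  have -> : (pval p (dgt n) - pval p (dgt k) = p ^ i)%N.
    by rewrite -pvalB // -(pval_delta1 p i); congr pval; apply/funext.
  have nE t : n t = (k t + (t == i))%N :> nat by rewrite -hi subnKC.
  have ii0 : i != i0.
    apply: contraNneq nn1 => ii0; apply/eqP/ffunP => t; apply/val_inj.
    by rewrite /= nE ii0 kE.
  have [hw _] := hc _ cn.
  have ni : (0 < n i)%N by rewrite nE eqxx addn1.
  (* Away from [i0] a positive degree of [wt j] equals p - 1 > 1, so [N_e] places the term in
     N_(j-1). *)
  have wi := wt_small j0 e0 ii0 (leq_trans ni (hw i)).
  apply: hN; apply: N_e => //.
  apply: leq_trans (wt_ge j0 e0 ii0); rewrite wi; have := p_gt2; lia.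
have := smemD Tg (smemN Trest); rewrite addrK scalerA.
have le i : (k i <= n1 i)%N by rewrite -kE leq_addr.
have -> : pval p (fun i => (n1 i - k i)%N) = (p ^ i0)%N.
  by rewrite -(pval_delta1 p i0); congr pval; apply/funext => i; rewrite -kE addKn.
have pn1 : pval p (dgt n1) = (pval p (dgt k) + p ^ i0)%N.
  by rewrite -(pval_delta1 p i0) -pvalD; congr pval; apply/funext => i; apply/esym/kE.
have -> : (q1 - pval p (dgt n1) + q1 + p ^ h + pval p (dgt k) =
     q1 - p ^ i0 + q1 + p ^ h)%N.
  have := pval_dgt_le n1; rewrite pn1.
  move: (pval p (dgt k)) (p ^ i0)%N => x y; lia.
by apply: submodZ_inv; rewrite mulf_neq0 // prod_bin_neq0.
Qed.

(** With A = [wt j] - e_i0, whose digits are below p, [mN (p ^ i0)] is x^A y^(p^i0). Under x -> x +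
    z y the coefficient of z^k is an invertible multiple of x^(A-k) y^(p^i0+k) for k <= A, and these
    are the monomials of the layer. *)
Lemma N_from_mN (T : submodule (Fun2 D)) j i0 :
  (0 < j <= f)%N -> hdist i0 = j -> (forall phi, N j.-1 phi -> T phi) ->
  (forall z phi, T phi -> T (fact (lmx (teich z)) phi)) ->
  T (mN (p ^ i0)) -> forall phi, N j phi -> T phi.
Proof.
move=> hj e0 hN hT Tm phi /(N_decomp hj e0) [c [hc hphi]].
rewrite -[phi](subrK (\sum_n c n *: mND n)); apply: smemD; first exact: hN.
apply: smem_sum => n _.
have [cn|cn] := eqVneq (c n) 0; first by rewrite cn scale0r; apply: smem0.
apply: smemZ; have [nw ni0] := hc _ cn.
have /andP[j0 jf] := hj.
have Ap i : (wt j i - (i == i0) < p)%N.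
  have [->|ii0] := eqVneq i i0; last by rewrite subn0 (wt_lt j0 e0).
  by rewrite (wt_top j0 e0) subn1 prednK.
pose A : {ffun 'I_f -> 'I_p} := [ffun i => Ordinal (Ap i)].
have AE i : (A i + (i == i0) = wt j i)%N.
  by rewrite ffunE /= subnK //; case: eqVneq => // ->; rewrite (wt_top j0 e0).
have kp i : (n i - (i == i0) < p)%N by apply: leq_ltn_trans (leq_subr _ _) (ltn_ord _).
pose k : {ffun 'I_f -> 'I_p} := [ffun i => Ordinal (kp i)].
have kE i : (k i + (i == i0) = n i)%N.
  by rewrite ffunE /= subnK //; case: eqVneq => // ->.
have kA i : (k i <= A i)%N by rewrite -(leq_add2r (i == i0)) kE AE.
have kA0 : (k i0 < A i0)%N.
  have := kE i0; have := AE i0; rewrite eqxx (wt_top j0 e0); have := ltn_ord (n i0); lia.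
have pn : pval p (dgt n) = (p ^ i0 + pval p (dgt k))%N.
  by rewrite -(pval_delta1 p i0) -pvalD; congr pval; apply/funext => i; rewrite addnC; apply/esym/kE.
have pA : pval p (wt j) = (p ^ i0 + pval p (dgt A))%N.
  by rewrite -(pval_delta1 p i0) -pvalD; congr pval; apply/funext => i; rewrite addnC; apply/esym/AE.
have A0 : (0 < pval p (dgt A))%N.
  apply: leq_trans (leq_pval1 p (dgt A) i0).
  by rewrite muln_gt0 expn_gt0 p_gt0 andbT; apply: leq_trans kA0.
have Am : mono D (pval p (dgt A)) (p ^ i0) = mN (p ^ i0).
  apply: mono_mN => //; first by rewrite ltnW // mod_p_lt.
  by rewrite addnC -pA pval_wt.
have [k0|k0] := posnP (pval p (dgt k)).
  by rewrite /mND pn k0 addn0.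
have kAl : (pval p (dgt k) < pval p (dgt A))%N by apply: (@ltn_pval _ _ _ _ i0).
pose g (k' : {ffun 'I_f -> 'I_p}) : Fun2 D := (\prod_i 'C(A i, k' i)%:R) *:
  mono D (pval p (fun i => (A i - k' i)%N)) (p ^ i0 + pval p (dgt k')).
have eAk : pval p (fun i => (A i - k i)%N) = (pval p (dgt A) - pval p (dgt k))%N.
  exact: pvalB.
suff : T (g k).
  rewrite /g eAk => /(submodZ_inv (prod_bin_neq0 kA)).
  rewrite -pn mono_mN //.
  - by rewrite subn_gt0.
  - exact: pval_dgt_le.
  rewrite [in LHS]pn addnCA (subnK (ltnW kAl)) -pA; exact: pval_wt.
rewrite -(extract_coef (D := D) p_gt2 f_gt0 (U := Fun2 D) g (pval_dgt_inj D) (pval_dgt_lt D) k0).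
apply: smemN; apply: smem_sum => z _; apply: smemZ.
suff <- : fact (lmx (teich z)) (mN (p ^ i0)) =
  \sum_b zeta z ^+ pval p (dgt b) *: g b by apply: hT.
by rewrite -Am; apply: fact_lmx_mono.
Qed.

(** Dichotomy behind both the simplicity of the layers and the shape of the cosocle: a monomial of
    phi other than [mN (p ^ i0)] feeds [mN_key], and without one phi is a multiple of it modulo
    N_(j-1). *)
Lemma layer_U_invariant (T : submodule (Fun2 D)) j i0 phi :
  (0 < j <= f)%N -> hdist i0 = j -> (forall phi, N j.-1 phi -> T phi) ->
  (forall z phi, T phi -> T (fact (umx (teich z)) phi)) ->
  N j phi -> (forall z, T (fact (umx (teich z)) phi - phi)) ->
  T (mN (p ^ i0)) \/ exists c, N j.-1 (phi - c *: mN (p ^ i0)).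
Proof.
move=> hj e0 hN hU hphi hT; have [c [hc hd]] := N_decomp hj e0 hphi.
set phi' := \sum_n _ in hd.
have [[n0 c0 n0e]|nn] := pselect (exists2 n0, c n0 != 0 & pval p (dgt n0) <> (p ^ i0)%N).
  left; apply: (mN_key hj e0 hN hc _ c0 n0e) => z; rewrite -/phi'.
  have -> : fact (umx (teich z)) phi' - phi' =
     (fact (umx (teich z)) phi - phi) +
     ((phi - phi') - fact (umx (teich z)) (phi - phi')).
    rewrite [fact _ (phi - phi')](linearB (fact (umx (teich z)))) opprB.
    by rewrite addrA subrKA addrC subrKA.
  apply: smemD => //; apply: smemD; first exact: hN.
  by apply: smemN; apply: hU; apply: hN.
right; exists (\sum_n c n); rewrite scaler_suml.
congr (N _ (_ - _)): hd; apply: eq_bigr => n _.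
have [->|cn] := eqVneq (c n) 0; first by rewrite !scale0r.
by congr (_ *: mN _); apply: contrapT => H; apply: nn; exists n.
Qed.

End Layers.

Arguments mN {p f} D h n.
Arguments mND {p f} D h n.

Lemma semi_invariant_comb (R : comNzRingType) (U : lmodType R) (F X A B : U) (c e : R) :
  c *: (A - e *: B) = (F - e *: X) + e *: (X - c *: B) - (F - c *: A).
Proof.
have -> : e *: (X - c *: B) = e *: X - (c * e) *: B by rewrite scalerBr scalerA mulrC.
by rewrite scalerBr scalerA addrA subrK opprB [RHS]addrC addrA subrK.
Qed.

(** * The socle filtration of Q and invariants in its cosocle *)

Section Socle.
Variables (p f : nat) (D : padic_setting p f) (h : 'I_f) (r : 'I_f -> nat).
Local Notation OF := (intring (vF D)).
Local Notation kb := (kbar D).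
Local Notation sb := (structkbar D).
Local Notation V := (Vrep sb r).
Local Notation Q := (repQ D r).
Local Notation q1 := (p ^ f - 1)%N.
Hypothesis p_gt2 : (2 < p)%N.
Hypothesis r_gt : forall i, (p ^ f + p - 2 < r i)%N.
Hypothesis r_mod : pval p r = p ^ h %[mod q1].
Let f_gt0 : (0 < f)%N := f_gt0_of h.

Definition Qker : subrep V := add_sub (Vstar D r) (Xr D r).
Definition cls (v : V) : Q := qclass Qker v.

Lemma cls_linear : linear cls.
Proof. exact: linearP. Qed.

HB.instance Definition _ := GRing.isLinear.Build kb V Q _ cls cls_linear.

Lemma cls_act k v : cls (act k v) = act k (cls v).
Proof. exact: qclass_act. Qed.

Lemma cls_surj (x : Q) : exists v, cls v = x.
Proof. by exists (repr x); apply: qclass_repr. Qed.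

Lemma q1_lt : (q1 < p ^ f)%N.
Proof. by rewrite subn1 ltn_predL expn_gt0 (ltnW (p_gt1 D)). Qed.

Lemma pval_r_ge_q : (p ^ f <= pval p r)%N.
Proof.
apply: leq_trans (leq_pval1 p r (Ordinal f_gt0)).
by rewrite /= expn0 muln1 (r_ge_q p_gt2 f_gt0 r_gt).
Qed.

Lemma pval_r_gt0 : (0 < pval p r)%N.
Proof. by apply: leq_trans pval_r_ge_q; rewrite expn_gt0 (ltnW (p_gt1 D)). Qed.

Lemma pval_zero : pval p (fun i : 'I_f => 0%N) = 0%N.
Proof. by rewrite /pval (@big1 _ _ _ _ _ _ (fun i : 'I_f => 0 * p ^ i)%N). Qed.

Lemma evV_vmon0 : evV (vmon D r (fun=> 0%N)) = mono D (pval p r) 0.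
Proof. by rewrite ev_vmon // pval_zero subn0. Qed.

(** Because r_0 >= q, the variable Y_0 alone realises every y-exponent in 1..q-1 and leaves x a
    positive exponent. The vectors X^r and Y^r cover the cases b = 0 and a = 0. *)
Lemma lift_mono a b : (0 < a + b)%N -> (a + b = p ^ h %[mod q1])%N ->
  exists v : V, evV v = mono D a b.
Proof.
move=> ab0 e; have r0 := pval_r_gt0.
have [b0|b0] := posnP b.
  move: e ab0; rewrite b0 addn0 => e a0; exists (vmon D r (fun=> 0%N)).
  by rewrite evV_vmon0; apply: mono_mod => //; rewrite r_mod e.
have [a0|a0] := posnP a.
  move: e; rewrite a0 add0n => e; exists (vmon D r r).
  by rewrite ev_vmon // subnn; apply: mono_modr => //; rewrite r_mod e.
have q2 := q_gt2 D p_gt2 f_gt0.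
have [b' /andP[b'0 b'q] eb] := mod_lt_ind b0 (ltnW q2).
exists (vmon D r (fun i => b' * (i == Ordinal f_gt0))%N).
have hb i : (b' * (i == Ordinal f_gt0) <= r i)%N.
  case: (i == _); rewrite ?muln0 // muln1; apply: leq_trans b'q _.
  exact: leq_trans (leq_subr 1 _) (r_ge_q p_gt2 f_gt0 r_gt i).
rewrite ev_vmon // pval_delta /= expn0 muln1 (mono_modr _ _ b'0 b0 eb).
have lt : (b' < pval p r)%N.
  exact: leq_ltn_trans b'q (leq_trans q1_lt pval_r_ge_q).
apply: mono_mod => //; first by rewrite subn_gt0.
apply/eqP; rewrite -(eqn_modDr b') subnK ?(ltnW lt) //.
by rewrite r_mod -modnDmr eb modnDmr e.
Qed.

Lemma N_lift j phi : (j <= f)%N -> N D h j phi -> exists v : V, evV v = phi.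
Proof.
move=> jf hphi.
have [v _ e] : lin_image (@evV p f D r) (full_sub _) phi.
  move: hphi; apply: N_gen => b hb.
  have le := leq_pval p hb.
  have [||v e] := @lift_mono (pval p (wt p h j) - pval p b) (pval p b).
  - by rewrite subnK // (pval_wt_gt0 D).
  - by rewrite subnK // (pval_wt D).
  by exists v.
by exists v.
Qed.

(** The digits of a normal form are at most p - 1, hence bounded by [wt f]; Y^r has the same
    evaluation as the pure power of y in multidegree [wt f]. *)
Lemma N_full (v : V) : N D h f (evV v).
Proof.
have [c [b hv]] := nfP p_gt2 f_gt0 r_gt v.
have e0 := ev_theta_span hv.
have -> : evV v = evV (nform r c b).
  by apply/eqP; rewrite -subr_eq0 -linearB; apply/eqP; apply: e0.
rewrite ev_nform //; apply: smemD.
  apply: smem_sum => n _; apply: smemZ.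
  have hn i : (dgt n i <= wt p h f i)%N.
    by apply: leq_trans (wt_f_ge D h p_gt2 i); rewrite -ltnS prednK ?ltn_ord // ltnW // (p_gt1 D).
  have lt : (dgt n h < wt p h f h)%N.
    by rewrite (wt_top p (h := h) f_gt0) ?hdist_h // ltn_ord.
  have := N_mono D hn; rewrite (@mono_mod _ _ D _ (pval p r - pval p (dgt n))) //.
  - by rewrite subn_gt0; apply: (@ltn_pval _ _ _ _ h) => //; rewrite ltnW // (p_gt1 D).
  - by rewrite subn_gt0 (pval_r_gt D).
  apply/eqP; rewrite -(eqn_modDr (pval p (dgt n))) !subnK ?leq_pval //.
    by rewrite (pval_wt D) // r_mod.
  by move=> i; apply: (dgt_le D).
apply: smemZ; have := @N_mono _ _ D h f (wt p h f) (fun=> leqnn _); rewrite subnn.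
rewrite (@mono_modr _ _ D _ _ (pval p r)) ?pval_r_gt0 ?(pval_wt_gt0 D) //.
by rewrite (pval_wt D) // r_mod.
Qed.

Lemma evV_cls v v' : evV v = evV v' -> cls v = cls v'.
Proof.
move=> e; apply/qclass_eq; apply: mem_lspan; left.
apply: (@theta_span_Vstar _ _ D r); apply: (ev_eq0_theta_span p_gt2 f_gt0 r_gt).
by rewrite linearB /= e subrr.
Qed.

Definition wmx : 'M[OF]_2 := mx2 0 1 1 0.
Lemma wmx_unit : wmx \in unitmx.
Proof. by rewrite unitmxE det_mx2 mulr0 sub0r mulr1 unitrN unitr1. Qed.
Definition wgl : GL2 OF := Sub wmx wmx_unit.

Lemma fact_wmx a b : fact wmx (mono D a b) = mono D b a.
Proof.
apply/funext => -[x y]; rewrite /fact !mxE !monoE /= !mulr0 !mulr1 add0r addr0.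
exact: mulrC.
Qed.

Lemma Xr_vmon0 k : Qker (act k (vmon D r (fun=> 0%N))).
Proof.
apply: mem_lspan; right; apply: mem_lspan.
exists k, (vmon D r (fun=> 0%N)); split=> //.
rewrite val_vmon // mpolyX_mon [X in _ * X]big1 ?mulr1 => [|i _]; last exact: expr0.
by apply: eq_bigr => i _; rewrite subn0.
Qed.

(** By the congruence on r, x^(p^h) is the evaluation of X^r and y^(p^h) that of its Weyl translate,
    and both vectors lie in X_r. *)
Lemma N0_cls v : N D h 0 (evV v) -> cls v = 0.
Proof.
move=> hv; have r0 := pval_r_gt0.
have ph0 : (0 < p ^ h)%N by rewrite expn_gt0 (ltnW (p_gt1 D)).
have [v' Kv' e] : lin_image (@evV p f D r) Qker (evV v).
  move: hv; apply: N_gen => b hb.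
  have wE : pval p (wt p h 0) = (p ^ h)%N by rewrite -(pval_delta1 p h).
  have bE : b = (fun i => b h * (i == h))%N.
    apply/funext => i; have := hb i; rewrite /wt /=.
    by case: eqVneq => [->|_]; rewrite ?muln1 ?muln0 // leqn0 => /eqP.
  have bh : (b h <= 1)%N by have := hb h; rewrite /wt /= eqxx.
  have pb : pval p b = (b h * p ^ h)%N by rewrite bE pval_delta eqxx muln1.
  rewrite wE pb; case: (b h) bh => [|[|//]] _.
    exists (act 1%g (vmon D r (fun=> 0%N))); first exact: Xr_vmon0.
    rewrite act1 /= evV_vmon0 mul0n subn0; exact: mono_mod.
  exists (act wgl (vmon D r (fun=> 0%N))); first exact: Xr_vmon0.
  rewrite /= evV_act evV_vmon0 fact_wmx mul1n subnn; exact: mono_modr.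
rewrite -(evV_cls e) -(linear0 cls); apply/qclass_eq.
by rewrite subr0.
Qed.

Definition funS (S : subrep Q) : submodule (Fun2 D) :=
  lin_image (@evV p f D r) (preim_quot S).

Lemma funSP (S : subrep Q) v : funS S (evV v) <-> S (cls v).
Proof.
split=> [[v' Sv' e]|Sv]; last by exists v.
by rewrite -(evV_cls e).
Qed.

Lemma funS_act (S : subrep Q) (k : GL2 OF) phi : funS S phi -> funS S (fact (val k) phi).
Proof.
move=> [v Sv <-]; exists (act k v); last exact: evV_act.
exact: (subrep_act (s := preim_quot S)).
Qed.

(** The image of N_(j+1) in Q / Q_j is zero or simple: a nonzero subrepresentation of it contains
    the class of [mN (p ^ i0)] by the dichotomy, and lower unipotents generate the rest. *)
Lemma soc_layer j : (j <= f)%N -> forall v, N D h j (evV v) -> socfil Q j (cls v).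
Proof.
elim: j => [|j IH] jf v hv.
  rewrite (N0_cls hv); exact: (smem0 (socfil Q 0)).
have [i0 e0] : exists i0, hdist h i0 = j.+1 by apply: (hdist_ex D).
have {}IH := IH (ltnW jf).
pose Qj := socfil Q j; pose QQ := quot_rep Qj.
pose u : {linear V -> QQ} := qclass Qj \o cls.
change (soc QQ (u v)).
have uact k x : u (act k x) = act k (u x).
  by rewrite /u [LHS]/= cls_act; apply: qclass_act.
have u0 x : N D h j (evV x) -> u x = 0.
  move=> /IH hx; rewrite -(linear0 (qclass Qj)); apply/qclass_eq.
  by rewrite subr0.
have S_act k y : lin_image u (lin_preim (@evV p f D r) (N D h j.+1)) y ->
    lin_image u (lin_preim (@evV p f D r) (N D h j.+1)) (act k y).
  move=> [x hx <-]; exists (act k x); last exact: uact.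
  by change (N D h j.+1 (evV (act k x))); rewrite evV_act; apply: N_act.
pose S : subrep QQ := Subrep S_act.
have Sv : S (u v) by exists v.
have [z|nz] := eqVneq (u v) 0; first by rewrite z; apply: (smem0 (soc QQ)).
apply: mem_lspan; exists 1%g, (u v); rewrite act1; split=> //.
exists S => //; split; first by exists (u v).
move=> S' S'S.
have [S'0|S'n] := pselect (forall x, S' x -> x = 0); [by left | right].
have [y S'y yn0] : exists2 y, S' y & y != 0.
  apply: contrapT => H; apply: S'n => x S'x; apply/eqP; apply: contrapT => /negP xn.
  by apply: H; exists x.
have [x hx ux] := S'S _ S'y.
have T_act (T := lin_image (@evV p f D r) (lin_preim u S')) (k : GL2 OF) phi :
    T phi -> T (fact (val k) phi).
  move=> [w Sw <-]; exists (act k w); last exact: evV_act.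
  by change (S' (u (act k w))); rewrite uact; apply: subrep_act.
pose T := lin_image (@evV p f D r) (lin_preim u S').
have TP w : T (evV w) -> S' (u w).
  move=> [w' Sw' e]; have : cls w' = cls w by apply: evV_cls.
  move=> ew; change (S' (qclass Qj (cls w))); rewrite -ew; exact: Sw'.
have NT phi : N D h j phi -> T phi.
  move=> hphi; have [w ew] := N_lift (ltnW jf) hphi.
  exists w => //; change (S' (u w)); rewrite u0; first exact: (smem0 S').
  by rewrite ew.
have Tx : T (evV x) by exists x => //; change (S' (u x)); rewrite ux.
suff NjT phi : N D h j.+1 phi -> T phi.
  by move=> _ [w hw <-]; apply: TP; apply: NjT.
have Tm : T (mN D h (p ^ i0)).
  have [||//|[c hc]] := @layer_U_invariant _ _ D h p_gt2 T j.+1 i0 (evV x) jf e0 NT _ hx.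
  - by move=> z phi' /(T_act (ugl (teich z))).
  - move=> z; apply: smemD; first exact: (T_act (ugl (teich z))).
    exact: smemN.
  (* For c = 0 the evaluation of x would lie in N_j, so the class y of x in Q / Q_j would be
     zero. *)
  have c0 : c != 0.
    apply: contra_neq yn0 => c0; move: hc; rewrite c0 scale0r subr0 /= => /u0.
    by rewrite ux.
  apply: (submodZ_inv c0).
  have -> : c *: mN D h (p ^ i0) = evV x - (evV x - c *: mN D h (p ^ i0)).
    by rewrite opprB addrC subrK.
  by apply: smemD => //; apply: smemN; apply: NT.
move=> hphi.
apply: (@N_from_mN _ _ D h p_gt2 T j.+1 i0 jf e0 NT _ Tm phi hphi) => z phi'.
exact: (T_act (lgl (teich z))).
Qed.

Definition eps : V := vmon D r (fun i => i == h).

Lemma evV_eps : evV eps = mN D h (p ^ h).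
Proof.
have lt : (p ^ h < pval p r)%N.
  apply: ltn_trans (leq_trans q1_lt pval_r_ge_q); exact: mod_p_lt.
rewrite ev_vmon => [|i]; last by case: (i == h) => //; apply: leq_trans (r_gt i).
rewrite pval_delta1; apply: mono_mN => //.
- by rewrite subn_gt0.
- by rewrite ltnW // (mod_p_lt D).
by rewrite subnK // ltnW.
Qed.

(** The dichotomy for j = f, where i0 = h and N_f receives all of V. Its first alternative makes the
    cosocle vanish. *)
Lemma cosoc_cases (x : V) :
  (forall z, socfil Q f.-1 (cls (act (ugl (teich z)) x) - cls x)) ->
  (forall v, socfil Q f.-1 (cls v)) \/
  exists c, socfil Q f.-1 (cls x - c *: cls eps).
Proof.
move=> hx; set S := socfil Q f.-1.
have f1 : (f.-1 <= f)%N := leq_pred f.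
have NT phi : N D h f.-1 phi -> funS S phi.
  move=> hphi; have [w ew] := N_lift f1 hphi; rewrite -ew; apply/funSP.
  by apply: soc_layer => //; rewrite ew.
have ff : (0 < f <= f)%N by rewrite f_gt0 leqnn.
have [||Tm|[c hc]] := @layer_U_invariant _ _ D h p_gt2 (funS S) f h (evV x) ff (hdist_h h) NT _ (N_full x).
- by move=> z phi' /(funS_act (ugl (teich z))).
- move=> z; have := hx z; rewrite -linearB => /funSP.
  by rewrite linearB /= evV_act.
- left=> v; apply/funSP.
  apply: (@N_from_mN _ _ D h p_gt2 (funS S) f h ff (hdist_h h) NT _ Tm _ (N_full v)) => z phi'.
  exact: (funS_act (lgl (teich z))).
right; exists c; rewrite -linearZ -linearB; apply/funSP; apply: NT.
by rewrite linearB linearZ /= evV_eps.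
Qed.

(** This excludes one-dimensional weights from the cosocle. If the line of eps were Weyl-stable,
    [mN (q - 1)] - e [mN (p ^ h)] would lie in Q_(f-1); since y^(q-1) has all digits p - 1, it
    differs from y^(p^h) and [mN_key] applies. *)
Lemma cosoc_semi_invariant (x : V) (e : kb) :
  (forall z, socfil Q f.-1 (cls (act (ugl (teich z)) x) - cls x)) ->
  socfil Q f.-1 (cls (act wgl x) - e *: cls x) -> socfil Q f.-1 (cls x).
Proof.
move=> hx hw; have [//|[c hc]] := cosoc_cases hx.
set S := socfil Q f.-1 in hx hw hc *.
have f1 : (f.-1 <= f)%N := leq_pred f.
have NT phi : N D h f.-1 phi -> funS S phi.
  move=> hphi; have [w ew] := N_lift f1 hphi; rewrite -ew; apply/funSP.
  by apply: soc_layer => //; rewrite ew.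
have ff : (0 < f <= f)%N by rewrite f_gt0 leqnn.
have [c0|c0] := eqVneq c 0; first by move: hc; rewrite c0 scale0r subr0.
have p1 := p_gt1 D.
have hT1 : funS S (mN D h q1 - e *: mN D h (p ^ h)).
  apply: (submodZ_inv c0).
  have t1 : funS S (fact wmx (evV x) - e *: evV x).
    have := hw; rewrite -linearZ -linearB => /funSP.
    by rewrite linearB [X in _ - X]linearZ /= evV_act.
  have t2 : funS S (evV x - c *: mN D h (p ^ h)).
    have := hc; rewrite -linearZ -linearB => /funSP.
    by rewrite linearB linearZ /= evV_eps.
  have t3 := funS_act wgl t2.
  (* Swapping x and y gives y the exponent 2(q - 1), which may be lowered to the positive exponent q
     - 1. *)
  have wE : fact wmx (mN D h (p ^ h)) = mN D h q1.
    rewrite /mN fact_wmx; have lt : (p ^ h < q1)%N by apply: (mod_p_lt D).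
    have q10 := pf1_gt0 D p_gt2 f_gt0.
    rewrite (@mono_modr _ _ D _ _ q1) //; last first.
    - rewrite addnAC subnK ?(ltnW lt) //.
      by rewrite modnDl.
    - by rewrite addn_gt0 expn_gt0 (ltnW p1) orbT.
    apply: mono_mod; rewrite ?expn_gt0 ?(ltnW p1) ?addn_gt0 ?expn_gt0 ?(ltnW p1) ?orbT //.
    by rewrite subnn add0n modnDl.
  have -> : c *: (mN D h q1 - e *: mN D h (p ^ h)) =
     (fact wmx (evV x) - e *: evV x) + e *: (evV x - c *: mN D h (p ^ h)) -
     fact wmx (evV x - c *: mN D h (p ^ h)).
    have -> : fact wmx (evV x - c *: mN D h (p ^ h)) = fact wmx (evV x) - c *: mN D h q1.
      by rewrite -wE.
    exact: semi_invariant_comb.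
  by apply: smemD; [apply: smemD => //; apply: smemZ | apply: smemN].
have lp : (p.-1 < p)%N by rewrite prednK // ltnW.
pose n1 : {ffun 'I_f -> 'I_p} := [ffun _ : 'I_f => Ordinal lp].
have ep i : ((i == h : nat) < p)%N by case: (i == h) => //; rewrite ltnW.
pose n2 : {ffun 'I_f -> 'I_p} := [ffun i => Ordinal (ep i)].
have pn1 : pval p (dgt n1) = q1.
  rewrite subn1 predn_exp big_distrr /=; apply: eq_bigr => i _.
  by rewrite /dgt ffunE.
have pn2 : pval p (dgt n2) = (p ^ h)%N.
  by rewrite -(pval_delta1 p h); congr pval; apply/funext => i; rewrite /dgt ffunE.
have lt : (p ^ h < q1)%N by apply: (mod_p_lt D).
have n12 : n1 != n2 by apply/eqP => n12; move: lt; rewrite -pn1 n12 pn2 ltnn.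
pose cc n : kb := (n == n1)%:R - e * (n == n2)%:R.
have delta (n0 : {ffun 'I_f -> 'I_p}) (F : _ -> Fun2 D) : \sum_n (n == n0)%:R *: F n = F n0.
  by rewrite (bigD1 n0) //= eqxx scale1r big1 ?addr0 // => n /negPf ->; rewrite scale0r.
have ccE : \sum_n cc n *: mND D h n = mN D h q1 - e *: mN D h (p ^ h).
  rewrite (eq_bigr (fun n => (n == n1)%:R *: mND D h n - e *: ((n == n2)%:R *: mND D h n))).
    by rewrite sumrB -scaler_sumr !delta /mND pn1 pn2.
  by move=> n _; rewrite scalerBl scalerA.
have in1 n : n = n1 \/ n = n2 -> inlayer h f h n.
  move=> nE; split=> [i|].
    apply: leq_trans (wt_f_ge D h p_gt2 i); rewrite -ltnS prednK ?ltn_ord //.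
    exact: ltnW.
  case: nE => ->; rewrite ffunE /= ?eqxx //.
  by rewrite -ltnS prednK // ltnW.
have hcc n : cc n != 0 -> inlayer h f h n.
  rewrite /cc; have [-> _|n1'] := eqVneq n n1; first by apply: in1; left.
  have [-> _|n2'] := eqVneq n n2; first by apply: in1; right.
  by rewrite mulr0 subrr eqxx.
have Tm : funS S (mN D h (p ^ h)).
  apply: (@mN_key _ _ D h p_gt2 (funS S) f h cc n1 ff (hdist_h h) NT hcc).
  - move=> z; rewrite ccE; apply: smemD; first exact: (funS_act (ugl (teich z))).
    exact: smemN.
  - by rewrite /cc eqxx (negPf n12) mulr0 subr0 oner_neq0.
  - by rewrite pn1 => e1; move: lt; rewrite -e1 ltnn.
apply/funSP.
apply: (@N_from_mN _ _ D h p_gt2 (funS S) f h ff (hdist_h h) NT _ Tm _ (N_full x)) => z phi'.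
exact: (funS_act (lgl (teich z))).
Qed.

End Socle.

(** * Congruences between polynomials and a second-order expansion *)

Section Congruences.
Variables (f : nat) (R : comNzRingType).
Local Notation P := {mpoly R[f + f]}.

Definition mcong (c : R) (u v : P) : Prop := exists w, u - v = c *: w.

Lemma mcong_refl c u : mcong c u u.
Proof. by exists 0; rewrite scaler0 subrr. Qed.

Lemma mcong_trans c v u w : mcong c u v -> mcong c v w -> mcong c u w.
Proof.
by move=> [x ex] [y ey]; exists (x + y); rewrite scalerDr -ex -ey addrA subrK.
Qed.

Lemma mcongM c u u' v v' : mcong c u u' -> mcong c v v' -> mcong c (u * v) (u' * v').
Proof.
move=> [x ex] [y ey]; exists (x * v + u' * y).
rewrite scalerDr scalerAl -ex scalerAr -ey; ring.
Qed.

Lemma mcongX c u u' n : mcong c u u' -> mcong c (u ^+ n) (u' ^+ n).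
Proof.
move=> h; elim: n => [|n IH]; first by rewrite !expr0; apply: mcong_refl.
by rewrite !exprS; apply: mcongM.
Qed.

Lemma mcong_prod c (I : Type) (s : seq I) (u u' : I -> P) :
  (forall i, mcong c (u i) (u' i)) ->
  mcong c (\prod_(i <- s) u i) (\prod_(i <- s) u' i).
Proof.
move=> h; elim: s => [|i s IH]; first by rewrite !big_nil; apply: mcong_refl.
by rewrite !big_cons; apply: mcongM.
Qed.

Lemma mcong_polyV c (r : 'I_f -> nat) (u v : polyV R r) :
  mcong c (val u) (val v) -> exists w : polyV R r, u - v = c *: w.
Proof.
move=> [w ew]; have /multihomP hd := valP (u - v).
pose S := msupp (val (u - v)).
(* The cofactor [w] may fail to be homogeneous; keeping only its monomials in the support of u - v
   repairs this. *)
have wP : \sum_(m <- S) w@_m *: 'X_[m] \in multihom r.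
  rewrite big_seq; apply: rpred_sum => m hm; apply: rpredZ.
  by apply: mpolyX_multihom => i; apply: hd.
exists (Sub (\sum_(m <- S) w@_m *: 'X_[m]) wP); apply/val_inj.
rewrite [LHS]mpolyE /= scaler_sumr; apply: eq_bigr => m _.
by rewrite ew mcoeffZ scalerA.
Qed.

Definition vmonR (r b : 'I_f -> nat) : polyV R r :=
  insubd (0 : polyV R r) 'X_[mon (fun i => (r i - b i)%N) b].

Lemma val_vmonR r b : (forall i, b i <= r i)%N ->
  val (vmonR r b) = 'X_[mon (fun i => (r i - b i)%N) b].
Proof.
move=> hb; rewrite /vmonR val_insubd mpolyX_multihom // => i.
by rewrite monX monY subnK.
Qed.

Lemma lsubst_mon A a b : lsubst A 'X_[mon a b] =
  (\prod_(i < f) (A i 0 0 *: varX R i + A i 1 0 *: varY R i) ^+ a i) *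
  (\prod_(i < f) (A i 0 1 *: varX R i + A i 1 1 *: varY R i) ^+ b i).
Proof.
rewrite /lsubst comp_mpolyX big_split_ord /=; congr (_ * _); apply: eq_bigr => i _.
  by rewrite lin_formsX monX.
by rewrite lin_formsY monY.
Qed.

End Congruences.

(** Used with c = p: the linear term is the origin of p r_h, and p^2 is absorbed later because
    v(a_p) < 1. *)
Lemma taylor2 (R : comNzRingType) (c : R) f (A B : 'I_f -> R) (r : 'I_f -> nat) :
  exists w, \prod_i (A i + c * B i) ^+ r i =
    \prod_i A i ^+ r i +
    c * (\sum_i (r i)%:R * B i * \prod_j A j ^+ (r j - (j == i))) + c ^+ 2 * w.
Proof.
have one (a b : R) n : exists w, (a + c * b) ^+ n =
    a ^+ n + c * (n%:R * b * a ^+ (n - 1)) + c ^+ 2 * w.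
  elim: n => [|n [w IH]]; first by exists 0; rewrite !expr0; ring.
  case: n IH => [|n] IH; first by exists 0; rewrite subnn !expr0 !expr1; ring.
  exists (n.+1%:R * b ^+ 2 * a ^+ n + w * (a + c * b)).
  rewrite exprSr IH !subn1 /= !exprS; ring.
elim: f A B r => [|f IH] A B r.
  by exists 0; rewrite !big_ord0; ring.
have [w1 e1] := one (A ord0) (B ord0) (r ord0).
have [w2 e2] := IH (fun i => A (fintype.lift ord0 i)) (fun i => B (fintype.lift ord0 i))
  (fun i => r (fintype.lift ord0 i)).
pose P0 := \prod_(i < f) A (fintype.lift ord0 i) ^+ r (fintype.lift ord0 i).
pose S0 := \sum_(i < f) (r (fintype.lift ord0 i))%:R * B (fintype.lift ord0 i) *
  \prod_(j < f) A (fintype.lift ord0 j) ^+ (r (fintype.lift ord0 j) - (j == i)).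
rewrite -/P0 -/S0 in e2.
rewrite !big_ord_recl e1 e2 -/P0.
have -> : \sum_(i < f) (r (fintype.lift ord0 i))%:R * B (fintype.lift ord0 i) *
    \prod_(j < f.+1) A j ^+ (r j - (j == fintype.lift ord0 i)) = A ord0 ^+ r ord0 * S0.
  rewrite /S0 mulr_sumr; apply: eq_bigr => i _; rewrite big_ord_recl.
  rewrite (negPf (neq_lift ord0 i)) subn0 mulrCA; congr (_ * (_ * _)); apply: eq_bigr => j _.
have -> : \prod_(j < f) A (fintype.lift ord0 j) ^+ (r (fintype.lift ord0 j) -
    (fintype.lift ord0 j == ord0)) = P0.
  by apply: eq_bigr => j _; rewrite eq_sym (negPf (neq_lift ord0 j)) subn0.
rewrite eqxx.
move: (A ord0 ^+ (r ord0 - true)) (A ord0 ^+ r ord0) ((r ord0)%:R * B ord0) => a' a b.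
exists (b * a' * S0 + a * w2 + w1 * (P0 + c * S0 + c ^+ 2 * w2) + c * b * a' * w2).
ring.
Qed.

(** * Relations and divisibility in Theta, and its reduction *)

Section Lattice.
Variables (p f : nat) (D : padic_setting p f) (r : 'I_f -> nat) (ap : E D).
Local Notation OF := (intring (vF D)).
Local Notation OE := (intring (vE D)).
Local Notation G := (GL2 (F D)).
Local Notation jO := (structOE D).
Local Notation VO := (Vrep jO r).
Local Notation L := (ind VO).

Lemma coefE_Z a (v : VO) : Defs.coefE D r (a *: v) = val a *: Defs.coefE D r v.
Proof.
apply/val_inj.
change (map_mpoly (\val : OE -> E D) (a *: val (v : polyV OE r)) =
  val a *: map_mpoly (\val : OE -> E D) (val (v : polyV OE r))).
exact: (map_mpolyZ (\val : OE -> E D)).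
Qed.

Lemma coefE_ind_Z a (x : L) :
  ind_map (Defs.coefE D r) (a *: x) = val a *: ind_map (Defs.coefE D r) x.
Proof. by apply: ind_map_semilinear => v; apply: coefE_Z. Qed.

(** The integral elements that die in Pi, that is, the relations of Theta. They are saturated, which
    permits division by a_p and by a_p^2 - p r_h. *)
Definition null_mem (z : L) : Prop := hecke_shift r ap (ind_map (Defs.coefE D r) z).

Lemma null_mem0 : null_mem 0.
Proof. by rewrite /null_mem ind_map0; apply: (smem0 (hecke_shift r ap)). Qed.

Lemma null_memP a x y : null_mem x -> null_mem y -> null_mem (a *: x + y).
Proof.
by move=> hx hy; rewrite /null_mem ind_mapD coefE_ind_Z; apply: smemP.
Qed.

Definition null : submodule L := Submodule null_mem0 null_memP.

Lemma null_sat c z : val c != 0 -> null (c *: z) -> null z.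
Proof.
move=> c0; rewrite /= /null_mem coefE_ind_Z => /(smemZ (val c)^-1).
by rewrite scalerA mulVf // scale1r.
Qed.

Lemma psubst_lin (R : comNzRingType) A : linear (@psubst f R A r).
Proof. by move=> a u v; apply/val_inj; rewrite /= /lsubst linearP. Qed.

Lemma hecke_elt_lin g : linear (@hecke_elt p f D OE jO r 0 g).
Proof.
move=> a u v; rewrite /hecke_elt scalerDr addrACA; congr (_ + _); last first.
  by rewrite psubst_lin; apply: eltP.
rewrite scaler_sumr -big_split; apply: eq_bigr => c _.
by rewrite psubst_lin; apply: eltP.
Qed.

Lemma coefE_psubst A B (v : VO) : (forall i, map_mx val (A i) = B i) ->
  Defs.coefE D r (psubst A v) = psubst B (Defs.coefE D r v).
Proof.
move=> hAB; apply/val_inj.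
change (map_mpoly (\val : OE -> E D) (lsubst A (val (v : polyV OE r))) =
  lsubst B (map_mpoly (\val : OE -> E D) (val (v : polyV OE r)))).
by rewrite map_lsubst; congr lsubst; apply/funext.
Qed.

Lemma null_hecke g (v : VO) (a : OE) : val a = ap ->
  null (hecke_elt g v - a *: elt g v).
Proof.
move=> ea; apply: mem_lspan.
exists (elt g (Defs.coefE D r v), hecke_elt g (Defs.coefE D r v)) => /=.
  by exists [:: (g, Defs.coefE D r v)]; rewrite !big_seq1.
rewrite ind_mapD -scaleNr coefE_ind_Z ind_map_elt; congr (_ + _); last first.
  have -> : val (- a) = - ap by rewrite -ea.
  by rewrite scaleNr.
have mxE2 (a1 b c d : OE) : map_mx val (mx2 a1 b c d) = mx2 (val a1) (val b) (val c) (val d).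
  apply/matrixP => i k; rewrite !mxE.
  by case: (i == 0); case: (k == 0).
rewrite /hecke_elt ind_mapD ind_map_sum; congr (_ + _).
  apply: eq_bigr => c _; rewrite ind_map_elt.
  rewrite (coefE_psubst (B := fun i => mx2 1 ((- structE D (teich c)) ^+ (p ^ i)) 0 p%:R)) //.
  move=> i; rewrite mxE2 val_natOE; congr mx2.
  by rewrite (rmorphXn (\val : OE -> E D)) raddfN.
rewrite ind_map_elt (coefE_psubst (B := fun=> mx2 p%:R 0 0 1)) // => i.
by rewrite mxE2 val_natOE.
Qed.

Lemma tensor1D (x y : Theta r ap) :
  tensor1 (redE D) (x + y) = tensor1 (redE D) x + tensor1 (redE D) y.
Proof.
rewrite /tensor1 -linearD; apply/qclass_eq; apply: mem_lspan; left.
by exists x, y; rewrite opprD addrA.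
Qed.

Lemma tensor1Z a (x : Theta r ap) :
  tensor1 (redE D) (a *: x) = redE D a *: tensor1 (redE D) x.
Proof.
by rewrite /tensor1 -linearZ; apply/qclass_eq; apply: mem_lspan; right; exists a, x.
Qed.

Definition tt (x : L) : Thetabar r ap := tensor1 (redE D) (to_theta ap x).

Lemma to_theta_lin : linear (@to_theta p f D r ap).
Proof.
move=> a x y; apply/val_inj; rewrite /= -[theta_map _ _]/(theta_map ap (a *: x + y)).
exact: theta_map_linear.
Qed.

Lemma ttD x y : tt (x + y) = tt x + tt y.
Proof. by rewrite /tt -tensor1D -[in LHS](scale1r x) to_theta_lin scale1r. Qed.

Lemma ttZ a x : tt (a *: x) = redE D a *: tt x.
Proof.
have z0 : to_theta ap 0 = 0 :> Theta r ap.
  by have := to_theta_lin (-1) 0 0; rewrite scaler0 addr0 scaleN1r addNr.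
by rewrite /tt -tensor1Z -[a *: x]addr0 to_theta_lin z0 addr0.
Qed.

Lemma tt_sum I (s : seq I) (x : I -> L) : tt (\sum_(i <- s) x i) = \sum_(i <- s) tt (x i).
Proof.
apply: (big_morph _ ttD).
by rewrite -[X in tt X](scale0r 0) ttZ rmorph0 scale0r.
Qed.

Lemma tt_null z c z' : null (z - c *: z') -> redE D c = 0 -> tt z = 0.
Proof.
move=> hz c0; have -> : tt z = tt (c *: z'); last by rewrite ttZ c0 scale0r.
rewrite /tt; congr tensor1; apply/val_inj; apply/qclass_eq.
have := hz; rewrite /= /null_mem ind_mapD -scaleNr !coefE_ind_Z.
by rewrite raddfN scaleNr.
Qed.

(** Divisibility of the class of x by c in Theta. *)
Definition smallm c (x : L) : Prop := exists z, null (x - c *: z).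

Lemma smallm0 c : smallm c 0.
Proof. by exists 0; rewrite scaler0 subr0; apply: (smem0 null). Qed.

Lemma smallmP c a x y : smallm c x -> smallm c y -> smallm c (a *: x + y).
Proof.
move=> [z hz] [z' hz']; exists (a *: z + z').
have -> : a *: x + y - c *: (a *: z + z') = a *: (x - c *: z) + (y - c *: z').
  by rewrite !scalerDr scalerN !scalerA [c * a]mulrC opprD addrACA.
exact: smemP.
Qed.

Definition small c : submodule L := Submodule (@smallm0 c) (@smallmP c).

Lemma small_null c x : null x -> small c x.
Proof. by move=> hx; exists 0; rewrite scaler0 subr0. Qed.

Lemma small_scale c x : small c (c *: x).
Proof. by exists x; rewrite subrr; apply: (smem0 null). Qed.

Lemma small_weak a c x : small (a * c) x -> small c x.
Proof. by move=> [z hz]; exists (a *: z); rewrite scalerA mulrC. Qed.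

Lemma smallZ a c x : small c x -> small (a * c) (a *: x).
Proof.
move=> [z hz]; exists z; rewrite -scalerA -scalerBr; exact: (smemZ (N := null)).
Qed.

Lemma small_cong c g (u v : VO) : mcong c (val (u : polyV OE r)) (val (v : polyV OE r)) ->
  small c (elt g u - elt g v).
Proof.
move=> /mcong_polyV[w ew]; rewrite -linearB.
have -> : u - v = c *: (w : VO) by [].
by rewrite linearZ; apply: small_scale.
Qed.

End Lattice.

Lemma vsub_lt (K : fieldType) (v : valuation K) (x y : K) : x != 0 -> y != 0 ->
  v x < v y -> x - y != 0 /\ v (x - y) = v x.
Proof.
move=> x0 y0 lt.
have vN z : z != 0 -> v (- z) = v z.
  by move=> z0; rewrite -mulN1r vfunM ?oppr_eq0 ?oner_neq0 // vN1 add0r.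
have n0 : x - y != 0.
  by apply/eqP => /eqP; rewrite subr_eq0 => /eqP e; rewrite e ltxx in lt.
have ny0 : - y != 0 by rewrite oppr_eq0.
split=> //; apply/eqP; rewrite eq_le; apply/andP; split.
  rewrite leNgt; apply/negP => lt'.
  have xE : (x - y) + y = x by rewrite subrK.
  have := vfunD v n0 y0; rewrite xE => /(_ x0).
  by rewrite ge_min => /orP[h|h]; [have := lt_le_trans lt' h | have := lt_le_trans lt h];
     rewrite ltxx.
apply: le_trans (vfunD v x0 ny0 n0); rewrite vN //.
by rewrite le_min lexx ltW.
Qed.

Lemma smem_eq (R : nzRingType) (U : lmodType R) (T : submodule U) x y :
  T x -> x = y -> T y.
Proof. by move=> ? <-. Qed.

Lemma natr_scale (n : nat) (R : comNzRingType) (k : nat) (x : {mpoly R[n]}) :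
  k%:R * x = (k%:R : R) *: x.
Proof. by rewrite scaler_nat mulr_natl. Qed.

Lemma zmod_cancel1 (U : zmodType) (A B C S y x1 x2 x3 : U) :
  (B + C - y - x3 + (y - x2)) - (A + S - x1 - (A - B)) = (C - S) - (x3 + x2 - x1).
Proof.
rewrite (addrAC (B + C)) [X in X - _]addrA subrK.
rewrite -(addrA A S) (addrC A) addrKA opprK [S - x1 + B]addrC.
have -> : B + C - x3 - x2 = (C - x3 - x2) + B by rewrite -!addrA [LHS]addrC -!addrA.
by rewrite addrKA !opprD !opprK -(addrA C) addrACA.
Qed.

Lemma zmod_cancel2 (U : zmodType) (x u k w : U) :
  x - (u - k + w) + (u + w) = x + k.
Proof.
by rewrite -addrA [u - k + w]addrAC opprD opprK [X in x + X = _]addrAC addNr add0r.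
Qed.

(** * The Hecke operator modulo p and p^2 *)

Section Analytic.
Variables (p f : nat) (D : padic_setting p f) (r : 'I_f -> nat) (ap : E D) (h : 'I_f).
Local Notation OF := (intring (vF D)).
Local Notation OE := (intring (vE D)).
Local Notation G := (GL2 (F D)).
Local Notation jO := (structOE D).
Local Notation VO := (Vrep jO r).
Local Notation L := (ind VO).
Local Notation q1 := (p ^ f - 1)%N.
Hypothesis p_gt2 : (2 < p)%N.
Hypothesis r_gt : forall i, (p ^ f + p - 2 < r i)%N.
Hypothesis r_mod : pval p r = p ^ h %[mod q1].
Hypothesis ap0 : ap != 0.
Hypothesis ap_gt0 : 0 < vE D ap.
Hypothesis ap_lt1 : vE D ap < 1.
Let f_gt0 : (0 < f)%N := f_gt0_of h.
Local Notation small := (small r ap).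

Lemma vE_nat n : (0 < n)%N -> n%:R != 0 :> E D /\ vE D n%:R = (logn p n)%:R.
Proof.
move=> n0; have [nn vn] := vF_nat D n0.
have e : n%:R = (n%:R : F D)%:A :> E D by rewrite scaler_nat.
by rewrite e vE_F // vn scaler_eq0 negb_or nn oner_neq0.
Qed.

Lemma pE_neq0 : p%:R != 0 :> E D.
Proof. by have [] := vE_nat (prime_gt0 (p_prime D)). Qed.

Lemma vE_p : vE D p%:R = 1.
Proof.
by have [_ ->] := vE_nat (prime_gt0 (p_prime D)); rewrite logn_prime ?eqxx ?(p_prime D).
Qed.

Lemma OE_max (x : E D) : x != 0 -> 0 < vE D x ->
  exists2 y : OE, val y = x & redE D y = 0.
Proof.
move=> x0 vx; have hx : x \in intring_pred (vE D).
  by rewrite unfold_in /vge (ltW vx) orbT.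
exists (Sub x hx) => //; apply/redE_ker.
by rewrite /vgt /= vx orbT.
Qed.

Lemma r_gt0 i : (0 < r i)%N.
Proof. by apply: leq_ltn_trans (r_gt i). Qed.

Definition At (c : kF D) (i : 'I_f) : 'M[OE]_2 :=
  mx2 1 ((- jO (teich c)) ^+ (p ^ i)) 0 p%:R.
Definition Aal (i : 'I_f) : 'M[OE]_2 := mx2 p%:R 0 0 1.

Definition mO (b : 'I_f -> nat) : VO := vmonR OE r b.
Definition Xv : VO := mO (fun=> 0%N).
Definition Yv : VO := mO r.
Definition ep (i : 'I_f) : VO := mO (fun j => j == i).
Definition vO (v : VO) : {mpoly OE[f + f]} := val (v : polyV OE r).

Lemma vO_mO b : (forall i, b i <= r i)%N -> vO (mO b) =
  (\prod_(i < f) varX OE i ^+ (r i - b i)) * (\prod_(i < f) varY OE i ^+ b i).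
Proof. by move=> hb; rewrite /vO /mO val_vmonR // mpolyX_mon. Qed.

Lemma vO_Xv : vO Xv = \prod_(i < f) varX OE i ^+ r i.
Proof.
rewrite vO_mO // [X in _ * X]big1 ?mulr1 => [|i _]; last exact: expr0.
by apply: eq_bigr => i _; rewrite subn0.
Qed.

Lemma vO_Yv : vO Yv = \prod_(i < f) varY OE i ^+ r i.
Proof.
rewrite vO_mO // [X in X * _]big1 ?mul1r // => i _.
by rewrite subnn expr0.
Qed.

Lemma delta_le (i j : 'I_f) : ((j == i) <= r j)%N.
Proof. by case: (j == i) => //; apply: r_gt0. Qed.

Lemma prod_delta (R : comNzRingType) (F : 'I_f -> R) i :
  \prod_(j < f) F j ^+ (j == i) = F i.
Proof.
by rewrite (bigD1 i) //= eqxx expr1 big1 ?mulr1 // => j /negPf ->; rewrite expr0.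
Qed.

Lemma vO_ep i : vO (ep i) =
  (\prod_(j < f) varX OE j ^+ (r j - (j == i))) * varY OE i.
Proof. by rewrite vO_mO ?prod_delta // => j; apply: delta_le. Qed.

(** Modulo p the lambda-substitution turns Y_i into a multiple of X_i, so the monomial is remembered
    only through [pval p b]. *)
Lemma At_mod c b : (forall i, b i <= r i)%N ->
  mcong p%:R (vO (psubst (At c) (mO b : polyV OE r)))
    (vO ((- jO (teich c)) ^+ pval p b *: Xv)).
Proof.
move=> hb; rewrite /vO /= val_vmonR // lsubst_mon.
set t := - jO (teich c).
apply: (@mcong_trans _ _ _ ((\prod_(i < f) varX OE i ^+ (r i - b i)) *
    (\prod_(i < f) (t ^+ (p ^ i) *: varX OE i) ^+ b i))).
  apply: mcongM.
    have -> : \prod_(i < f) (At c i 0 0 *: varX OE i + At c i 1 0 *: varY OE i) ^+ (r i - b i) =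
        \prod_(i < f) varX OE i ^+ (r i - b i).
      by apply: eq_bigr => i _; rewrite !mxE /= scale1r scale0r addr0.
    exact: mcong_refl.
  apply: mcong_prod => i; apply: mcongX; rewrite !mxE /=.
  by exists (varY OE i); rewrite addrC addKr.
have -> : \prod_(i < f) (t ^+ (p ^ i) *: varX OE i) ^+ b i =
    t ^+ pval p b *: \prod_(i < f) varX OE i ^+ b i.
  by under eq_bigr do rewrite exprZn; rewrite scaler_prod expr_pval.
rewrite -scalerAr -big_split /=.
have -> : \prod_(i < f) (varX OE i ^+ (r i - b i) * varX OE i ^+ b i) = vO Xv.
  rewrite vO_Xv; apply: eq_bigr => i _.
  by rewrite -exprD subnK.
exact: mcong_refl.
Qed.

(** One factor X_i, replaced by p X_i, makes the result divisible by p; only Y^r escapes. *)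
Lemma Aal_mod b i : (forall i, b i <= r i)%N -> (b i < r i)%N ->
  mcong p%:R (vO (psubst Aal (mO b : polyV OE r))) (vO 0).
Proof.
move=> hb hi; rewrite /vO /= val_vmonR // lsubst_mon /mcong subr0 (bigD1 i) //=.
rewrite !mxE /= scale0r addr0 -(subnSK hi) exprS -!scalerAl.
by eexists.
Qed.

Lemma Aal_Yv : psubst Aal (Yv : polyV OE r) = Yv.
Proof.
apply/val_inj; change (lsubst Aal (vO Yv) = vO Yv).
rewrite vO_Yv /lsubst rmorph_prod; apply: eq_bigr => i _.
rewrite rmorphXn /= -/(lsubst _ _) lsubstY !mxE /= scale0r add0r scale1r.
by [].
Qed.

Lemma hecke_mod g b : (forall i, b i <= r i)%N ->
  small p%:R (hecke_elt g (mO b) -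
    (\sum_c elt (g * gl_teich c)%g ((- jO (teich c)) ^+ pval p b *: Xv) +
     elt (g * gl_alpha D)%g (psubst Aal (mO b : polyV OE r) : VO))).
Proof.
move=> hb; rewrite /hecke_elt opprD addrACA subrr addr0 -sumrB.
apply: smem_sum => c _; apply: small_cong; exact: At_mod.
Qed.

Lemma teich_pow c a b : (0 < a)%N -> (0 < b)%N -> a = b %[mod q1] ->
  (- jO (teich c)) ^+ a = (- jO (teich c)) ^+ b.
Proof.
move=> a0 b0 e; apply: (@expr_eq_mod _ (p ^ f)) => //.
  by rewrite -rmorphN -rmorphXn teichNX.
by rewrite expn_gt0 (ltnW (p_gt1 D)).
Qed.

(** As -[c] is its own q-th power, monomials whose [pval] are positive and congruent have the same
    lambda-part modulo p. Only the alpha-terms remain. *)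
Lemma hecke_diff g b b' : (forall i, b i <= r i)%N -> (forall i, b' i <= r i)%N ->
  (0 < pval p b)%N -> (0 < pval p b')%N -> pval p b = pval p b' %[mod q1] ->
  small p%:R (hecke_elt g (mO b - mO b') -
     (elt (g * gl_alpha D)%g (psubst Aal (mO b : polyV OE r) : VO) -
      elt (g * gl_alpha D)%g (psubst Aal (mO b' : polyV OE r) : VO))).
Proof.
move=> hb hb' b0 b'0 e.
apply: smem_eq (smemD (hecke_mod g hb) (smemN (hecke_mod g hb'))) _.
have -> : hecke_elt g (mO b - mO b') = hecke_elt g (mO b) - hecke_elt g (mO b') :> L.
  by rewrite -[mO b - mO b']addrC -scaleN1r hecke_elt_lin scaleN1r addrC.
have -> : \sum_c elt (g * gl_teich c)%g ((- jO (teich c)) ^+ pval p b *: Xv) =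
   \sum_c elt (g * gl_teich c)%g ((- jO (teich c)) ^+ pval p b' *: Xv) :> L.
  by apply: eq_bigr => c _; rewrite (teich_pow c b0 b'0 e).
set S := \sum_c _.
rewrite !opprD !opprK addrACA; congr (_ + _).
by rewrite addrACA addNr add0r.
Qed.

Lemma ap_div c x (a : OE) : val a = ap -> small (a * c) (a *: x) -> small c x.
Proof.
move=> ea [z hz]; exists z; apply: (@null_sat _ _ D r ap a); first by rewrite ea.
by rewrite scalerBr scalerA.
Qed.

Lemma small_hecke c g v (a : OE) : val a = ap ->
  small c (hecke_elt g v) -> small c (a *: elt g v).
Proof.
move=> ea hs.
have -> : a *: elt g v = hecke_elt g v - (hecke_elt g v - a *: elt g v).
  by rewrite opprB addrC subrK.
apply: smemD => //; apply: smemN; apply: small_null; exact: null_hecke.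
Qed.

Lemma apE : exists2 a : OE, val a = ap & redE D a = 0.
Proof. exact: OE_max. Qed.

Lemma pE (a : OE) : val a = ap -> exists2 d : OE, p%:R = a * d & redE D d = 0.
Proof.
move=> ea; have [] := @OE_max (p%:R / ap).
- by rewrite mulf_neq0 ?invr_eq0 // pE_neq0.
- by rewrite vfunM ?invr_eq0 ?pE_neq0 // vV // vE_p subr_gt0.
move=> d ed rd; exists d => //; apply/val_inj.
by rewrite val_natOE /= ea ed mulrC divfK.
Qed.

(** T of the difference is divisible by p, hence so is a_p times the difference; and p / a_p is
    still in the maximal ideal because v(a_p) < 1. *)
Lemma kill_diff g b b' i i' : (forall i, b i <= r i)%N -> (forall i, b' i <= r i)%N ->
  (0 < pval p b)%N -> (0 < pval p b')%N -> pval p b = pval p b' %[mod q1] ->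
  (b i < r i)%N -> (b' i' < r i')%N -> tt ap (elt g (mO b - mO b')) = 0.
Proof.
move=> hb hb' b0 b'0 e bi b'i.
have [a ea _] := apE; have [d ed rd] := pE ea.
have [z hz] : small d (elt g (mO b - mO b')).
  apply: (ap_div ea); rewrite -ed; apply: (small_hecke ea).
  have k1 := small_cong ap (g * gl_alpha D)%g (Aal_mod hb bi).
  have k2 := small_cong ap (g * gl_alpha D)%g (Aal_mod hb' b'i).
  apply: smem_eq (smemD (hecke_diff g hb hb' b0 b'0 e) (smemD k1 (smemN k2))) _.
  have e0 g' : elt g' (0 : VO) = 0 :> L := linear0 _.
  by rewrite !e0 !subr0 subrK.
exact: tt_null hz rd.
Qed.

Lemma pval_r_pos : (0 < pval p r)%N.
Proof.
apply: leq_trans (leq_pval1 p r h).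
by rewrite muln_gt0 r_gt0 expn_gt0 (ltnW (p_gt1 D)).
Qed.

(** The congruence on r says that Y^r and eps have congruent [pval], while modulo p only the
    alpha-term of Y^r survives. *)
Lemma Yv_rec g (a : OE) : val a = ap ->
  small p%:R (elt (g * gl_alpha D)%g Yv - a *: elt g (Yv - ep h)).
Proof.
move=> ea.
have hr i : (r i <= r i)%N by [].
have h1 : (1 < r h)%N by have := r_gt h; have := q_gt2 D p_gt2 f_gt0; lia.
have k0 : (0 < pval p (fun j => (j == h : nat)))%N.
  by rewrite pval_delta1 expn_gt0 (ltnW (p_gt1 D)).
have k1 : pval p r = pval p (fun j => (j == h : nat)) %[mod q1].
  by rewrite pval_delta1.
have k2 : ((h == h : nat) < r h)%N by rewrite eqxx.
have H1 := hecke_diff g hr (fun j => delta_le h j) pval_r_pos k0 k1.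
have H2 := small_cong ap (g * gl_alpha D)%g (Aal_mod (fun j => delta_le h j) k2).
have H3 := small_null p%:R (null_hecke (r := r) g (Yv - ep h) ea).
apply: smem_eq (smemD (smemD H3 (smemN H1)) H2) _.
rewrite Aal_Yv linear0 subr0 -/(ep h) -/Yv.
move: (hecke_elt g (Yv - ep h)) (a *: elt g (Yv - ep h)) (elt _ Yv)
  (elt _ (psubst Aal (ep h : polyV OE r) : VO)) => x y z t.
by rewrite opprB -addrA [X in _ + X]addrAC subrK addrC addrA subrK.
Qed.

Lemma gl_alphaVK (g : G) : ((g * (gl_alpha D)^-1) * gl_alpha D)%g = g.
Proof. by rewrite mulgVK. Qed.

(** Every g has the form g' alpha, so the recursion applies to it; its error p is itself divisible
    by a_p. *)
Lemma small_Yv g (a : OE) : val a = ap -> small a (elt g Yv).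
Proof.
move=> ea; have [d ed _] := pE ea.
have := Yv_rec (g * (gl_alpha D)^-1)%g ea; rewrite gl_alphaVK ed mulrC => /small_weak H.
rewrite -[elt g Yv](subrK (a *: elt (g * (gl_alpha D)^-1)%g (Yv - ep h))).
by apply: smemD => //; apply: small_scale.
Qed.

Lemma small_actYv g k (a : OE) : val a = ap -> small a (elt g (act k Yv)).
Proof. by move=> ea; rewrite -(elt_KZ g 0 k); apply: small_Yv. Qed.

Lemma act_wgl_Yv : act (wgl D) Yv = Xv.
Proof.
apply/val_inj; rewrite /= expr0 scale1r val_vmonR // lsubst_mon -[RHS]/(vO Xv) vO_Xv.
rewrite [X in X * _]big1 ?mul1r => [|i _]; last by rewrite subnn expr0.
apply: eq_bigr => i _; rewrite !mxE /=.
by rewrite (rmorph1 (frobn i)) (rmorph0 (frobn i)) rmorph1 rmorph0 scale1r scale0r addr0.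
Qed.

Lemma small_Xv g (a : OE) : val a = ap -> small a (elt g Xv).
Proof. by move=> ea; rewrite -act_wgl_Yv; apply: small_actYv. Qed.


(** Coefficient of X_i when the lambda = c substitution is applied to the image of Y_i under u_[m].
    Only its residue (m - c)^(p^i) will matter. *)
Definition dd (c m : kF D) (i : 'I_f) : OF := frobn i (teich m) - teich c ^+ (p ^ i).
Definition uY (m : kF D) : VO := act (ugl (teich m)) Yv.

Lemma vO_lin a u v : vO (a *: u + v) = a *: vO u + vO v.
Proof. by []. Qed.

Lemma vO_sum I (s : seq I) (u : I -> VO) : vO (\sum_(i <- s) u i) = \sum_(i <- s) vO (u i).
Proof. exact: (big_morph vO). Qed.

Lemma vO_psubst_uY A m : vO (psubst A (uY m : polyV OE r)) =
  \prod_(i < f) ((A i *m conj_mx jO (umx (teich m)) i) 0 1 *: varX OE i +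
    (A i *m conj_mx jO (umx (teich m)) i) 1 1 *: varY OE i) ^+ r i.
Proof.
rewrite /vO /= expr0 scale1r lsubstM val_vmonR // lsubst_mon.
by rewrite [X in X * _]big1 ?mul1r // => i _; rewrite subnn expr0.
Qed.

Lemma conj_umx t i : conj_mx jO (umx t) i = mx2 1 (jO (frobn i t)) 0 1.
Proof.
apply/matrixP => a b; rewrite !mxE; do 2 case: (_ == 0);
by rewrite /= ?(rmorph1 (frobn i)) ?(rmorph0 (frobn i)) ?rmorph1 ?rmorph0.
Qed.

Lemma mul_mx2 (a b c d a' b' c' d' : OE) : mx2 a b c d *m mx2 a' b' c' d' =
  mx2 (a * a' + b * c') (a * b' + b * d') (c * a' + d * c') (c * b' + d * d').
Proof.
by apply/matrixP => i k; rewrite !mxE sum2 !mxE; case: (i == 0); case: (k == 0).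
Qed.

Lemma mx2_01 (R : nzRingType) (a b c d : R) : mx2 a b c d 0 1 = b.
Proof. by rewrite mxE. Qed.
Lemma mx2_11 (R : nzRingType) (a b c d : R) : mx2 a b c d 1 1 = d.
Proof. by rewrite mxE. Qed.

Lemma vO_At_uY c m : vO (psubst (At c) (uY m : polyV OE r)) =
  \prod_(i < f) (jO (dd c m i) *: varX OE i + p%:R * varY OE i) ^+ r i.
Proof.
rewrite vO_psubst_uY; apply: eq_bigr => i _; congr (_ ^+ _).
rewrite conj_umx /At mul_mx2 mx2_01 mx2_11 mul1r mul0r !mulr1 add0r natr_scale.
by rewrite (expN_odd D p_gt2) /dd rmorphB rmorphXn.
Qed.

Lemma vO_Aal_uY m : vO (psubst Aal (uY m : polyV OE r)) =
  \prod_(i < f) (varY OE i + p%:R * (jO (frobn i (teich m)) *: varX OE i)) ^+ r i.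
Proof.
rewrite vO_psubst_uY; apply: eq_bigr => i _; congr (_ ^+ _).
rewrite conj_umx /Aal mul_mx2 mx2_01 mx2_11 !mul0r !mulr1 addr0 add0r natr_scale.
by rewrite scalerA scale1r addrC.
Qed.

(** Taylor coefficients: [cA] multiplies X^r, and p times [cB] multiplies X^r Y_i / X_i. *)
Definition cA c m : OF := \prod_(j < f) dd c m j ^+ r j.
Definition cB c m i : OF := (r i)%:R * \prod_(j < f) dd c m j ^+ (r j - (j == i)).

Lemma taylor_lam c m : mcong (p%:R ^+ 2) (vO (psubst (At c) (uY m : polyV OE r)))
  (vO (jO (cA c m) *: Xv + p%:R *: \sum_(i < f) jO (cB c m i) *: ep i)).
Proof.
rewrite vO_At_uY.
have [w ->] := taylor2 (p%:R : {mpoly OE[f + f]})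
  (fun i => jO (dd c m i) *: varX OE i) (fun i => varY OE i) r.
exists w; rewrite vO_lin.
have -> : \prod_(i < f) (jO (dd c m i) *: varX OE i) ^+ r i = jO (cA c m) *: vO Xv.
  under eq_bigr do rewrite exprZn.
  by rewrite scaler_prod vO_Xv /cA rmorph_prod; under [in RHS]eq_bigr do rewrite rmorphXn.
have -> : vO (p%:R *: \sum_(i < f) jO (cB c m i) *: ep i) =
    p%:R * \sum_(i < f) (r i)%:R * varY OE i *
      \prod_(j < f) (jO (dd c m j) *: varX OE j) ^+ (r j - (j == i)).
  rewrite natr_scale -[X in vO X]addr0 vO_lin addr0; congr (_ *: _).
  rewrite vO_sum; apply: eq_bigr => i _.
  under eq_bigr do rewrite exprZn.
  rewrite scaler_prod -[jO _ *: ep i]addr0 vO_lin addr0 vO_ep /cB rmorphM rmorph_nat.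
  rewrite rmorph_prod; under eq_bigr do rewrite rmorphXn.
  by rewrite -scalerAr -mulrA natr_scale scalerA [_ * (r i)%:R]mulrC [varY OE i * _]mulrC.
by rewrite addrC addKr expr2 -mulrA !natr_scale scalerA expr2.
Qed.

Lemma taylor_al m : mcong (p%:R ^+ 2) (vO (psubst Aal (uY m : polyV OE r)))
  (vO (1 *: Yv + p%:R *: \sum_(i < f) jO ((r i)%:R * frobn i (teich m)) *:
     mO (fun j => (r j - (j == i))%N))).
Proof.
rewrite vO_Aal_uY.
have [w ->] := taylor2 (p%:R : {mpoly OE[f + f]})
  (fun i => varY OE i) (fun i => jO (frobn i (teich m)) *: varX OE i) r.
exists w; rewrite vO_lin scale1r vO_Yv.
have -> : vO (p%:R *: \sum_(i < f) jO ((r i)%:R * frobn i (teich m)) *: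
     mO (fun j => (r j - (j == i))%N)) =
    p%:R * \sum_(i < f) (r i)%:R * (jO (frobn i (teich m)) *: varX OE i) *
      \prod_(j < f) varY OE j ^+ (r j - (j == i)).
  rewrite natr_scale -[X in vO X]addr0 vO_lin addr0; congr (_ *: _).
  rewrite vO_sum; apply: eq_bigr => i _.
  rewrite -[jO _ *: mO _]addr0 vO_lin addr0 vO_mO => [|j]; last exact: leq_subr.
  have -> : \prod_(j < f) varX OE j ^+ (r j - (r j - (j == i))) = varX OE i.
    rewrite -[RHS](prod_delta (fun j => varX OE j) i); apply: eq_bigr => j _.
    by rewrite subKn // delta_le.
  by rewrite rmorphM rmorph_nat -scalerA -natr_scale -!mulrA scalerAl.
by rewrite addrC addKr expr2 -mulrA !natr_scale scalerA expr2.
Qed.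

Lemma resF_dd c m i : resF D (dd c m i) = (m - c) ^+ (p ^ i).
Proof.
rewrite /dd rmorphB resF_frobn rmorphXn !res_teich.
have pP : p \in [pchar (kF D)].
  by rewrite !inE (p_prime D) /= -(rmorph_nat (resF D)) resF_p eqxx.
rewrite exprDn_pchar; last by rewrite pnatX pnatE ?(p_prime D) // pP.
by rewrite (expN_odd D p_gt2).
Qed.

Lemma sum_shift (c : kF D) e : (0 < e)%N ->
  \sum_(m : kF D) (m - c) ^+ e = - ((q1 %| e)%N)%:R.
Proof.
by move=> e0; rewrite -(card_kF D) -sum_pow_finField // (reindex_inj (addIr c)) /=;
   apply: eq_bigr => m _; rewrite addrK.
Qed.

Lemma resF_eq x y : resF D x = resF D y -> exists z, x = y + p%:R * z.
Proof.
move=> e; have [z hz] : exists z, x - y = p%:R * z.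
  by apply: resF_dvd; rewrite rmorphB e subrr.
by exists z; rewrite -hz addrC subrK.
Qed.

(** In F_q this is the sum of (m - c)^(pval r), zero because q - 1 does not divide p^h. *)
Lemma sum_cA c : exists z, \sum_m cA c m = p%:R * z.
Proof.
apply: resF_dvd; rewrite rmorph_sum /=.
under eq_bigr => m _.
  rewrite /cA rmorph_prod; under eq_bigr do rewrite rmorphXn resF_dd.
  rewrite expr_pval; over.
rewrite sum_shift ?pval_r_pos //.
have -> : (q1 %| pval p r)%N = false; last by rewrite oppr0.
rewrite /dvdn r_mod modn_small ?(mod_p_lt D) //.
by rewrite expn_eq0; case: p (p_gt1 D).
Qed.

(** The exponent drops to r - p^i, which q - 1 divides exactly for i = h: here the summation over m
    singles out h. *)
Lemma sum_cB c i : exists z, \sum_m cB c m i = - ((r h)%:R * (i == h)%:R) + p%:R * z.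
Proof.
apply: resF_eq; rewrite rmorph_sum /= rmorphN rmorphM !rmorph_nat.
under eq_bigr => m _.
  rewrite /cB rmorphM rmorph_nat rmorph_prod.
  under eq_bigr do rewrite rmorphXn resF_dd.
  rewrite expr_pval; over.
have le j : ((j == i) <= r j)%N by apply: delta_le.
have lt : (p ^ i < pval p r)%N.
  rewrite -(pval_delta1 p i); apply: (@ltn_pval _ _ _ _ i) => //; first exact: ltnW (p_gt1 D).
  by rewrite eqxx; have := r_gt i; have := q_gt2 D p_gt2 f_gt0; lia.
rewrite -mulr_sumr pvalB // pval_delta1 sum_shift ?subn_gt0 // mulrN; congr (- _).
have -> : (q1 %| pval p r - p ^ i)%N = (i == h).
  rewrite -eqn_mod_dvd ?(ltnW lt) // r_mod !modn_small ?(mod_p_lt D) //.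
  by rewrite eqn_exp2l ?(p_gt1 D) // eq_sym.
by case: eqVneq => [->|] //; rewrite !mulr0.
Qed.

Lemma sum_cM i : exists z, \sum_(m : kF D) (r i)%:R * frobn i (teich m) = p%:R * z.
Proof.
apply: resF_dvd; rewrite rmorph_sum /=.
under eq_bigr do rewrite rmorphM rmorph_nat resF_frobn res_teich.
rewrite -mulr_sumr -(eq_bigr _ (fun m _ => congr1 (fun x => x ^+ (p ^ i)) (subr0 m))).
rewrite sum_shift ?expn_gt0 ?(ltnW (p_gt1 D)) //.
by rewrite gtnNdvd ?oppr0 ?mulr0 // ?(mod_p_lt D) // expn_gt0 (ltnW (p_gt1 D)).
Qed.

Lemma model_lam c : exists (z : OE) (W : VO),
  \sum_m (jO (cA c m) *: Xv + p%:R *: \sum_(i < f) jO (cB c m i) *: ep i) =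
  p%:R *: (z *: Xv) - (p%:R * (r h)%:R) *: ep h + p%:R ^+ 2 *: W.
Proof.
have [z ez] := sum_cA c; have [b eb] := choice (sum_cB c).
exists (jO z), (\sum_i jO (b i) *: ep i).
rewrite big_split /= -scaler_suml -rmorph_sum ez rmorphM rmorph_nat -scalerA -addrA.
congr (_ + _); rewrite -scaler_sumr exchange_big /=.
under eq_bigr => i _.
  rewrite -scaler_suml -rmorph_sum eb rmorphD rmorphN !rmorphM !rmorph_nat scalerDl -scalerA.
  over.
rewrite big_split /= scalerDr -scaler_sumr scalerA -expr2; congr (_ + _).
rewrite (bigD1 h) //= eqxx mulr1 big1 ?addr0 => [|i /negPf ->]; last first.
  by rewrite mulr0 oppr0 scale0r.
by rewrite scaleNr scalerN scalerA.
Qed.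

Lemma model_al : exists (z : OE) (W : VO),
  \sum_(m : kF D) (1 *: Yv + p%:R *: \sum_(i < f) jO ((r i)%:R * frobn i (teich m)) *:
     mO (fun j => (r j - (j == i))%N)) = p%:R *: (z *: Yv) + p%:R ^+ 2 *: W.
Proof.
have [b eb] := choice sum_cM.
(* The q copies of Y^r add up to p times p^(f-1) Y^r. *)
exists (p ^ f.-1)%:R, (\sum_(i < f) jO (b i) *: mO (fun j => (r j - (j == i))%N)).
rewrite big_split /= sumr_const card_kF scale1r; congr (_ + _).
  by rewrite scalerA -natrM -expnS prednK // scaler_nat.
rewrite -scaler_sumr exchange_big /= expr2 -scalerA; congr (_ *: _).
rewrite scaler_sumr; apply: eq_bigr => i _.
by rewrite -scaler_suml -rmorph_sum eb rmorphM rmorph_nat scalerA.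
Qed.

Definition vsum : VO := \sum_(m : kF D) uY m.
Definition Sg (g : G) : L := \sum_(c : kF D) elt (g * gl_teich c)%g (ep h).

Lemma small_pp (a : OE) x : val a = ap -> small (a * p%:R) (p%:R ^+ 2 *: x).
Proof.
move=> ea; have [d ed _] := pE ea.
have -> : p%:R ^+ 2 *: x = (a * p%:R) *: (d *: x).
  by rewrite scalerA mulrAC -ed expr2.
exact: small_scale.
Qed.

Lemma small_ap_pp (a : OE) x : val a = ap -> small (p%:R ^+ 2) x -> small (a * p%:R) x.
Proof.
by move=> ea; have [d ed _] := pE ea; rewrite expr2 {1}ed mulrAC mulrC => /small_weak.
Qed.

(** All terms but the one with p r_h are absorbed: X^r and Y^r are divisible by a_p in Theta, so p
    X^r and p Y^r are divisible by a_p p, as is p^2 because v(a_p) < 1. *)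
Lemma hecke_vsum g (a : OE) : val a = ap ->
  small (a * p%:R) (hecke_elt g vsum + (p%:R * (r h)%:R) *: Sg g).
Proof.
move=> ea.
have psum A : psubst A (vsum : polyV OE r) = \sum_(m : kF D) psubst A (uY m : polyV OE r).
  rewrite /vsum; apply: (big_morph (fun v : polyV OE r => psubst A v)).
    by move=> x y; rewrite -[x in LHS]scale1r psubst_lin scale1r.
  by apply/val_inj; rewrite /= /lsubst raddf0.
have esum A g' : elt g' (psubst A (vsum : polyV OE r) : VO) =
    \sum_(m : kF D) elt g' (psubst A (uY m : polyV OE r) : VO).
  by rewrite psum; apply: (linear_sum (elt g') _ _ (fun m => psubst A (uY m : polyV OE r) : VO)).
have lam c : small (a * p%:R) (elt (g * gl_teich c)%g (psubst (At c) (vsum : polyV OE r) : VO) +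
    (p%:R * (r h)%:R) *: elt (g * gl_teich c)%g (ep h)).
  have [z [W e]] := model_lam c; set g' := (g * gl_teich c)%g.
  have H1 : small (a * p%:R) (elt g' (psubst (At c) (vsum : polyV OE r) : VO) -
     elt g' (\sum_m (jO (cA c m) *: Xv + p%:R *: \sum_(i < f) jO (cB c m i) *: ep i))).
    rewrite esum (linear_sum (elt g')) -sumrB; apply: smem_sum => m _.
    by apply: small_ap_pp => //; apply: small_cong; apply: taylor_lam.
  have H2 : small (a * p%:R) (p%:R *: elt g' (z *: Xv)).
    rewrite mulrC; apply: smallZ; rewrite linearZ; apply: smemZ; exact: small_Xv.
  apply: smem_eq (smemD H1 (smemD H2 (small_pp (elt g' W) ea))) _; rewrite e.
  have -> : elt g' (p%:R *: (z *: Xv) - (p%:R * (r h)%:R) *: ep h + p%:R ^+ 2 *: W) =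
      p%:R *: elt g' (z *: Xv) - (p%:R * (r h)%:R) *: elt g' (ep h) + p%:R ^+ 2 *: elt g' W.
    rewrite -scaleNr -addrA (eltP g') -[X in elt g' (_ + X)]addr0.
    by rewrite addr0 (eltP g') -[p%:R ^+ 2 *: W]addr0 (eltP g') linear0 addr0 scaleNr addrA.
  exact: zmod_cancel2.
have al : small (a * p%:R) (elt (g * gl_alpha D)%g (psubst Aal (vsum : polyV OE r) : VO)).
  have [z [W e]] := model_al; set g' := (g * gl_alpha D)%g.
  have H1 : small (a * p%:R) (elt g' (psubst Aal (vsum : polyV OE r) : VO) -
     elt g' (\sum_(m : kF D) (1 *: Yv + p%:R *: \sum_(i < f) jO ((r i)%:R * frobn i (teich m)) *:
        mO (fun j => (r j - (j == i))%N)))).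
    rewrite esum (linear_sum (elt g')) -sumrB; apply: smem_sum => m _.
    by apply: small_ap_pp => //; apply: small_cong; apply: taylor_al.
  have H2 : small (a * p%:R) (p%:R *: elt g' (z *: Yv)).
    rewrite mulrC; apply: smallZ; rewrite linearZ; apply: smemZ; exact: small_Yv.
  apply: smem_eq (smemD H1 (smemD H2 (small_pp (elt g' W) ea))) _.
  by rewrite e (eltP g') -[p%:R ^+ 2 *: W]addr0 (eltP g') linear0 addr0 subrK.
rewrite /hecke_elt addrAC; apply: smemD => //.
rewrite /Sg scaler_sumr -big_split; apply: smem_sum => c _; exact: lam.
Qed.

(** The product of [gl_teich m] and [gl_alpha] is p u_[m], and p acts trivially. *)
Lemma elt_uY g m : elt g (uY m) = elt (g * gl_teich m * gl_alpha D)%g Yv.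
Proof.
rewrite /uY -(elt_KZ g 1 (ugl (teich m))); congr elt; rewrite -mulgA; congr (_ * _)%g.
apply/val_inj/matrixP => i k; rewrite /= !mxE sum2 !mxE expr1z.
do 2 case: (_ == 0); rewrite /= ?val_natOF ?mulr1 ?mulr0 ?mul0r ?add0r ?addr0 ?mul1r //.
by rewrite mulrC.
Qed.

(** Apply [Yv_rec] to each [g g_m alpha, Y^r]: the eps parts give a_p^2 [Sg], and the remaining
    a_p^2 [g g_m, Y^r] are divisible by a_p^3 thanks to [small_Yv]. *)
Lemma elt_vsum g (a : OE) : val a = ap -> exists2 y, small (a ^+ 3) y &
  small (a * p%:R) (a *: elt g vsum + a ^+ 2 *: Sg g - y).
Proof.
move=> ea; exists (\sum_(m : kF D) a ^+ 2 *: elt (g * gl_teich m)%g Yv).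
  apply: smem_sum => m _; rewrite exprSr; apply: smallZ; exact: small_Yv.
have -> : elt g vsum = \sum_(m : kF D) elt g (uY m) by apply: (linear_sum (elt g)).
rewrite /Sg !scaler_sumr -big_split -sumrB; apply: smem_sum => m _; cbv beta.
rewrite elt_uY; apply: smem_eq (smallZ a (Yv_rec (g * gl_teich m)%g ea)) _.
have -> : elt (g * gl_teich m)%g (Yv - ep h) =
    elt (g * gl_teich m)%g Yv - elt (g * gl_teich m)%g (ep h) by apply: linearB.
by rewrite scalerBr scalerA -expr2 scalerBr opprB addrA.
Qed.

(** Comparing T and a_p on [g, [vsum]] puts (a_p^2 - p r_h) [Sg] in the span of multiples of a_p p
    and a_p^3. Saturation allows division, and the two inequalities place the quotients [e1] and
    [e2] in the maximal ideal. *)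
Lemma kill_Sg g : ap ^+ 2 - p%:R * (r h)%:R != 0 ->
  vE D (ap ^+ 2 - p%:R * (r h)%:R) < 1 + vE D ap ->
  vE D (ap ^+ 2 - p%:R * (r h)%:R) < vE D ap *+ 3 -> tt ap (Sg g) = 0.
Proof.
set cc := _ - _ => cc0 v1 v2.
have [a ea _] := apE.
pose cO : OE := a ^+ 2 - p%:R * (r h)%:R.
have ecO : val cO = cc by rewrite /cO /= !val_natOE ea.
have [e1 ve1 re1] : exists2 e1 : OE, val e1 = ap * p%:R / cc & redE D e1 = 0.
  apply: OE_max; first by rewrite !mulf_neq0 ?invr_eq0 ?pE_neq0.
  by rewrite !vfunM ?mulf_neq0 ?invr_eq0 ?pE_neq0 // vV // vE_p subr_gt0 addrC.
have [e2 ve2 re2] : exists2 e2 : OE, val e2 = ap ^+ 3 / cc & redE D e2 = 0.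
  apply: OE_max; first by rewrite !mulf_neq0 ?invr_eq0 ?expf_neq0.
  by rewrite vfunM ?invr_eq0 ?expf_neq0 // vV // vfunX // subr_gt0.
have E1 : a * p%:R = cO * e1.
  apply/val_inj; change (val a * val (p%:R : OE) = val cO * val e1).
  by rewrite ecO ve1 val_natOE ea [RHS]mulrC divfK.
have E2 : a ^+ 3 = cO * e2.
  apply/val_inj; change (val (a ^+ 3) = val cO * val e2).
  rewrite ecO ve2 (rmorphXn (\val : OE -> E D)); change (val a ^+ 3 = cc * (ap ^+ 3 / cc)).
  by rewrite ea [RHS]mulrC divfK.
have [y [z2 hz2] [z3 hz3]] := elt_vsum g ea.
have [z1 hz1] := hecke_vsum g ea.
have hn := null_hecke (r := r) g vsum ea.
have H := smemD (smemD hz3 hz2) (smemN (smemD hz1 (smemN hn))).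
have {H} : null r ap (cO *: (Sg g - (e1 *: z3 + e2 *: z2 - e1 *: z1))).
  apply: smem_eq H _; rewrite E1 E2 scalerBr !scalerDr scalerN !scalerA /cO scalerBl.
  move: (hecke_elt g vsum) (a *: elt g vsum) (_ *: Sg g) (_ *: Sg g) (_ *: z1) (_ *: z2) (_ *: z3).
  move=> A B C S' x1 x2 x3; exact: zmod_cancel1.
move/(null_sat (r := r)); rewrite ecO => /(_ cc0) hS.
have t0 : tt ap (Sg g - (e1 *: z3 + e2 *: z2 - e1 *: z1)) = 0.
  apply: (@tt_null _ _ D r ap _ 0 0); last exact: rmorph0.
  by rewrite scaler0 subr0.
have -> : Sg g = (Sg g - (e1 *: z3 + e2 *: z2 - e1 *: z1)) +
   (e1 *: z3 + e2 *: z2 + (- e1) *: z1) by rewrite scaleNr subrK.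
by rewrite ttD t0 add0r !ttD !ttZ rmorphN re1 re2 oppr0 !scale0r !addr0.
Qed.

End Analytic.

(** The list of summation depends on u, so linearity is checked on one list containing the three
    supports. *)
Lemma supp_sum_linear (R : nzRingType) (X : eqType) (U A C : lmodType R)
    (coef : U -> X -> A) (supp : U -> seq X) (Fx : X -> A -> C) :
  (forall x, linear (Fx x)) -> (forall u, uniq (supp u)) ->
  (forall u x, coef u x != 0 -> x \in supp u) ->
  (forall a u v x, coef (a *: u + v) x = a *: coef u x + coef v x) ->
  linear (fun u => \sum_(x <- supp u) Fx x (coef u x)).
Proof.
move=> Fl us hs cl a u v.
have F0 x : Fx x 0 = 0.
  by have := Fl x (-1) 0 0; rewrite scaler0 addr0 scaleN1r addNr.
pose s := undup (supp (a *: u + v) ++ supp u ++ supp v).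
have ss w : {subset supp w <= s} -> \sum_(x <- supp w) Fx x (coef w x) =
    \sum_(x <- s) Fx x (coef w x).
  move=> sub; apply: big_uniq_supp; rewrite ?undup_uniq // => x hx.
    by apply: hs; apply: contraNneq hx => ->; rewrite F0.
  by apply: sub; apply: hs; apply: contraNneq hx => ->; rewrite F0.
rewrite !ss => [|x|x|x]; try by rewrite mem_undup !mem_cat => ->; rewrite ?orbT.
rewrite scaler_sumr -big_split; apply: eq_bigr => x _.
by rewrite cl Fl.
Qed.

Lemma linear_ex (R : nzRingType) (U W : lmodType R) (u : U -> W) :
  linear u -> exists u' : {linear U -> W}, forall x, u' x = u x.
Proof.
move=> lu; pose Pm := GRing.isLinear.Build R U W _ u lu.
by exists (HB.pack u Pm : {linear U -> W}).
Qed.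

(** * Construction of the natural map onto the reduction of Theta *)

Section NaturalMap.
Variables (p f : nat) (D : padic_setting p f) (r : 'I_f -> nat) (ap : E D).
Local Notation OF := (intring (vF D)).
Local Notation OE := (intring (vE D)).
Local Notation kb := (kbar D).
Local Notation G := (GL2 (F D)).
Local Notation VO := (Vrep (structOE D) r).
Local Notation V := (Vrep (structkbar D) r).

Definition mlift (m : 'X_{1..f + f}) : VO := insubd (0 : polyV OE r) 'X_[m].

(** A vector over kbar need not lift to O_E, whose residue field may be smaller. Monomials do lift,
    and their coefficients are placed outside, in [Thetabar]. *)
Definition fib (g : G) (v : V) : Thetabar r ap :=
  \sum_(m <- msupp (val (v : polyV kb r)))
     (val (v : polyV kb r))@_m *: tt ap (elt g^-1%g (mlift m)).

Lemma fib_linear g : linear (fib g).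
Proof.
apply: (@supp_sum_linear kb _ V kb^o (Thetabar r ap)
  (fun v m => (val (v : polyV kb r))@_m) (fun v => msupp (val (v : polyV kb r)))
  (fun m c => c *: tt ap (elt g^-1%g (mlift m)))).
- by move=> m a x y; rewrite scalerDl scalerA.
- by move=> v; apply: msupp_uniq.
- by move=> v m; rewrite mcoeff_msupp.
by move=> a u v m; rewrite /= mcoeffD mcoeffZ.
Qed.

Lemma fib_red g (v : VO) : fib g (coefkbar D r v) = tt ap (elt g^-1%g v).
Proof.
have /multihomP hv := valP (v : polyV OE r).
pose w := val (v : polyV OE r).
have lE m : m \in msupp w -> val (mlift m : polyV OE r) = 'X_[m].
  by move=> hm; rewrite /mlift val_insubd mpolyX_multihom // => i; apply: hv.
have vE : v = \sum_(m <- msupp w) w@_m *: mlift m.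
  apply/val_inj; rewrite raddf_sum -[LHS]/w {1}[w]mpolyE; apply: eq_big_seq => m hm.
  by change (w@_m *: 'X_[m] = w@_m *: val (mlift m : polyV OE r)); rewrite lE.
have -> : elt g^-1%g v = \sum_(m <- msupp w) w@_m *: elt g^-1%g (mlift m).
  by rewrite {1}vE linear_sum; apply: eq_bigr => m _; rewrite linearZ.
rewrite tt_sum; under [RHS]eq_bigr do rewrite ttZ.
have cE m : (val (coefkbar D r v : polyV kb r))@_m = redE D w@_m.
  exact: mcoeff_map_mpoly.
have -> : fib g (coefkbar D r v) = \sum_(m <- msupp (map_mpoly (redE D) w))
    redE D w@_m *: tt ap (elt g^-1%g (mlift m)).
  by apply: eq_bigr => m _; congr (_ *: _); apply: cE.
apply: big_uniq_supp; rewrite ?msupp_uniq // => m hm.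
  rewrite mcoeff_msupp mcoeff_map_mpoly; apply: contraNneq hm => hm.
  by rewrite hm scale0r.
rewrite mcoeff_msupp; apply: contraNneq hm => hm.
by rewrite hm rmorph0 scale0r.
Qed.

Lemma natural_surj_ex :
  exists psi : {linear ind V -> Thetabar r ap}, natural_surj psi.
Proof.
have [supp hs] := choice (@rep_suppP p f D kb V).
(* Restriction to the chosen representatives counts each coset once. *)
pose coef (x : ind V) (g : G) : V := if coset_rep g == g then ind_fun x g else 0.
have coefP x g : coef x g != 0 -> g \in supp x.
  rewrite /coef; have [_ _ h3] := hs x.
  have [e hg|ne] := eqVneq (coset_rep g) g; last by rewrite eqxx.
  by have := h3 g hg; rewrite e.
have lin : linear (fun x => \sum_(g <- supp x) fib g (coef x g)).
  apply: supp_sum_linear => //; first exact: fib_linear.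
    by move=> x; have [] := hs x.
  move=> a x y g; rewrite /coef; case: (coset_rep g == g); first by rewrite ind_funD ind_funZ.
  by rewrite scaler0 addr0.
have [psi psiE] := linear_ex lin; exists psi => x; have [t ht] := rep_suppP x.
have -> : psi (ind_map (coefkbar D r) x) = tt ap x; last by [].
rewrite psiE [in RHS](ind_decomp ht) tt_sum.
have [ut rt st] := ht.
have f0 g : fib g 0 = 0.
  by have := fib_linear g (-1) 0 0; rewrite scaler0 addr0 scaleN1r addNr.
rewrite (@big_uniq_supp _ _ _ _ t) //.
- rewrite big_seq [RHS]big_seq; apply: eq_bigr => g gt.
  by rewrite /coef rt // eqxx -fib_red.
- by have [] := hs (ind_map (coefkbar D r) x).
- by move=> g hg; apply: coefP; apply: contraNneq hg => ->; rewrite f0.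
move=> g; rewrite /coef; have [e hg|ne] := eqVneq (coset_rep g) g; last by rewrite f0 eqxx.
rewrite -e; apply: st; apply: contraNneq hg => hg.
have -> : ind_fun (ind_map (coefkbar D r) x) g = coefkbar D r (ind_fun x g) by [].
by rewrite hg raddf0 f0.
Qed.

End NaturalMap.

(** * Vectors killed by the natural map *)

Section Kill.
Variables (p f : nat) (D : padic_setting p f) (r : 'I_f -> nat) (ap : E D) (h : 'I_f).
Local Notation OF := (intring (vF D)).
Local Notation OE := (intring (vE D)).
Local Notation kb := (kbar D).
Local Notation G := (GL2 (F D)).
Local Notation VO := (Vrep (structOE D) r).
Local Notation V := (Vrep (structkbar D) r).
Local Notation q1 := (p ^ f - 1)%N.
Hypothesis p_gt2 : (2 < p)%N.
Hypothesis r_gt : forall i, (p ^ f + p - 2 < r i)%N.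
Hypothesis r_mod : pval p r = p ^ h %[mod q1].
Hypothesis ap0 : ap != 0.
Hypothesis ap_gt0 : 0 < vE D ap.
Hypothesis ap_lt1 : vE D ap < 1.
Variable psi : {linear ind V -> Thetabar r ap}.
Hypothesis psi_nat : natural_surj psi.
Let f_gt0 : (0 < f)%N := f_gt0_of h.

Lemma psi_red g (v : VO) : psi (elt g (coefkbar D r v)) = tt ap (elt g v).
Proof. by rewrite -ind_map_elt; apply: psi_nat. Qed.

Lemma coefkbar_mO b : (forall i, b i <= r i)%N -> coefkbar D r (mO D r b) = vmon D r b.
Proof.
move=> hb; apply/val_inj; rewrite val_vmon //.
change (map_mpoly (redE D) (vO (mO D r b)) = 'X_[mon (fun i => (r i - b i)%N) b]).
by rewrite /vO /mO val_vmonR // map_mpolyX.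
Qed.

(** The vector lifts to a difference of two monomials. Their [pval] contain p p^(i-1) and p^i
    respectively, congruent modulo q - 1 around the cycle, and each still contains some X, so
    [kill_diff] applies. *)
Lemma kill_theta g (u : V) i m : val (u : polyV kb r) = theta D i * 'X_[m] ->
  psi (elt g u) = 0.
Proof.
move=> eu; pose i0 := ord_pred i.
have iS : ordS i0 = i by apply: ord_predK.
pose m1 := mon (fun j => expX m j + (j == i))%N (fun j => expY m j + p * (j == i0))%N.
pose m2 := mon (fun j => expX m j + p * (j == i0))%N (fun j => expY m j + (j == i))%N.
have X1 j : expX m1 j = (expX m j + (j == i))%N := monX _ _ _.
have Y1 j : expY m1 j = (expY m j + p * (j == i0))%N := monY _ _ _.
have X2 j : expX m2 j = (expX m j + p * (j == i0))%N := monX _ _ _.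
have Y2 j : expY m2 j = (expY m j + (j == i))%N := monY _ _ _.
have e1 : 'X_[m1] = varX kb i * varY kb i0 ^+ p * 'X_[m].
  rewrite /varX /varY mpolyXn -!mpolyXD; congr mpolyX; apply: mnm_split => j.
    rewrite !mnmDE mulmnE !mnm1E (inj_eq (@lshift_inj _ _)) eq_rlshift mul0n addn0.
    by rewrite -[m1 _]/(expX m1 j) X1 addnC (eq_sym i).
  rewrite !mnmDE mulmnE !mnm1E (inj_eq (@rshift_inj _ _)) eq_lrshift add0n.
  by rewrite -[m1 _]/(expY m1 j) Y1 addnC mulnC (eq_sym i0).
have e2 : 'X_[m2] = varY kb i * varX kb i0 ^+ p * 'X_[m].
  rewrite /varX /varY mpolyXn -!mpolyXD; congr mpolyX; apply: mnm_split => j.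
    rewrite !mnmDE mulmnE !mnm1E (inj_eq (@lshift_inj _ _)) eq_rlshift add0n.
    by rewrite -[m2 _]/(expX m2 j) X2 addnC mulnC (eq_sym i0).
  rewrite !mnmDE mulmnE !mnm1E (inj_eq (@rshift_inj _ _)) eq_lrshift mul0n addn0.
  by rewrite -[m2 _]/(expY m2 j) Y2 addnC (eq_sym i).
have uE : val (u : polyV kb r) = 'X_[m1] - 'X_[m2].
  by rewrite eu /theta mulrBl -e1 -e2.
(* Without cancellation both monomials are in the support of u and inherit its multidegree. *)
have m12 : (m1 == m2) = false.
  apply/eqP => e; have := X1 i; rewrite e X2 eqxx => /addnI.
  by case: (i == i0); rewrite ?muln1 ?muln0 // => e'; have := p_gt1 D; rewrite e'.
have /multihomP hu := valP (u : polyV kb r).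
have d1 j : (expX m1 j + expY m1 j)%N = r j.
  apply: hu; rewrite uE mcoeff_msupp mcoeffB !mcoeffX eqxx [m2 == m1]eq_sym m12 subr0.
  exact: oner_neq0.
have d2 j : (expX m2 j + expY m2 j)%N = r j.
  apply: hu; rewrite uE mcoeff_msupp mcoeffB !mcoeffX eqxx m12 sub0r oppr_eq0.
  exact: oner_neq0.
have b1 j : (expY m1 j <= r j)%N by rewrite -d1 leq_addl.
have b2 j : (expY m2 j <= r j)%N by rewrite -d2 leq_addl.
have p0 : (0 < p)%N := ltnW (p_gt1 D).
have u12 : u = coefkbar D r (mO D r (expY m1) - mO D r (expY m2)).
  rewrite raddfB !coefkbar_mO //; apply/val_inj.
  change (val (u : polyV kb r) = val (vmon D r (expY m1) : polyV kb r) -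
    val (vmon D r (expY m2) : polyV kb r)).
  rewrite !val_vmon // uE; congr (mpolyX _ _ - mpolyX _ _).
    by apply: mnm_split => j; rewrite ?monX ?monY // -d1 addnK.
  by apply: mnm_split => j; rewrite ?monX ?monY // -d2 addnK.
have pv1 : pval p (expY m1) = (pval p (expY m) + p * p ^ i0)%N.
  by rewrite -pval_delta -pvalD; congr pval; apply/funext.
have pv2 : pval p (expY m2) = (pval p (expY m) + p ^ i)%N.
  by rewrite -pval_delta1 -pvalD; congr pval; apply/funext.
rewrite u12 psi_red.
apply: (kill_diff (i := i) (i' := i0) p_gt2 ap0 ap_gt0 ap_lt1 g b1 b2).
- by rewrite pv1 addn_gt0 muln_gt0 p0 expn_gt0 p0 orbT.
- by rewrite pv2 addn_gt0 expn_gt0 p0 orbT.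
- rewrite pv1 pv2; apply/eqP; rewrite eqn_modDl; apply/eqP.
  by rewrite -iS (p_ordS D).
- by rewrite -d1 X1 eqxx addn1 addSn ltnS leq_addl.
- by rewrite -d2 X2 eqxx muln1; lia.
Qed.

(** An element of V_r^*, whose cofactors are arbitrary, is brought to monomial cofactors through its
    zero evaluation. For X_r, the translates of X^r are reductions of vectors divisible by a_p. *)
Lemma kill_Qker g (v : V) : Qker D r v -> psi (elt g v) = 0.
Proof.
have z0 : psi (elt g (0 : V)) = 0 by rewrite !linear0.
have zP a x y : psi (elt g x) = 0 -> psi (elt g y) = 0 -> psi (elt g (a *: x + y)) = 0.
  by move=> hx hy; rewrite (eltP g) linearP hx hy scaler0 addr0.
move=> hv; apply: (hv (Submodule z0 zP)) => w [hw|hw].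
  have ht := ev_eq0_theta_span p_gt2 f_gt0 r_gt (ev_Vstar hw).
  by apply: (ht (Submodule z0 zP)) => u [i [m e]]; apply: kill_theta e.
apply: (hw (Submodule z0 zP)) => _ [k [x [hx ->]]].
change (psi (elt g (act k x)) = 0).
have -> : x = coefkbar D r (act (wgl D) (Yv D r)).
  rewrite (act_wgl_Yv D) // coefkbar_mO //; apply/val_inj; rewrite hx val_vmon //.
  rewrite mpolyX_mon [X in _ * X]big1 ?mulr1 => [|i _]; last exact: expr0.
  by apply: eq_bigr => i _; rewrite subn0.
rewrite -equivar_act psi_red.
have [a ea ra] : exists2 a : OE, val a = ap & redE D a = 0 by apply: apE.
rewrite -actM; have [z hz] : small r ap a (elt g (act (k * wgl D)%g (Yv D r))).
  exact: (small_actYv p_gt2 r_gt r_mod ap0 ap_gt0 ap_lt1 g (k * wgl D)%g ea).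
exact: tt_null hz ra.
Qed.

Lemma kill_eps g : ap ^+ 2 - p%:R * (r h)%:R != 0 ->
  vE D (ap ^+ 2 - p%:R * (r h)%:R) < 1 + vE D ap ->
  vE D (ap ^+ 2 - p%:R * (r h)%:R) < vE D ap *+ 3 ->
  psi (\sum_(c : kF D) elt (g * gl_teich c)%g (eps D h r)) = 0.
Proof.
move=> c0 v1 v2.
have le j : ((j == h) <= r j)%N by apply: (delta_le r_gt).
have <- : tt ap (Sg r h g) = 0 by apply: kill_Sg.
rewrite linear_sum tt_sum.
by apply: eq_bigr => c _; rewrite -psi_red coefkbar_mO.
Qed.

End Kill.

(** * The induced map from ind cosoc(Q) to F_t *)

Section Induced2.
Variables (p f : nat) (D : padic_setting p f) (r : 'I_f -> nat) (ap : E D).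
Local Notation OF := (intring (vF D)).
Local Notation kb := (kbar D).
Local Notation G := (GL2 (F D)).
Local Notation Q := (repQ D r).
Variable psiQ : {linear ind Q -> Thetabar r ap}.

Lemma elt_ind_in (S : subrep Q) (g : G) (x : Q) : S x -> ind_in S (elt g x).
Proof.
move=> Sx g'; rewrite /ind_fun /=.
have [[[n k] /= e]|ne] := pselect (exists nk, (g' * g)%g = KZelt nk.1 nk.2).
  by rewrite (elt_funE x e); apply: subrep_act.
by rewrite elt_funN //; apply: (smem0 S).
Qed.

Local Notation S1 := (socfil Q f).
Local Notation S0 := (socfil Q f.-1).

Lemma incl_mem (x : ind (sub_rep S1)) :
  psiQ (ind_map (sub_incl S1) x) \in smem_pred (Fil psiQ f).
Proof.
apply/smem_predP; exists (ind_map (sub_incl S1) x) => // g.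
exact/smem_predP/(valP (ind_fun x g : submod S1)).
Qed.

Definition toFil (x : ind (sub_rep S1)) : submod (Fil psiQ f) :=
  Sub (psiQ (ind_map (sub_incl S1) x)) (incl_mem x).

Lemma toFil_linear : linear toFil.
Proof.
move=> a x y; apply/val_inj => /=; rewrite -linearP; congr (psiQ _).
exact: (ind_map_lin (u := sub_incl S1)).
Qed.

HB.instance Definition _ := GRing.isLinear.Build kb (ind (sub_rep S1))
  (submod (Fil psiQ f)) _ toFil toFil_linear.

Definition toFtx : {linear ind (sub_rep S1) -> Ft psiQ} := qclass _ \o toFil.

Lemma toFtx_eq0 x : Fil psiQ f.-1 (psiQ (ind_map (sub_incl S1) x)) -> toFtx x = 0.
Proof.
move=> hx; rewrite -[RHS](linear0 (qclass _)); apply/qclass_eq.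
by rewrite subr0.
Qed.

Lemma induced_ex : exists2 pi : {linear ind (cosocQ D r) -> Ft psiQ},
  induced_surj pi & forall x, pi (ind_map (quot_proj _) x) = toFtx x.
Proof.
have [|pi hpi] := @ind_factor p f D kb (sub_rep S1) (res_sub S1 S0) (Ft psiQ) toFtx.
  move=> g v hv; apply: toFtx_eq0; rewrite ind_map_elt.
  by exists (elt g (val (v : submod S1))) => //; apply: elt_ind_in.
exists pi => // x y e; rewrite hpi; congr (qclass _ _).
by apply/val_inj; rewrite /= e.
Qed.

End Induced2.

(** * The reduced Hecke operator and lower unipotents *)

Section HeckeEquivariance.
Variables (p f : nat) (D : padic_setting p f) (s : 'I_f -> nat) (m : nat).
Local Notation OF := (intring (vF D)).
Local Notation kb := (kbar D).
Local Notation sb := (structkbar D).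
Local Notation G := (GL2 (F D)).
Local Notation W := (weight_rep sb s m).
Hypothesis p_gt2 : (2 < p)%N.
Hypothesis f_gt0 : (0 < f)%N.
Hypothesis s_lt : forall i, (s i < p)%N.

Definition xs : W := vmonR kb s (fun=> 0%N).
Definition ys : W := vmonR kb s s.
Definition vW (v : W) : {mpoly kb[f + f]} := val (v : polyV kb s).

Lemma vW_inj u v : vW u = vW v -> u = v.
Proof. exact: val_inj. Qed.

Lemma vW_Z a v : vW (a *: v) = a *: vW v.
Proof. by []. Qed.

Lemma vW_sum I (t : seq I) (u : I -> W) : vW (\sum_(i <- t) u i) = \sum_(i <- t) vW (u i).
Proof. exact: (big_morph vW). Qed.

Lemma vW_xs : vW xs = \prod_(i < f) varX kb i ^+ s i.
Proof.
rewrite /vW /xs val_vmonR // mpolyX_mon [X in _ * X]big1 ?mulr1 => [|i _]; last exact: expr0.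
by apply: eq_bigr => i _; rewrite subn0.
Qed.

Lemma vW_ys : vW ys = \prod_(i < f) varY kb i ^+ s i.
Proof.
rewrite /vW /ys val_vmonR // mpolyX_mon [X in X * _]big1 ?mul1r // => i _.
by rewrite subnn expr0.
Qed.

Lemma vW_act_xs k : vW (act k xs) = sb (\det (val k)) ^+ m *:
  \prod_(i < f) (sb (val k 0 0) ^+ (p ^ i) *: varX kb i +
                 sb (val k 1 0) ^+ (p ^ i) *: varY kb i) ^+ s i.
Proof.
rewrite /vW /= val_vmonR // lsubst_mon [X in _ * X]big1 ?mulr1 => [|i _]; last exact: expr0.
congr (_ *: _); apply: eq_bigr => i _.
by rewrite !conj_mxE subn0.
Qed.

Lemma vW_act_lgl t : vW (act (lgl t) xs) =
  \prod_(i < f) (varX kb i + sb t ^+ (p ^ i) *: varY kb i) ^+ s i.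
Proof.
rewrite vW_act_xs det_mx2 mulr1 mul0r subr0 (rmorph1 sb) expr1n scale1r.
by apply: eq_bigr => i _; rewrite !mxE (rmorph1 sb) expr1n scale1r.
Qed.

Lemma act_ugl_xs t : act (ugl t) xs = xs.
Proof.
apply: vW_inj; rewrite vW_act_xs det_mx2 mulr1 mulr0 subr0 (rmorph1 sb) expr1n scale1r vW_xs.
apply: eq_bigr => i _; rewrite !mxE (rmorph1 sb) (rmorph0 sb) expr1n scale1r.
by rewrite expr0n expn_eq0 -[p == 0]/(p == 0%N) (gtn_eqF (ltnW (p_gt1 D))) /= scale0r addr0.
Qed.

(** The coefficient of z^k in the lower unipotent translates of X^s; its binomial factor vanishes
    unless k <= s. *)
Definition gk (k : {ffun 'I_f -> 'I_p}) : W :=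
  (\prod_(i < f) 'C(s i, k i)%:R) *: vmonR kb s (dgt k).

Lemma act_lgl_expand z : act (lgl (teich z)) xs =
  \sum_k zeta z ^+ pval p (dgt k) *: gk k.
Proof.
apply: vW_inj; rewrite vW_act_lgl vW_sum.
have E (i : 'I_f) : (varX kb i + sb (teich z) ^+ (p ^ i) *: varY kb i) ^+ s i =
   \sum_(k : 'I_p) (zeta z ^+ (p ^ i)) ^+ k *:
     ('C(s i, k)%:R *: (varX kb i ^+ (s i - k) * varY kb i ^+ k)).
  rewrite exprDn.
  rewrite (big_ord_widen _ (fun k : nat => (varX kb i ^+ (s i - k) *
     (sb (teich z) ^+ (p ^ i) *: varY kb i) ^+ k) *+ 'C(s i, k)) (s_lt i)).
  rewrite [RHS](bigID (fun k : 'I_p => (k < (s i).+1)%N)) /= [X in _ = _ + X]big1 ?addr0.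
    apply: eq_bigr => k _; rewrite exprZn -scalerAr -scaler_nat !scalerA.
    by congr (_ *: _); rewrite mulrC.
  by move=> k; rewrite -leqNgt => /bin_small ->; rewrite scale0r scaler0.
under eq_bigr do rewrite E; rewrite bigA_distr_bigA /=.
apply: eq_bigr => k _; rewrite scaler_prod expr_pval vW_Z; congr (_ *: _).
rewrite scaler_prod /gk vW_Z.
have [hk|hk] := pselect (forall i, dgt k i <= s i)%N.
  by congr (_ *: _); rewrite /vW val_vmonR // mpolyX_mon big_split.
have [i hi] : exists i, (s i < k i)%N.
  apply: contrapT => H; apply: hk => i; rewrite leqNgt; apply/negP => hi.
  by apply: H; exists i.
by rewrite (bigD1 i) //= bin_small // mul0r !scale0r.
Qed.

(** As s_i < p, each monomial is, up to an invertible binomial factor, a coefficient [gk], and these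
    are recovered from the translates by Fourier inversion. *)
Lemma span_lgl (S : submodule W) :
  (forall z, S (act (lgl (teich z)) xs)) -> forall v, S v.
Proof.
move=> hS.
have Sg k : S (gk k).
  (* The case k = 0, outside the range of [extract_coef], is the translate at z = 0. *)
  have [k0|k0] := posnP (pval p (dgt k)); last first.
    rewrite -(extract_coef (D := D) p_gt2 f_gt0 gk (pval_dgt_inj D) (pval_dgt_lt D) k0).
    apply: smemN; apply: smem_sum => z _; apply: smemZ.
    by rewrite -act_lgl_expand.
  have := hS 0; rewrite act_lgl_expand (bigD1 k) //= k0 expr0 scale1r big1 ?addr0 //.
  move=> k' kk'; rewrite (rmorph0 (@zeta p f D)) expr0n.
  have -> : (pval p (dgt k') == 0%N) = false; last by rewrite scale0r.
  by apply/eqP => e; case/eqP: kk'; apply: (pval_dgt_inj D); rewrite e k0.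
apply: polyV_gen => u m' hm e.
have hb i : (expY m' i <= s i)%N by rewrite -hm leq_addl.
have hp i : (expY m' i < p)%N by apply: leq_ltn_trans (hb i) (s_lt i).
pose k : {ffun 'I_f -> 'I_p} := [ffun i => Ordinal (hp i)].
have kE : dgt k = expY m' by apply/funext => i; rewrite /dgt ffunE.
have := Sg k; rewrite /gk kE => /submodZ_inv.
have -> : (vmonR kb s (expY m') : W) = u.
  apply: val_inj; rewrite e val_vmonR //; congr mpolyX.
  by apply: mnm_split => i; rewrite ?monX ?monY // -hm addnK.
apply; apply/prodf_neq0 => i _; rewrite (bin_kbar_neq0 D) //.
by rewrite ffunE /= hb s_lt.
Qed.

Hypothesis s_pos : exists i, (0 < s i)%N.

Lemma pval_s_gt0 : (0 < pval p s)%N.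
Proof.
have [i si] := s_pos; apply: leq_trans (leq_pval1 p s i).
by rewrite muln_gt0 si expn_gt0 (ltnW (p_gt1 D)).
Qed.

Lemma pK : p%:R = 0 :> kb.
Proof. exact: pcharf0 (kbar_pchar D). Qed.

Lemma frobD (x y : kb) i : (x + y) ^+ (p ^ i) = x ^+ (p ^ i) + y ^+ (p ^ i).
Proof.
by rewrite exprDn_pchar // pnatX pnatE ?(p_prime D) // (kbar_pchar D).
Qed.

Definition AtK (c : kF D) (i : 'I_f) : 'M[kb]_2 :=
  mx2 1 ((- sb (teich c)) ^+ (p ^ i)) 0 p%:R.
Definition AalK (i : 'I_f) : 'M[kb]_2 := mx2 p%:R 0 0 1.

Lemma lsubst_prod A (F : 'I_f -> {mpoly kb[f + f]}) (e : 'I_f -> nat) :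
  lsubst A (\prod_(i < f) F i ^+ e i) = \prod_(i < f) lsubst A (F i) ^+ e i.
Proof.
by rewrite /lsubst rmorph_prod; apply: eq_bigr => i _; rewrite rmorphXn.
Qed.

Lemma lsubst_lin A a b (u v : {mpoly kb[f + f]}) :
  lsubst A (a *: u + b *: v) = a *: lsubst A u + b *: lsubst A v.
Proof. by rewrite /lsubst linearD !linearZ. Qed.

Lemma AtK_lgl c z : psubst (AtK c) (act (lgl (teich z)) xs : polyV kb s) =
  (1 - zeta c * zeta z) ^+ pval p s *: xs.
Proof.
apply: vW_inj; change (lsubst (AtK c) (vW (act (lgl (teich z)) xs)) =
  (1 - zeta c * zeta z) ^+ pval p s *: vW xs).
rewrite vW_act_lgl lsubst_prod vW_xs -expr_pval -scaler_prod; apply: eq_bigr => i _.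
rewrite -exprZn; congr (_ ^+ _).
rewrite -[varX kb i in LHS]scale1r lsubst_lin lsubstX lsubstY !mxE /= pK !scale0r !addr0.
rewrite !scalerA -scalerDl mulr1; congr (_ *: _).
by rewrite frobD expr1n -exprMn mulrN [zeta z * _]mulrC.
Qed.

Lemma AalK_lgl z : psubst AalK (act (lgl (teich z)) xs : polyV kb s) =
  zeta z ^+ pval p s *: ys.
Proof.
apply: vW_inj; change (lsubst AalK (vW (act (lgl (teich z)) xs)) =
  zeta z ^+ pval p s *: vW ys).
rewrite vW_act_lgl lsubst_prod vW_ys -expr_pval -scaler_prod; apply: eq_bigr => i _.
rewrite -exprZn; congr (_ ^+ _).
rewrite -[varX kb i in LHS]scale1r lsubst_lin lsubstX lsubstY !mxE /= pK !scale0r.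
by rewrite addr0 scaler0 !add0r scale1r.
Qed.

Lemma AtK_xs c : psubst (AtK c) (xs : polyV kb s) = xs.
Proof.
apply: vW_inj; change (lsubst (AtK c) (vW xs) = vW xs).
rewrite vW_xs lsubst_prod; apply: eq_bigr => i _.
by rewrite lsubstX !mxE /= scale1r scale0r addr0.
Qed.

Lemma AalK_xs : psubst AalK (xs : polyV kb s) = (0 : W).
Proof.
apply: vW_inj; change (lsubst AalK (vW xs) = 0).
have [i si] := s_pos; rewrite vW_xs lsubst_prod (bigD1 i) //= lsubstX !mxE /= pK !scale0r.
by rewrite addr0 expr0n (gtn_eqF si) mul0r.
Qed.

Lemma mx_GL2 (a b c d : OF) : a * d - b * c = 1 ->
  exists k : GL2 OF, val k = mx2 a b c d.
Proof.
move=> e; have hk : mx2 a b c d \in unitmx by rewrite unitmxE det_mx2 e unitr1.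
by exists (Sub (mx2 a b c d) hk).
Qed.

Lemma val_OFM (x y : OF) : val (x * y) = val x * val y. Proof. by []. Qed.
Lemma G_eq (g g' : G) : (forall i j, val g i j = val g' i j) -> g = g'.
Proof. by move=> e; apply/val_inj/matrixP. Qed.

(** Action of the lower unipotent on the affine part of the projective line over F_q. The lower left
    entry of k is divisible by p, so X^s is an eigenvector of k. *)
Lemma coset_fin c z : 1 + z * c != 0 -> exists k : GL2 OF,
  (KZelt 0 (lgl (teich z)) * gl_teich c = gl_teich (c / (1 + z * c))%R * KZelt 0 k)%g /\
  act k xs = (1 - zeta (c / (1 + z * c)) * zeta z) ^+ pval p s *: xs.
Proof.
move=> n0; set c' := c / _; set t := teich z; set u := teich c; set u' := teich c'.
(* The upper right entry of k has to be (u - u'(1 + t u)) / p, integral because c' (1 + z c) = c. *)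
have [w ew] : exists w, u - u' * (1 + t * u) = p%:R * w.
  apply: resF_dvd; rewrite rmorphB rmorphM rmorphD rmorph1 rmorphM !res_teich.
  by rewrite /c' divfK // subrr.
have [|k ek] := @mx_GL2 (1 - u' * t) w (t * p%:R) (1 + t * u).
  rewrite mulrCA [w * p%:R]mulrC -ew; ring.
exists k; split.
  have pv : val (p%:R : OF) = p%:R := val_natOF D p.
  have evw : val u - val u' * (1 + val t * val u) = p%:R * val w.
    by have e := congr1 val ew; rewrite val_OFM val_natOF in e; exact: e.
  apply: G_eq => i j; rewrite /= ek !expr0z !scale1r !mxE !sum2 !mxE /=.
  case: (i == 0); case: (j == 0); rewrite /= ?mulr1 ?mulr0 ?mul1r ?mul0r ?addr0 ?add0r.
  - change (p%:R = p%:R * (1 - val u' * val t) + val u' * (val t * val (p%:R : OF))).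
    rewrite pv; ring.
  - change (val u = p%:R * val w + val u' * (1 + val t * val u)).
    rewrite -evw; ring.
  - by change (val t * p%:R = val t * val (p%:R : OF)); rewrite pv.
  - exact: addrC.
apply: vW_inj; rewrite vW_act_xs ek det_mx2.
have -> : (1 - u' * t) * (1 + t * u) - w * (t * p%:R) = 1.
  rewrite mulrCA [w * p%:R]mulrC -ew; ring.
rewrite (rmorph1 sb) expr1n scale1r vW_Z vW_xs -expr_pval -scaler_prod.
apply: eq_bigr => i _; rewrite -exprZn; congr (_ ^+ _).
have -> : mx2 (1 - u' * t) w (t * p%:R) (1 + t * u) 0 0 = 1 - u' * t by rewrite mxE.
have -> : mx2 (1 - u' * t) w (t * p%:R) (1 + t * u) 1 0 = t * p%:R by rewrite mxE.
rewrite (rmorphB sb) (rmorph1 sb) !(rmorphM sb) [sb p%:R](rmorph_nat sb) pK mulr0.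
by rewrite expr0n expn_eq0 (gtn_eqF (ltnW (p_gt1 D))) /= scale0r addr0.
Qed.

(** The pole of c -> c / (1 + z c): the coset becomes that of alpha, and since the upper left entry
    of k is p, X^s goes to a multiple of Y^s. *)
Lemma coset_inf c z : 1 + z * c = 0 -> exists k : GL2 OF,
  (KZelt 0 (lgl (teich z)) * gl_teich c = gl_alpha D * KZelt 0 k)%g /\
  act k xs = zeta z ^+ pval p s *: ys.
Proof.
move=> e0; set t := teich z; set u := teich c.
have [w ew] : exists w, 1 + t * u = p%:R * w.
  apply: resF_dvd; rewrite rmorphD rmorph1 rmorphM !res_teich; exact: e0.
have dk : p%:R * w - u * t = 1 :> OF by rewrite -ew [u * t]mulrC addrK.
have [k ek] := mx_GL2 dk.
exists k; split.
  have evw : 1 + val t * val u = p%:R * val w.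
    by have e := congr1 val ew; rewrite val_OFM val_natOF in e; exact: e.
  apply: G_eq => i j; rewrite /= ek !expr0z !scale1r !mxE !sum2 !mxE /=.
  case: (i == 0); case: (j == 0); rewrite /= ?mulr1 ?mulr0 ?mul1r ?mul0r ?addr0 ?add0r //.
  - exact/esym/val_natOF.
  - by rewrite mulrC.
  - by rewrite addrC; exact: evw.
apply: vW_inj; rewrite vW_act_xs ek det_mx2 dk.
rewrite (rmorph1 sb) expr1n scale1r vW_Z vW_ys -expr_pval -scaler_prod.
apply: eq_bigr => i _; rewrite -exprZn; congr (_ ^+ _).
have -> : mx2 p%:R u t w 0 0 = p%:R by rewrite mxE.
have -> : mx2 p%:R u t w 1 0 = t by rewrite mxE.
rewrite [sb p%:R](rmorph_nat sb) pK expr0n expn_eq0.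
by rewrite (gtn_eqF (ltnW (p_gt1 D))) /= scale0r add0r.
Qed.

(** The formula for T must respect [g k, v] = [g, k v]. Both sides run over the projective line and
    are matched by c -> c / (1 + z c): the pole c = -1/z on the right gives the alpha-term on the
    left, and the left term with z c = 1 vanishes because s is nonzero. *)
Lemma hecke_lgl g z :
  hecke_elt g (act (lgl (teich z)) xs) =
  hecke_elt (g * KZelt 0 (lgl (teich z)))%g xs :> ind W.
Proof.
pose FF c := elt (g * gl_teich c)%g ((1 - zeta c * zeta z) ^+ pval p s *: xs) : ind W.
have -> : hecke_elt g (act (lgl (teich z)) xs) =
    \sum_c FF c + elt (g * gl_alpha D)%g (zeta z ^+ pval p s *: ys) :> ind W.
  congr (_ + _); last by rewrite -AalK_lgl.
  by apply: eq_bigr => c _; rewrite /FF -AtK_lgl.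
have -> : hecke_elt (g * KZelt 0 (lgl (teich z)))%g xs =
    \sum_c elt (g * (KZelt 0 (lgl (teich z)) * gl_teich c))%g xs :> ind W.
  have e0 : elt (g * KZelt 0 (lgl (teich z)) * gl_alpha D)%g
      (psubst AalK (xs : polyV kb s) : W) = 0 by rewrite AalK_xs linear0.
  apply: etrans (addr0 _); congr (_ + _); last exact: e0.
  by apply: eq_bigr => c _; rewrite mulgA -[in RHS](AtK_xs c).
have zM : forall a b, zeta (a * b) = zeta a * zeta b := rmorphM (@zeta p f D).
have ps := pval_s_gt0.
rewrite [RHS](bigID (fun c => 1 + z * c != 0)) /=; congr (_ + _).
  rewrite (bigID (fun c => 1 - z * c != 0)) /= [X in _ + X]big1 ?addr0; last first.
    move=> c /negPn/eqP ec; rewrite /FF -zM mulrC.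
    rewrite -(rmorph1 (@zeta p f D)) -(rmorphB (@zeta p f D)) ec rmorph0 expr0n.
    by rewrite (gtn_eqF ps) scale0r linear0.
  rewrite (reindex_onto (fun c => c / (1 + z * c)) (fun c => c / (1 - z * c))) /=.
    have hE c : 1 + z * c != 0 -> 1 - z * (c / (1 + z * c)) = (1 + z * c)^-1.
      by move=> n0; field.
    rewrite (eq_bigl (fun c => 1 + z * c != 0)); last first.
      move=> c; have [e0|n0] := eqVneq (1 + z * c) 0.
        rewrite e0 invr0 mulr0 mulr0 subr0 oner_neq0 invr1 mulr1 /=.
        by apply/eqP => c0; move: e0; rewrite -c0 mulr0 addr0 => /eqP; rewrite oner_eq0.
      by rewrite hE // invr_eq0 n0 invrK divfK // eqxx.
    apply: eq_bigr => c n0; have [k [-> ek]] := coset_fin n0.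
    by rewrite mulgA elt_KZ ek.
  move=> c n0.
  have e : 1 + z * (c / (1 - z * c)) = (1 - z * c)^-1 by field.
  by rewrite e invrK divfK.
(* For z = 0 there is no pole, and the alpha-term carries the factor 0^(pval s) = 0. *)
have [z0|z0] := eqVneq z 0.
  rewrite z0 (rmorph0 (@zeta p f D)) expr0n (gtn_eqF ps) scale0r linear0 big_pred0 // => c.
  by rewrite mul0r addr0 oner_eq0.
rewrite (big_pred1 (- z^-1)) => [|c]; last first.
  rewrite negbK; apply/eqP/eqP => [e|->]; last by rewrite mulrN divff ?subrr.
  by apply: (mulfI z0); rewrite mulrN divff //; apply/eqP; rewrite -addr_eq0 addrC e.
have e0 : 1 + z * (- z^-1) = 0 by rewrite mulrN divff ?subrr.
have [k [-> ek]] := coset_inf e0.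
by rewrite mulgA elt_KZ ek.
Qed.

Lemma hecke_xs g : hecke_elt g xs = \sum_c elt (g * gl_teich c)%g xs :> ind W.
Proof.
have e0 : elt (g * gl_alpha D)%g (psubst AalK (xs : polyV kb s) : W) = 0.
  by rewrite AalK_xs linear0.
apply: etrans (addr0 _); congr (_ + _); last exact: e0.
by apply: eq_bigr => c _; rewrite -[in RHS](AtK_xs c).
Qed.

End HeckeEquivariance.

(** * Vanishing of the Hecke image in F_t *)

Section Main.
Variables (p f : nat) (D : padic_setting p f) (r : 'I_f -> nat) (ap : E D) (h : 'I_f).
Local Notation OF := (intring (vF D)).
Local Notation kb := (kbar D).
Local Notation sb := (structkbar D).
Local Notation G := (GL2 (F D)).
Local Notation V := (Vrep sb r).
Local Notation Q := (repQ D r).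
Local Notation q1 := (p ^ f - 1)%N.
Hypothesis p_gt2 : (2 < p)%N.
Hypothesis r_gt : forall i, (p ^ f + p - 2 < r i)%N.
Hypothesis r_mod : pval p r = p ^ h %[mod q1].
Let f_gt0 : (0 < f)%N := f_gt0_of h.
Variable psiQ : {linear ind Q -> Thetabar r ap}.
Hypothesis psiQ_eps : forall g : G,
  psiQ (\sum_(c : kF D) elt (g * gl_teich c)%g (cls (eps D h r))) = 0.
Variable pi : {linear ind (cosocQ D r) -> Ft psiQ}.
Hypothesis piP : forall x, pi (ind_map (quot_proj _) x) = toFtx psiQ x.
Local Notation S1 := (socfil Q f).
Local Notation S0 := (socfil Q f.-1).
Local Notation RS := (res_sub S1 S0).

Lemma RS_qclass0 (w : sub_rep S1) : S0 (val (w : submod S1)) -> qclass RS w = 0.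
Proof.
by move=> hw; rewrite -(linear0 (qclass RS)); apply/qclass_eq; rewrite subr0.
Qed.

(** The image of X^s is lifted from the cosocle to Q_f and then to V, where its invariance becomes a
    congruence modulo Q_(f-1). A zero image of X^s already forces iota = 0, since X^s generates the
    weight. *)
Lemma hecke_iota_vanish (s : 'I_f -> nat) (m : nat)
    (iota : equivar (weight_rep sb s m) (cosocQ D r)) :
  (forall i, (s i < p)%N) -> (forall a v, iota (a *: v) = a *: iota v) ->
  forall g v, pi (ind_map iota (hecke_elt g v)) = 0.
Proof.
move=> s_lt iZ.
have iotaP a u v : iota (a *: u + v) = a *: iota u + iota v by rewrite raddfD iZ.
have heckeP g a u v : hecke_elt g (a *: u + v) =
    a *: hecke_elt g u + hecke_elt g v :> ind (weight_rep sb s m).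
  rewrite /hecke_elt scalerDr addrACA; congr (_ + _); last first.
    by rewrite psubst_lin; apply: eltP.
  rewrite scaler_sumr -big_split; apply: eq_bigr => c _.
  by rewrite psubst_lin; apply: eltP.
pose X := xs D s m.
have zero_case : iota X = 0 -> forall g v, pi (ind_map iota (hecke_elt g v)) = 0.
  move=> iX g v.
  have k0 : iota 0 = 0 by rewrite raddf0.
  have kP a u w : iota u = 0 -> iota w = 0 -> iota (a *: u + w) = 0.
    by move=> hu hw; rewrite iotaP hu hw scaler0 addr0.
  have i0 u : iota u = 0.
    apply: (span_lgl p_gt2 f_gt0 s_lt (S := Submodule k0 kP)) => z.
    change (iota (act (lgl (teich z)) X) = 0).
    have -> : iota (act (lgl (teich z)) X) = act (lgl (teich z)) (iota X) :=
      equivar_act _ _ _.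
    by rewrite iX; apply: linear0.
  have -> : ind_map iota (hecke_elt g v) = 0; last exact: linear0.
  by apply: ind_eq => g'; apply: i0.
have [w0 ew0] : exists w0 : sub_rep S1, qclass RS w0 = iota X.
  by exists (repr (iota X)); apply: qclass_repr.
have [v0 ev0] := cls_surj (val (w0 : submod S1)).
have S0_act k (e : kb) : act k X = e *: X -> S0 (cls (act k v0) - e *: cls v0).
  move=> ek.
  have : qclass RS (act k w0) = qclass RS (e *: w0).
    by rewrite qclass_act ew0 -equivar_act ek iZ -ew0 linearZ.
  by move/qclass_eq; rewrite cls_act ev0.
have hU z : S0 (cls (act (ugl (teich z)) v0) - cls v0).
  have := @S0_act (ugl (teich z)) 1; rewrite !scale1r; apply.
  exact: act_ugl_xs.
have S0_zero : S0 (cls v0) -> iota X = 0.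
  by move=> hv; rewrite -ew0; apply: RS_qclass0; rewrite -ev0.
have [all0|[c hc]] := cosoc_cases p_gt2 r_gt r_mod hU.
  exact: zero_case (S0_zero (all0 v0)).
(* For s = 0 the alpha-term survives on X^s. But then the Weyl element scales X^s by det(w)^m, so
   its image in the cosocle is zero. *)
have [s_pos|s0] := pselect (exists i, (0 < s i)%N); last first.
  apply: zero_case; apply: S0_zero.
  apply: (cosoc_semi_invariant p_gt2 r_gt r_mod hU (e := sb (\det (val (wgl D))) ^+ m)).
  apply: S0_act; apply: vW_inj; rewrite vW_act_xs vW_Z vW_xs; congr (_ *: _).
  have sz i : s i = 0%N by apply/eqP; rewrite -leqn0 leqNgt; apply/negP => hi; apply: s0; exists i.
  by apply: eq_bigr => i _; rewrite sz !expr0.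
move=> g v; move: v g.
have z0 g : pi (ind_map iota (hecke_elt g 0)) = 0.
  have -> : hecke_elt g 0 = 0 :> ind (weight_rep sb s m).
    have := heckeP g (-1) 0 0; rewrite scaler0 addr0 scaleN1r addNr; exact.
  by rewrite ind_map0 linear0.
have ilin := ind_map_lin iZ.
pose mem v := forall g, pi (ind_map iota (hecke_elt g v)) = 0.
have memP a u v : mem u -> mem v -> mem (a *: u + v).
  by move=> hu hv g; rewrite heckeP ilin linearP hu hv scaler0 addr0.
apply: (span_lgl p_gt2 f_gt0 s_lt (S := Submodule (z0 : mem 0) memP)) => z g.
change (pi (ind_map iota (hecke_elt g (act (lgl (teich z)) X))) = 0).
rewrite /X hecke_lgl // hecke_xs // ind_map_sum.
under eq_bigr do rewrite ind_map_elt -/X -ew0.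
transitivity (pi (ind_map (quot_proj RS)
    (\sum_(c0 : kF D) elt (g * KZelt 0 (lgl (teich z)) * gl_teich c0)%g w0))).
  congr (pi _); rewrite ind_map_sum; apply: eq_bigr => c0 _.
  by rewrite (ind_map_elt (quot_proj RS)).
rewrite piP; apply: toFtx_eq0; rewrite ind_map_sum.
under eq_bigr do rewrite ind_map_elt.
set g1 := (g * _)%g.
(* The error lies in Q_(f-1), so its contribution falls into F_(f-1) and dies in F_t. *)
pose n0 : Q := cls v0 - c *: cls (eps D h r).
have vE : val (w0 : submod S1) = c *: cls (eps D h r) + n0.
  by rewrite -ev0 /n0 addrC subrK.
have -> : \sum_(c0 : kF D) elt (g1 * gl_teich c0)%g (val (w0 : submod S1) : Q) =
   c *: (\sum_c0 elt (g1 * gl_teich c0)%g (cls (eps D h r))) +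
   \sum_c0 elt (g1 * gl_teich c0)%g n0 :> ind Q.
  rewrite scaler_sumr -big_split; apply: eq_bigr => c0 _.
  by rewrite vE; apply: eltP.
rewrite linearP psiQ_eps scaler0 add0r.
exists (\sum_c0 elt (g1 * gl_teich c0)%g n0) => //.
by move=> g'; rewrite ind_fun_sum; apply: smem_sum => c0 _; apply: elt_ind_in.
Qed.

Lemma hecke_image_vanish y : hecke_image (cosocQ D r) y -> pi y = 0.
Proof.
have z0 : pi 0 = 0 by apply: linear0.
have zP a x x' : pi x = 0 -> pi x' = 0 -> pi (a *: x + x') = 0.
  by move=> hx hx'; rewrite linearP hx hx' scaler0 addr0.
move=> hy; apply: (hy (Submodule z0 zP)) => z [s [m [iota [x [x' [s_lt iZ [l [_ ->]] ->]]]]]].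
rewrite /= ind_map_sum linear_sum big1 // => gv _.
exact: hecke_iota_vanish.
Qed.

End Main.

(** * The valuation of a_p^2 - p r_h *)

Section Discriminant.
Variables (p f : nat) (D : padic_setting p f) (ap : E D) (n : nat).
Hypothesis n_gt0 : (0 < n)%N.
Hypothesis ap0 : ap != 0.
Hypothesis ap_gt0 : 0 < vE D ap.
Hypothesis ap_lt1 : vE D ap < 1.

(** Below 1/2 the term a_p^2 dominates. Above 1/2 the term p n dominates if p does not divide n;
    otherwise a_p^2 does again, as v(p n) >= 2 > 2 v(a_p). At 1/2 the unit condition gives valuation
    exactly 1. *)
Lemma discriminant_val :
  vE D ap <> 2^-1 \/ (vE D ap = 2^-1 /\
     padic_unit (vE D) ((ap ^+ 2 - p%:R * n%:R) / p%:R)) ->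
  [/\ ap ^+ 2 - p%:R * n%:R != 0,
      vE D (ap ^+ 2 - p%:R * n%:R) < 1 + vE D ap &
      vE D (ap ^+ 2 - p%:R * n%:R) < vE D ap *+ 3].
Proof.
have p0 := pE_neq0 D; have [nn0 vn] := vE_nat D n_gt0.
have y0 : p%:R * n%:R != 0 :> E D by rewrite mulf_neq0.
have x0 : ap ^+ 2 != 0 by rewrite expf_neq0.
have vx : vE D (ap ^+ 2) = vE D ap *+ 2 by rewrite vfunX.
have vy : vE D (p%:R * n%:R) = 1 + (logn p n)%:R by rewrite vfunM // vE_p vn.
have l0 : 0 <= (logn p n)%:R :> rat by apply: ler0n.
move=> [ne|[e [u0 vu]]]; last first.
  have c0 : ap ^+ 2 - p%:R * n%:R != 0.
    by apply: contra_neq u0 => ->; rewrite mul0r.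
  have vc : vE D (ap ^+ 2 - p%:R * n%:R) = 1.
    by move: vu; rewrite vfunM ?invr_eq0 // vV // vE_p => /eqP; rewrite subr_eq0 => /eqP.
  by split=> //; rewrite vc e; lra.
have [lt|] := ltP (vE D ap) 2^-1.
  have [|c0 ->] := vsub_lt (v := vE D) x0 y0; first by rewrite vx vy; lra.
  by split=> //; rewrite vx; [rewrite mulr2n ltrD2r | rewrite [ltRHS]mulrSr ltrDl].
rewrite le_eqVlt => /orP[/eqP e|gt]; first by case: ne.
have [l|l] := posnP (logn p n).
  have [|c0 vc] := vsub_lt (v := vE D) y0 x0; first by rewrite vx vy l; lra.
  have eN : ap ^+ 2 - p%:R * n%:R = - 1 * (p%:R * n%:R - ap ^+ 2) by rewrite mulN1r opprB.
  have vN : vE D (ap ^+ 2 - p%:R * n%:R) = 1.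
    by rewrite eN vfunM ?oppr_eq0 ?oner_neq0 // vN1 add0r vc vy l addr0.
  split; rewrite ?vN; [by rewrite eN mulf_neq0 ?oppr_eq0 ?oner_neq0 | by lra | by lra].
have l1 : 1 <= (logn p n)%:R :> rat by rewrite ler1n.
have [|c0 ->] := vsub_lt (v := vE D) x0 y0.
  by rewrite vx vy mulr2n; apply: ltr_leD => //; apply: le_trans (ltW ap_lt1) l1.
by split=> //; rewrite vx; [rewrite mulr2n ltrD2r | rewrite [ltRHS]mulrSr ltrDl].
Qed.

End Discriminant.

Theorem theorem8p3 (p f : nat) (D : padic_setting p f) (k : 'I_f -> nat)
    (h : 'I_f) (ap : E D) :
  let r := fun i : 'I_f => (k i - 2)%N in
  (2 < p)%N -> (1 <= f)%N ->
  (forall i, (p ^ f + p - 2 < r i)%N) ->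
  (\sum_(i < f) r i * p ^ i = p ^ h %[mod p ^ f - 1])%N ->
  ap != 0 -> 0 < vE D ap -> vE D ap < 1 ->
  vE D ap <> 2^-1 \/
    (vE D ap = 2^-1 /\
     padic_unit (vE D) ((ap ^+ 2 - p%:R * (r h)%:R) / p%:R)) ->
  exists (psi : {linear ind (Vrep (structkbar D) r) -> Thetabar r ap})
         (psiQ : {linear ind (repQ D r) -> Thetabar r ap})
         (pi : {linear ind (cosocQ D r) -> Ft psiQ}),
    [/\ natural_surj psi,
        forall x, psiQ (ind_map (projQ D r) x) = psi x,
        induced_surj pi
      & forall y, hecke_image (cosocQ D r) y -> pi y = 0].
Proof.
move=> r p_gt2 f_gt0 r_gt r_mod ap0 ap_gt0 ap_lt1 hap.
have [psi psi_nat] := natural_surj_ex r ap.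
have [|psiQ psiQE] := @ind_factor p f D (kbar D) (Vrep (structkbar D) r) (Qker D r) _ psi.
  exact: (kill_Qker p_gt2 r_gt r_mod ap0 ap_gt0 ap_lt1 psi_nat).
have [pi pi_ind piP] := induced_ex psiQ.
exists psi, psiQ, pi; split=> // y.
have rh0 : (0 < r h)%N by apply: leq_ltn_trans (r_gt h).
have [c0 v1 v2] := discriminant_val rh0 ap0 ap_gt0 ap_lt1 hap.
apply: (hecke_image_vanish p_gt2 r_gt r_mod) => // g.
have <- := kill_eps p_gt2 r_gt r_mod ap0 ap_gt0 ap_lt1 psi_nat g c0 v1 v2.
rewrite -psiQE ind_map_sum; congr (psiQ _).
by apply: eq_bigr => c _; rewrite ind_map_elt.
Qed.
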